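(* Let $C\subset\mathbb{R}^2$ be a convex body, and let $I=(\alpha,\beta]\subset\mathbb{T}_{2\pi}$ be a left semi-open interval. It holds $$\lim_{\lambda\to0^+}\frac{1}{2\lambda}\int_I\left|K_C^+(\theta,\lambda)\right|^2 d\theta=P_C(I).$$
   Context: For $p>0$, $\mathbb{T}_p=\mathbb{R}/p\mathbb{Z}$, and $\eta_p:\mathbb{T}_p\times\mathbb{T}_p\to[0,p)$ is the ordered-distance function: $\eta_p(x_1,x_2)=y$ iff $x_1+y\equiv x_2\pmod p$. $\mathbf{u}(\theta)=(\cos\theta,\sin\theta)$ and $\mathbf{u}'(\theta)=(-\sin\theta,\cos\theta)$. A convex body is a bounded convex subset of $\mathbb{R}^2$ with non-empty interior. $|\cdot|$ is length / one-dimensional Lebesgue measure. Intervals of angles have positive length. Let $\boldsymbol{\Gamma}_C:\mathbb{T}_{|\partial C|}\to\mathbb{R}^2$ be the (counterclockwise) arc-length parameterization of $\partial C$, with $|\partial C|$ the perimeter. For $s\in\mathbb{T}_{|\partial C|}$, $\nu_C(s)=\{\theta\in\mathbb{T}_{2\pi}:\inf_{\mathbf{a}\in C}\mathbf{a}\cdot\mathbf{u}(\theta)=\boldsymbol{\Gamma}_C(s)\cdot\mathbf{u}(\theta)\}$. The portion of perimeter with respect to $I$ is $P_C(I)=|\{s\in\mathbb{T}_{|\partial C|}:\nu_C(s)\cap I\ne\varnothing\}|$. For $\theta\in\mathbb{T}_{2\pi}$ and $\lambda>0$, the chord of $C$ in direction $\mathbf{u}(\theta)$ at distance $\lambda$ is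 the segment $K_C(\theta,\lambda)=\{\mathbf{x}\in C:\mathbf{x}\cdot\mathbf{u}(\theta)=\inf_{\mathbf{y}\in C}(\mathbf{y}\cdot\mathbf{u}(\theta))+\lambda\}$. Let $s_C^-(\theta,\lambda)$ and $s_C^+(\theta,\lambda)$ be the parameters (under $\boldsymbol{\Gamma}_C$) of the extreme points of $K_C(\theta,\lambda)$, named so that $\boldsymbol{\Gamma}_C(s_C^-(\theta,\lambda))-\boldsymbol{\Gamma}_C(s_C^+(\theta,\lambda))=|K_C(\theta,\lambda)|\,\mathbf{u}'(\theta)$. Put $s_C^{o^\pm}(\theta)=\lim_{\lambda\to0^+}s_C^\pm(\theta,\lambda)$ and $$s_C^o(\theta)=s_C^{o^-}(\theta)+\tfrac12\,\eta_{|\partial C|}\big(s_C^{o^-}(\theta),s_C^{o^+}(\theta)\big).$$ The right semi-chord $K_C^+(\theta,\lambda)$ is the projection, in direction $\mathbf{u}(\theta)$, of the boundary arc $\boldsymbol{\Gamma}_C([s_C^o(\theta),s_C^+(\theta,\lambda)])$ on (the line containing) $K_C(\theta,\lambda)$, and $|K_C^+(\theta,\lambda)|$ is its length. *)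

(* Defs.v *)
From HB Require Import structures.
From mathcomp Require Import all_boot all_order all_algebra.
From mathcomp Require Import all_classical all_reals all_analysis.

Set Implicit Arguments.
Unset Strict Implicit.
Unset Printing Implicit Defensive.

Import Order.TTheory GRing.Theory Num.Theory.
Import numFieldNormedType.Exports.

Local Open Scope classical_set_scope.
Local Open Scope ring_scope.

(* R^o (convertible to R) carries the module structure needed by the
   topology, norm and convexity of the product. *)
Notation plane R := (R^o * R^o)%type.

(* Points of the circle T_p = R / pZ are denoted by real representatives; functions on T_p are
   p-periodic functions on R. *)

Definition eta (R : realType) (p x1 x2 : R) : R :=
  x2 - x1 - p * (Num.floor ((x2 - x1) / p))%:~R.

Lemma etaP (R : realType) (p x1 x2 y : R) : 0 < p ->
  y = eta p x1 x2 <->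
  0 <= y < p /\ exists k : int, x1 + y = x2 + p * k%:~R.
Proof.
move=> p0; have pn0 : p != 0 by rewrite gt_eqF.
rewrite /eta; set z := x2 - x1.
split=> [->|[/andP[y0 yp] [k Hk]]].
  split; last first.
    exists (- Num.floor (z / p)); rewrite /z intrN mulrN.
    by rewrite addrA addrCA subrr addr0.
  have /andP[h1 h2] := floor_itv (z / p).
  rewrite subr_ge0 ltrBlDr mulrC -ler_pdivlMr // h1 /=.
  by rewrite -[X in X + _]mul1r -mulrDl addrC -ltr_pdivrMr // -intrD1.
have ey : y = z + p * k%:~R by rewrite /z addrAC -Hk addrC addKr.
suff -> : Num.floor (z / p) = - k by rewrite intrN mulrN opprK.
apply: floor_def; rewrite intrD intrN ler_pdivlMr // ltr_pdivrMr //.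
have -> : z = y - k%:~R * p by rewrite ey mulrC addrK.
by rewrite mulNr lerDr y0 mulrDl mulNr mul1r addrC ltrD2l.
Qed.

(* The quotient metric of T_p. *)
Definition circle_dist (R : realType) (p x y : R) : R :=
  Num.min (eta p x y) (eta p y x).

Definition cvg_circle_at0 (R : realType) (p : R) (f : R -> R) (l : R) : Prop :=
  circle_dist p (f lambda) l @[lambda --> 0^'+] --> (0 : R).

Definition dot (R : realType) (x y : plane R) : R := x.1 * y.1 + x.2 * y.2.

Definition enorm (R : realType) (x : plane R) : R := Num.sqrt (dot x x).

Definition u (R : realType) (theta : R) : plane R := (cos theta, sin theta).

Definition u' (R : realType) (theta : R) : plane R := (- sin theta, cos theta).

Definition convex_body (R : realType) (C : set (plane R)) : Prop :=
  [/\ bounded_set C, convex_set C & C° !=set0].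

Definition boundary (R : realType) (C : set (plane R)) : set (plane R) :=
  closure C `\` C°.

Definition extreme_points (R : realType) (A : set (plane R)) : set (plane R) :=
  [set x | A x /\ forall a b t, A a -> A b -> 0 < t < 1 ->
             x = t *: a + (1 - t) *: b -> a = b].

(* One-dimensional Lebesgue measure of a subset A of a line directed by
   u' theta, read off in the isometric coordinate x |-> x . u' theta. *)
Definition line_length (R : realType) (theta : R) (A : set (plane R)) : \bar R :=
  lebesgue_measure [set dot x (u' theta) | x in A].

Definition polygon_length (R : realType) (a b : R) (Gamma : R -> plane R)
    (s : seq R) : R :=
  let F := Gamma \o nth b (a :: s) in
  \sum_(0 <= n < size s) enorm (F n.+1 - F n).

Definition curve_length (R : realType) (Gamma : R -> plane R) (a b : R) : \bar R :=
  ereal_sup [set (polygon_length a b Gamma s)%:E | s in itv_partition a b].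

(* The winding number of the L-periodic curve Gamma around c is 1: phi is a
   continuous determination of the polar angle around c. *)
Definition winds_once_ccw (R : realType) (L : R) (Gamma : R -> plane R)
    (c : plane R) : Prop :=
  exists phi : R -> R,
    [/\ continuous phi,
        forall s, Gamma s - c = enorm (Gamma s - c) *: u (phi s) &
        forall s, phi (s + L) = phi s + 2 * pi].

(* Gamma : T_L -> R^2 is a counterclockwise arc-length parameterization of the
   boundary of C; in particular L is the perimeter of C. *)
Record arclength_param (R : realType) (C : set (plane R)) (L : R)
    (Gamma : R -> plane R) : Prop := ArclengthParam {
  param_period_gt0 : 0 < L ;
  param_periodic : forall s, Gamma (s + L) = Gamma s ;
  param_inj : {in `[0, L[ &, injective Gamma} ;
  param_image : Gamma @` `[0, L[ = boundary C ;
  param_arclength :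
    forall a b, a <= b -> curve_length Gamma a b = (b - a)%:E ;
  param_ccw : forall c, C° c -> winds_once_ccw L Gamma c }.

Definition support_inf (R : realType) (C : set (plane R)) (theta : R) : R :=
  inf [set dot a (u theta) | a in C].

Definition nu (R : realType) (C : set (plane R)) (Gamma : R -> plane R)
    (s : R) : set R :=
  [set theta | support_inf C theta = dot (Gamma s) (u theta)].

Definition perimeter_portion (R : realType) (C : set (plane R)) (L : R)
    (Gamma : R -> plane R) (I : set R) : \bar R :=
  lebesgue_measure [set s | 0 <= s < L /\ (nu C Gamma s `&` I) !=set0].

Definition chord (R : realType) (C : set (plane R)) (theta lambda : R) :
    set (plane R) :=
  C `&` [set x | dot x (u theta) = support_inf C theta + lambda].

(* C need not be closed, so that the end points of its chords may be missing
   from C: hence the closure. *)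
Definition chord_ends (R : realType) (C : set (plane R)) (L : R)
    (Gamma : R -> plane R) (theta lambda : R) (s : R * R) : Prop :=
  [/\ 0 <= s.1 < L, 0 <= s.2 < L,
      extreme_points (closure (chord C theta lambda)) =
        [set Gamma s.1; Gamma s.2] &
      Gamma s.1 - Gamma s.2 =
        fine (line_length theta (chord C theta lambda)) *: u' theta].

(* Meaningful when 0 < lambda < the width of C in direction u theta, in which
   case chord_ends holds for exactly one pair; get returns an arbitrary value
   otherwise. *)
Definition s_minus (R : realType) (C : set (plane R)) (L : R)
    (Gamma : R -> plane R) (theta lambda : R) : R :=
  (get (chord_ends C L Gamma theta lambda)).1.

Definition s_plus (R : realType) (C : set (plane R)) (L : R)
    (Gamma : R -> plane R) (theta lambda : R) : R :=
  (get (chord_ends C L Gamma theta lambda)).2.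

(* Limit in T_L of f lambda as lambda --> 0^'+, as a representative in
   [0, L[. *)
Definition circle_lim_at0 (R : realType) (L : R) (f : R -> R) : R :=
  get [set l | 0 <= l < L /\ cvg_circle_at0 L f l].

Definition s_o_minus (R : realType) (C : set (plane R)) (L : R)
    (Gamma : R -> plane R) (theta : R) : R :=
  circle_lim_at0 L (s_minus C L Gamma theta).

Definition s_o_plus (R : realType) (C : set (plane R)) (L : R)
    (Gamma : R -> plane R) (theta : R) : R :=
  circle_lim_at0 L (s_plus C L Gamma theta).

Definition s_o (R : realType) (C : set (plane R)) (L : R)
    (Gamma : R -> plane R) (theta : R) : R :=
  s_o_minus C L Gamma theta
  + 2^-1 * eta L (s_o_minus C L Gamma theta) (s_o_plus C L Gamma theta).

(* The arc of T_L going counterclockwise from a to b, as a set of real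
   representatives. *)
Definition circle_arc (R : realType) (L a b : R) : set R :=
  [set s | a <= s <= a + eta L a b].

Definition right_semichord (R : realType) (C : set (plane R)) (L : R)
    (Gamma : R -> plane R) (theta lambda : R) : set (plane R) :=
  [set y | dot y (u theta) = support_inf C theta + lambda /\
     exists2 x : plane R,
       (Gamma @` circle_arc L (s_o C L Gamma theta)
                              (s_plus C L Gamma theta lambda)) x &
       exists t : R, y = x + t *: u theta].

Definition right_semichord_length (R : realType) (C : set (plane R)) (L : R)
    (Gamma : R -> plane R) (theta lambda : R) : \bar R :=
  line_length theta (right_semichord C L Gamma theta lambda).

(* Main.v *)
Require Import Defs.
From HB Require Import structures.
From mathcomp Require Import all_boot all_order all_algebra.
From mathcomp Require Import all_classical all_reals all_analysis.
From mathcomp Require Import measurable_realfun ring lra.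

Set Implicit Arguments.
Unset Strict Implicit.
Unset Printing Implicit Defensive.

Import Order.TTheory GRing.Theory Num.Theory.
Import numFieldNormedType.Exports.

Local Open Scope classical_set_scope.
Local Open Scope ring_scope.

(* Let f(t,s) = Gamma s . u t - h t be the height of Gamma s above the support
   line of direction t, sigma t the last parameter of its face, lifted to a
   nondecreasing right-continuous function on the real line, and
   q(t,s) = (Gamma (sigma t) - Gamma s) . u' t the distance of Gamma s to the
   right of the face.  For all t outside a countable set, |K+(t,lambda)| is
   q(t,s') up to O(lambda), where s' is the last parameter at height at most
   lambda, cut off at sigma (t + eps).  Between sigma t and sigma (t + eps) the
   slope of q(t,.) lies in [cos eps, 1], so q(t,s')^2 / 2 lies between cos eps
   and 1 times the integral of q(t,.) over [sigma t, s'].  By Tonelli the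
   integral of q over this strip can be taken first in t; since
   q = - df/dt, it equals for each fixed s the drop of the height f(.,s), which
   is lambda for all s but those close to the ends.  Hence the limit is
   sigma beta - sigma alpha, which is also the perimeter portion. *)

(** * Integrals on the real line *)

(** At a direction whose face is a segment, f(.,s) has no derivative, so q = - df/dt enters only as
    a subgradient inequality with an error quadratic in the step; this form still integrates
    exactly. The countable exceptional set consists of these directions, where [s_o] is the middle
    of the face and not its end. The cut-off is forced by the slope of q: between the faces of t and
    t + eps the tangent turns by at most eps, but further along it may point anywhere. The part of
    the boundary beyond the cut-off and below height lambda adds at most lambda / sin eps to the
    length. For the lower bound the directions are divided into short intervals, with the cut-off at
    the face of the right end of each, so that no parameter beyond sigma beta comes in. *)

Section real_integrals.
Context {R : realType}.
Local Notation mu := (@lebesgue_measure R).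

(* The integral of a nonnegative function is a supremum over simple functions
   below it, hence monotone without any measurability: the semi-chord lengths
   are never shown to be measurable. *)
Lemma ge0_le_integralW d (T : measurableType d) (m : {measure set T -> \bar R})
    (D : set T) (f g : T -> \bar R) :
  (forall x, D x -> 0 <= f x)%E -> (forall x, D x -> f x <= g x)%E ->
  (\int[m]_(x in D) f x <= \int[m]_(x in D) g x)%E.
Proof.
move=> f0 fg; rewrite (integral_mkcond D f) (integral_mkcond D g).
have f0' x : (0 <= (f \_ D) x)%E by apply: erestrict_ge0.
have fg' x : ((f \_ D) x <= (g \_ D) x)%E by apply: lee_restrict.
have g0' x : (0 <= (g \_ D) x)%E by exact: le_trans (fg' x).
rewrite !ge0_integralTE//; apply: ereal_sup_le; apply: image_subset => h /= hf x.
exact: le_trans (fg' x).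
Qed.


Section almost_everywhere.
Context d (T : measurableType d) (m : {measure set T -> \bar R}).
Variables (D N : set T) (f g : T -> \bar R).
Hypotheses (mD : measurable D) (mN : measurable N) (N0 : m N = 0).
Hypotheses (f0 : (forall x, 0 <= f x)%E) (g0 : (forall x, 0 <= g x)%E).
Hypothesis fg : forall x, D x -> ~ N x -> (f x <= g x)%E.

(** Only the measurable side is altered on the null set: [g] is raised to infinity on [N], which
    keeps its integral and makes it dominate [f] on all of [D], so that plain monotonicity
    applies. *)
Lemma ae_le_integralWl : measurable_fun D g ->
  (\int[m]_(x in D) f x <= \int[m]_(x in D) g x)%E.
Proof.
move=> mg; pose h x := (g x + ((fun=> +oo) \_ N) x)%E.
have noo0 x : (0 <= ((fun=> +oo%E) \_ N : T -> \bar R) x)%E.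
  by apply: erestrict_ge0 => y _; exact: leey.
have h0 x : (0 <= h x)%E by rewrite adde_ge0.
have mh : measurable_fun D h.
  apply: emeasurable_funD => //; apply: measurable_funTS.
  by apply/(measurable_restrictT _ _).1 => //; exact: measurable_cst.
apply: (@le_trans _ _ (\int[m]_(x in D) h x)%E).
  apply: ge0_le_integralW => // x Dx; rewrite /h patchE; case: ifPn => [_|].
    by rewrite addey ?leey// gt_eqF// (lt_le_trans _ (g0 x))// ltNy0.
  by rewrite notin_setE adde0; exact: fg.
rewrite !(ge0_negligible_integral mN mD)// le_eqVlt; apply/orP; left; apply/eqP.
apply: eq_integral => x; rewrite inE => -[_ Nx].
by rewrite /h patchE memNset// adde0.
Qed.

(** Here [f] is the measurable side and may be cut down to the complement of [N]. *)
Lemma ae_le_integralWr : measurable_fun D f ->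
  (\int[m]_(x in D) f x <= \int[m]_(x in D) g x)%E.
Proof.
move=> mf; rewrite (ge0_negligible_integral mN mD)//.
rewrite integral_mkcond [leRHS]integral_mkcond.
apply: ge0_le_integralW => x _; first by apply: erestrict_ge0.
rewrite !patchE; case: ifPn => [|_]; last by case: ifPn.
by rewrite inE => -[Dx Nx]; rewrite mem_set//; exact: fg.
Qed.

End almost_everywhere.

(** Over a subdivision into equal cells of width [w] the increments of [G] telescope, so the
    increment of [D] is at most [w] times that of [G], for [w] as small as desired. *)
Lemma eq_of_quadratic_increments (D G : R -> R) (a b : R) : a <= b ->
  (forall x y, a <= x -> x <= y -> y <= b ->
     `|D y - D x| <= (G y - G x) * (y - x)) ->
  D a = D b.
Proof.
move=> ab H; pose w (n : nat) : R := (b - a) / n.+1%:R.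
have w0 n : 0 <= w n by rewrite divr_ge0// subr_ge0.
have step n k : (k <= n.+1)%N ->
    `|D (a + k%:R * w n) - D a| <= (G (a + k%:R * w n) - G a) * w n.
  elim: k => [|k IH] kn; first by rewrite mul0r addr0 !subrr normr0 mul0r.
  set x := a + k%:R * w n; set y := a + k.+1%:R * w n.
  have yx : y - x = w n by rewrite /x /y -natr1; ring.
  have yb : y <= b.
    have -> : b = a + n.+1%:R * w n.
      by rewrite /w mulrCA divff ?pnatr_eq0// mulr1 addrC subrK.
    by rewrite lerD2l ler_wpM2r// ler_nat.
  have -> : D y - D a = (D y - D x) + (D x - D a) by ring.
  apply: (le_trans (ler_normD _ _)).
  have -> : (G y - G a) * w n = (G y - G x) * w n + (G x - G a) * w n by ring.
  apply: lerD; last exact: IH (ltnW kn).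
  rewrite -yx; apply: H => //; first by rewrite lerDl mulr_ge0.
  by rewrite -subr_ge0 yx.
have key n : `|D b - D a| <= (G b - G a) * w n.
  have := step n n.+1 (leqnn _).
  have -> : a + n.+1%:R * w n = b.
    by rewrite /w mulrCA divff ?pnatr_eq0// mulr1 addrC subrK.
  by [].
apply/eqP; rewrite eq_sym -subr_eq0 -normr_le0; apply/ler_addgt0Pr => e e0.
rewrite add0r.
have [c0|c0] := leP ((G b - G a) * (b - a)) 0.
  apply: le_trans (key 0%N) _; rewrite /w divr1; exact: le_trans c0 (ltW e0).
pose n := Num.truncn ((G b - G a) * (b - a) / e).
apply: (le_trans (key n)); rewrite /w mulrA ler_pdivrMr// -ler_pdivrMl//.
by rewrite mulrC; exact/ltW/truncnS_gt.
Qed.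

(* The hypothesis says that q is a subgradient of the semiconvex function H:
   q + 2 M id is a subgradient of the convex function H + M id^2, hence
   nondecreasing. *)
Section semiconvex.
Variables (H q : R -> R) (M : R).
Hypothesis Hq : forall x y, q x * (y - x) - M * (y - x) ^+ 2 <= H y - H x.
Hypothesis M0 : 0 <= M.

Let Q x := q x + 2 * M * x.

Let Qnd : nondecreasing_fun Q.
Proof.
move=> x y; rewrite le_eqVlt => /predU1P[->//|xy].
have := Hq x y; have := Hq y x => h1 h2; rewrite /Q -subr_ge0.
have d0 : 0 < y - x by rewrite subr_gt0.
rewrite -(pmulr_lge0 _ d0); nra.
Qed.

Lemma semiconvex_measurable (D : set R) : measurable D -> measurable_fun D q.
Proof.
move=> mD; rewrite (_ : q = Q \- (fun x => 2 * M * x)).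
  apply: measurable_funB; first exact: nondecreasing_measurable.
  exact: measurable_funM.
by apply/funext => x; rewrite /Q /= addrK.
Qed.

Lemma semiconvex_integrable (a b : R) :
  mu.-integrable `[a, b] (EFin \o q).
Proof.
apply: measurable_bounded_integrable => //.
- by rewrite /= lebesgue_measure_itv/=; case: ifPn => // _; rewrite -EFinB ltry.
- exact: semiconvex_measurable.
- exists (`|Q a| + `|Q b| + 2 * `|M| * (`|a| + `|b|)); split; first exact: num_real.
  move=> B hB x /=; rewrite in_itv/= => /andP[ax xb]; apply: le_trans (ltW hB).
  have -> : q x = Q x - 2 * M * x by rewrite /Q; ring.
  apply: (le_trans (ler_normB _ _)); apply: lerD.
    have := Qnd ax; have := Qnd xb => h1 h2.
    rewrite ler_norml; have := ler_norm (Q b); have := ler_norm (- Q a).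
    have := normr_ge0 (Q a); have := normr_ge0 (Q b).
    by rewrite normrN => *; apply/andP; split; lra.
  rewrite !normrM ger0_norm// ler_wpM2l ?mulr_ge0//.
  rewrite ler_norml; have := ler_norm (b); have := ler_norm (- a).
  have := normr_ge0 (a); have := normr_ge0 (b).
  by rewrite normrN => *; apply/andP; split; lra.
Qed.

(** On a cell of width d both the integral and the increment of [H] lie between [q x] d and [q y] d
    up to O(d^2). Their difference is at most d times the increment of [Q] plus [M] times the
    identity, which is the quadratic bound required above. No derivative of [H] is taken. *)
Lemma semiconvex_FTC (a b : R) : a <= b ->
  (\int[mu]_(x in `[a, b]) (q x)%:E = (H b - H a)%:E)%E.
Proof.
move=> ab.
pose I x := (\int[mu]_(t in `[a, x]) q t)%R.
pose D x := I x - (H x - H a).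
have ige (x y c : R) : x <= y ->
    mu.-integrable `[x, y] (EFin \o (fun=> c)) /\
    (\int[mu]_(t in `]x, y]) c = c * (y - x))%R.
  move=> xy; split.
    apply: measurable_bounded_integrable => //; last exact: bounded_cst.
    by rewrite /= lebesgue_measure_itv/=; case: ifPn => // _; rewrite -EFinB ltry.
  rewrite Rintegral_cst//= lebesgue_measure_itv/= lte_fin.
  by move: xy; rewrite le_eqVlt => /predU1P[->|->//]; rewrite ltxx subrr.
have D0 : D a = 0.
  by rewrite /D /I subrr subr0 set_itv1 Rintegral_set1.
have inc x y : a <= x -> x <= y -> y <= b ->
    `|D y - D x| <= ((Q y + M * y) - (Q x + M * x)) * (y - x).
  move=> ax xy yb.
  have Iyx : I y - I x = (\int[mu]_(t in `]x, y]) q t)%R.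
    rewrite /I Rintegral_itvB//; exact: semiconvex_integrable.
  have iq : mu.-integrable `]x, y] (EFin \o q).
    apply: integrableS (semiconvex_integrable x y) => //.
    exact: subset_itv_oc_cc.
  have ic c : mu.-integrable `]x, y] (EFin \o (fun=> c)).
    apply: integrableS (ige x y c xy).1 => //; exact: subset_itv_oc_cc.
  have mui : measurable `]x, y]%classic by [].
  have lo : (q x - 2 * M * (y - x)) * (y - x) <= I y - I x.
    rewrite Iyx -(ige x y _ xy).2; apply: le_Rintegral => // t /=.
    rewrite in_itv/= => /andP[xt ty]; have := Qnd (ltW xt); rewrite /Q => h.
    have := ler_wpM2l M0 ty; nra.
  have up : I y - I x <= (q y + 2 * M * (y - x)) * (y - x).
    rewrite Iyx -(ige x y _ xy).2; apply: le_Rintegral => // t /=.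
    rewrite in_itv/= => /andP[xt ty]; have := Qnd ty; rewrite /Q => h.
    have := ler_wpM2l M0 (ltW xt); nra.
  have h1 := Hq x y; have h2 := Hq y x.
  rewrite /Q ler_norml; apply/andP; split; rewrite /D; nra.
have Dab := eq_of_quadratic_increments ab inc.
have := integrable_fin_num _ (semiconvex_integrable a b) => /= /(_ (measurable_itv _)).
move=> /fineK <-; congr EFin.
by move: Dab; rewrite D0 /D /I => /esym/eqP; rewrite subr_eq0 => /eqP.
Qed.

End semiconvex.
Lemma measure_between (A S F : set R) : measurable A -> finite_set F ->
  A `<=` S -> S `<=` A `|` F -> measurable S /\ mu S = mu A.
Proof.
move=> mA fF AS SAF; pose G := S `\` A.
have fG : finite_set G by apply: sub_finite_set fF => x [/SAF[]].
have mG : measurable G by apply: countable_measurable => //; exact: finite_set_countable.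
have SE : S = A `|` G.
  apply/seteqP; split=> x; last by case=> [/AS//|[]].
  by move=> Sx; have [Ax|Ax] := pselect (A x); [left|right].
split; first by rewrite SE; exact: measurableU.
rewrite SE measureU//; last by apply/seteqP; split=> x // [? []].
rewrite [X in (_ + X)%E](_ : _ = 0%E) ?adde0//.
by apply: countable_lebesgue_measure0; exact: finite_set_countable.
Qed.

(** Gives the length of a set when it is not known which of the two end points belong to it, as for
    a chord of a body that is not closed. *)
Lemma measure_itv_between (S : set R) (a b : R) : a <= b ->
  `]a, b[ `<=` S -> S `<=` `[a, b] -> mu S = (b - a)%:E.
Proof.
move=> ab abS Sab.
have SF : S `<=` `]a, b[ `|` [set a; b].
  move=> x /Sab /=; rewrite !in_itv/= !le_eqVlt.
  by move=> /andP[/predU1P[->|->] /predU1P[->|->]];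
    [right; left|right; left|right; right|left].
have [_ ->] := measure_between (measurable_itv _) (finite_set2 _ _) abS SF.
rewrite lebesgue_measure_itv/= lte_fin; move: ab; rewrite le_eqVlt.
by move=> /predU1P[->|->]; rewrite ?ltxx ?subrr// EFinB.
Qed.

End real_integrals.

(** * Squares as areas under affine functions *)

Section squares.
Context {R : realType}.
Local Notation mu := (@lebesgue_measure R).

Lemma integral_affine (T c a b : R) : 0 <= c -> a <= b ->
  (\int[mu]_(s in `[a, b]) (T - c * (b - s))%:E =
   (T * (b - a) - c * (b - a) ^+ 2 / 2)%:E)%E.
Proof.
move=> c0 ab.
(* The antiderivative is convex because [c] is nonnegative, so the subgradient inequality holds with
   [M] equal to 0. *)
rewrite (@semiconvex_FTC _ (fun s => T * s + c * (b - s) ^+ 2 / 2) _ 0)//.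
  by congr EFin; field.
move=> x y; rewrite -subr_ge0.
have -> : T * y + c * (b - y) ^+ 2 / 2 - (T * x + c * (b - x) ^+ 2 / 2) -
  ((T - c * (b - x)) * (y - x) - 0 * (y - x) ^+ 2) = c * (y - x) ^+ 2 / 2 by field.
by rewrite divr_ge0// mulr_ge0// sqr_ge0.
Qed.

(** The left-hand side is the area of the right isosceles triangle with legs [T] ending at [b]; the
    hypotheses put it under the graph of [G]. *)
Lemma sq_le_integral (G : R -> R) (T a b : R) : 0 <= T <= b - a ->
  (forall s, 0 <= G s) -> (forall s, a <= s <= b -> T - (b - s) <= G s) ->
  ((T ^+ 2 / 2)%:E <= \int[mu]_s (G s)%:E)%E.
Proof.
move=> /andP[T0 Tab] G0 TG.
have -> : (T ^+ 2 / 2)%:E = (\int[mu]_(s in `[(b - T)%R, b]) (T - 1 * (b - s))%:E)%E.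
  by rewrite integral_affine ?gerBl//; congr EFin; field.
rewrite integral_mkcond; apply: ge0_le_integralW => s _.
- by apply: erestrict_ge0 => t /=; rewrite in_itv/= lee_fin => /andP[? ?]; lra.
- rewrite patchE; case: ifPn => [|_]; last by rewrite lee_fin.
  rewrite inE/= in_itv/= => /andP[? ?]; rewrite lee_fin mul1r; apply: TG.
  by apply/andP; split; lra.
Qed.

(** [G] lies under the line of slope [c] that reaches [T] at [b]. The signed area under this line,
    times [c], falls short of [T ^+ 2 / 2] by half the square of [T - c * (b - a)], so [b - a] need
    not be compared with [T / c]. *)
Lemma integral_le_sq (G : R -> R) (T c a b : R) : 0 < c -> a <= b ->
  (forall s, 0 <= G s) -> (forall s, G s != 0 -> a <= s <= b) ->
  (forall s, a <= s <= b -> G s <= T - c * (b - s)) ->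
  (c%:E * \int[mu]_s (G s)%:E <= (T ^+ 2 / 2)%:E)%E.
Proof.
move=> c0 ab G0 Gab GT.
have : (\int[mu]_s (G s)%:E <= (T * (b - a) - c * (b - a) ^+ 2 / 2)%:E)%E.
  rewrite -(integral_affine T (ltW c0) ab) [leRHS]integral_mkcond.
  apply: ge0_le_integralW => s _; first by rewrite lee_fin.
  rewrite patchE; case: ifPn; first by rewrite inE/= in_itv/= lee_fin; exact: GT.
  move=> sab; rewrite lee_fin; have [->//|/Gab h] := eqVneq (G s) 0.
  by move: sab; rewrite notin_setE/= in_itv/= h.
move/(lee_wpmul2l (_ : 0 <= c%:E)%E) => /(_ _)/le_trans; apply.
  by rewrite lee_fin ltW.
rewrite -EFinM lee_fin -subr_ge0.
have -> : T ^+ 2 / 2 - c * (T * (b - a) - c * (b - a) ^+ 2 / 2)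
  = (T - c * (b - a)) ^+ 2 / 2 by field.
by rewrite divr_ge0// sqr_ge0.
Qed.
End squares.
(** * The strip of height lambda *)

Section strip.
Context {R : realType}.
Local Notation mu := (@lebesgue_measure R).
(** The boundary curve enters the analysis only through these hypotheses. Later [M] and [K] are both
    four times the radius of a disc about an interior point that contains the body. *)
Variables (f q : R -> R -> R) (sigma : R -> R) (M K D eps0 : R).
Hypothesis M0 : 0 <= M.
Hypothesis K0 : 0 <= K.
Hypothesis f_ge0 : forall t s, 0 <= f t s.
Hypothesis f_subgrad : forall t t' s,
  - q t s * (t' - t) - M * (t' - t) ^+ 2 <= f t' s - f t s.
Hypothesis q_bound : forall t s, `|q t s| <= D.
Hypothesis f_meas : measurable_fun setT (fun z : R * R => f z.1 z.2).
Hypothesis q_meas : measurable_fun setT (fun z : R * R => q z.1 z.2).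
Hypothesis sigma_nd : {homo sigma : x y / x <= y}.
Hypothesis eps0_gt0 : 0 < eps0.
Hypothesis eps0_le1 : eps0 <= 1.
Hypothesis q_sigma : forall t, q t (sigma t) = 0.
Hypothesis q_inc : forall t t' s s' : R, t <= t' <= t + eps0 ->
  sigma t <= s -> s <= s' -> s' <= sigma t' ->
  (1 - (t' - t) ^+ 2) * (s' - s) <= q t s' - q t s.
Hypothesis f_small : forall t t' s : R, t <= t' <= t + eps0 ->
  sigma t <= s <= sigma t' -> f t s <= K * (t' - t).

Let q_ge0 (t t' s : R) : t <= t' <= t + eps0 ->
  sigma t <= s <= sigma t' -> 0 <= q t s.
Proof.
move=> tt' /andP[s1 s2].
have := q_inc tt' (lexx _) s1 s2; rewrite q_sigma subr0; apply: le_trans.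
rewrite mulr_ge0 ?subr_ge0// expr_le1 ?subr_ge0; have /andP[] := tt' => //.
by move=> _; rewrite lerBlDl => /le_trans; apply; rewrite lerD2l.
Qed.

Lemma f_dist (t t' s : R) : `|f t' s - f t s| <= D * `|t' - t| + M * (t' - t) ^+ 2.
Proof.
have h x y : - (D * `|y - x| + M * (y - x) ^+ 2) <= f y s - f x s.
  apply: le_trans (f_subgrad x y s); rewrite opprD lerD2r mulNr lerN2.
  apply: (le_trans (ler_norm _)); rewrite normrM ler_wpM2r//.
rewrite ler_norml h/= -lerN2 opprB.
by have := h t' t; rewrite (distrC t t') -[(t - t') ^+ 2]sqrrN opprB.
Qed.

Let D0 : 0 <= D. Proof. exact: le_trans (q_bound 0 0). Qed.

Lemma f_near (t s e : R) : 0 < e -> exists2 d, 0 < d &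
  forall t', `|t' - t| <= d -> `|f t' s - f t s| <= e.
Proof.
move=> e0; have DM : 0 < D + M + 1 by have := D0; have := M0; lra.
exists (Num.min 1 (e / (D + M + 1))); first by rewrite lt_min ltr01 divr_gt0.
move=> t'; rewrite le_min => /andP[d1]; rewrite ler_pdivlMr// => d2.
apply: le_trans (f_dist _ _ _) _; rewrite -real_normK ?num_real//.
have := normr_ge0 (t' - t); move: d1 d2; set z := `|_ - _| => d1 d2 z0.
have zz : z ^+ 2 <= z by rewrite expr2 ler_piMl.
by have := ler_wpM2l M0 zz; lra.
Qed.

(** [t1] is the direction at which [sigma] passes [s]. Just before it [sigma t <= s], just after it
    [s <= sigma t'], so [f_small] squeezes the height of [s] to 0 at [t1]. *)
Lemma exists_face (a b s : R) : a <= b -> sigma a <= s <= sigma b ->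
  exists t1, [/\ a <= t1 <= b, f t1 s = 0,
    forall t, a <= t -> t < t1 -> sigma t <= s &
    forall t, a <= t <= b -> sigma t <= s -> t <= t1].
Proof.
move=> ab /andP[sa sb].
pose A := [set t | a <= t <= b /\ sigma t <= s].
have Aa : A a by split=> //; rewrite lexx.
have A0 : A !=set0 by exists a.
have ubA : has_ubound A by exists b => t /= [/andP[]].
set t1 := sup A.
have at1 : a <= t1 by exact: ub_le_sup.
have t1b : t1 <= b by apply: ge_sup => // t /= [/andP[]].
exists t1; split.
- by rewrite at1.
- apply/eqP; rewrite eq_le f_ge0 andbT; apply/ler_addgt0Pr => e e0; rewrite add0r.
  have e20 : 0 < e / 2 by rewrite divr_gt0.
  have [d d0 hd] := f_near t1 s e20.
  (* The three bounds keep [t'] within [eps0] of [t], keep [t] in the range of [hd], and make [K]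
     times the distance of [t'] from [t] at most [e / 2]. *)
  pose d' := Num.min (eps0 / 2) (Num.min d (e / 2 / (K * 2 + 1))).
  have K1 : 0 < K * 2 + 1 by have := K0; lra.
  have d'0 : 0 < d' by rewrite !lt_min d0 !divr_gt0.
  have [|t [/andP[at_ tb] st] td] := sup_gt A0 (x := t1 - d').
    by rewrite gtrDl oppr_lt0.
  have tt1 : t <= t1 by apply: ub_le_sup => //; split=> //; rewrite at_.
  (* If [t1 + d'] exceeds [b], the hypothesis [s <= sigma b] takes the place of the maximality of
     [t1]. *)
  pose t' := Num.min b (t1 + d').
  have tt' : t <= t' by rewrite le_min tb (le_trans tt1)// lerDl ltW.
  have t't : t' <= t1 + d' by rewrite ge_min lexx orbT.
  have st' : s <= sigma t'.
    rewrite /t'; have [//|bt] := leP b (t1 + d').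
    rewrite leNgt; apply/negP => sh.
    have : t1 + d' <= t1.
      apply: ub_le_sup => //; split; last exact: ltW.
      by rewrite (ltW bt) andbT (le_trans at1)// lerDl ltW.
    by rewrite gerDl leNgt d'0.
  have d'eps : d' <= eps0 / 2 by rewrite ge_min lexx.
  have d'd : d' <= d by rewrite !ge_min lexx orbT.
  have d'e : d' * (K * 2 + 1) <= e / 2 by rewrite -ler_pdivlMr// !ge_min lexx !orbT.
  have : f t s <= K * (t' - t).
    by apply: f_small; rewrite ?st// tt'/=; lra.
  have := hd t; rewrite distrC ger0_norm ?subr_ge0//.
  move=> /(_ ltac:(lra)); rewrite ler_norml => /andP[h1 h2] h3.
  have : K * (t' - t) <= K * (2 * d') by rewrite ler_wpM2l//; lra.
  nra.
- move=> t at_ /(sup_gt A0)[t' [_ st'] tt'].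
  exact: le_trans (sigma_nd (ltW tt')) st'.
- by move=> t tab st; apply: ub_le_sup.
Qed.

(** The opposite of [q] is a subgradient of the semiconvex function [f ^~ s]. *)
Lemma f_integral (a b s : R) : a <= b ->
  (\int[mu]_(t in `[a, b]) (q t s)%:E = (f a s - f b s)%:E)%E.
Proof.
move=> ab.
have h t t' : - q t s * (t' - t) - M * (t' - t) ^+ 2 <= f t' s - f t s by [].
have iq := semiconvex_integrable (H := f ^~ s) (q := fun t => - q t s) h a b.
have := semiconvex_FTC (H := f ^~ s) (q := fun t => - q t s) h M0 ab.
under eq_integral do rewrite EFinN.
rewrite integralN//=.
  by move=> /(congr1 oppe); rewrite oppeK => ->; rewrite -EFinN opprB.
apply: integrable_add_def => //.
by apply: eq_integrable (integrableN iq) => // x _ /=; rewrite opprK.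
Qed.

Lemma measurable_q (s : R) : measurable_fun setT (q ^~ s).
Proof. exact: (measurableT_comp q_meas (pair2_measurable s)). Qed.

Lemma f_integral_oo (a b s : R) : a <= b ->
  (\int[mu]_(t in `]a, b[) (q t s)%:E = (f a s - f b s)%:E)%E.
Proof.
move=> ab; have mq (A : set R) : measurable_fun A (fun t => (q t s)%:E).
  by apply/measurable_EFinP; apply: measurable_funTS; exact: measurable_q.
by rewrite integral_itv_obnd_cbnd// integral_itv_bndo_bndc// f_integral.
Qed.

(** * The strip, integrated in both orders *)

Section region.
Variables (alpha beta lambda : R) (tau : R -> R).
Hypothesis lambda0 : 0 < lambda.
Hypothesis tau_nd : {homo tau : x y / x <= y}.
Hypothesis tau_sigma : forall t, alpha < t <= beta ->
  exists2 t', t <= t' <= t + eps0 & tau t = sigma t'.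

(** The cut-off [tau] is [sigma (t + eps)] for the upper bound and the constant [sigma beta], on a
    short interval of directions, for the lower bound. *)
Definition strip (t s : R) : bool :=
  [&& alpha < t, t <= beta, sigma t <= s, s <= tau t & f t s <= lambda].

Definition strip_q (t s : R) : R := if strip t s then q t s else 0.

Lemma strip_q_ge0 t s : 0 <= strip_q t s.
Proof.
rewrite /strip_q; case: ifP => // /and5P[h1 h2 h3 h4 _].
have [|t' tt' tE] := tau_sigma (t := t); first by rewrite h1.
by apply: (@q_ge0 t t') => //; rewrite h3 -tE.
Qed.

Lemma measurable_strip_q :
  measurable_fun setT (fun z : R * R => strip_q z.1 z.2).
Proof.
rewrite /strip_q /strip; apply: measurable_fun_ifT => //.
have m1 : measurable_fun setT (fun z : R * R => z.1) by exact: measurable_fst.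
have m2 : measurable_fun setT (fun z : R * R => z.2) by exact: measurable_snd.
have ms : measurable_fun setT sigma by exact: nondecreasing_measurable.
have mt : measurable_fun setT tau by exact: nondecreasing_measurable.
have mst : measurable_fun setT (fun z : R * R => sigma z.1).
  exact: (measurableT_comp ms m1).
have mtt : measurable_fun setT (fun z : R * R => tau z.1).
  exact: (measurableT_comp mt m1).
apply: measurable_and; first by apply: measurable_fun_ltr => //; exact: measurable_cst.
by repeat apply: measurable_and; apply: measurable_fun_ler => //; exact: measurable_cst.
Qed.

(** The directions of the strip at [s] need not form an interval. But [q] is nonnegative on the
    whole interval from their infimum to their supremum, by monotonicity of [sigma] and [tau]; there
    it integrates to a drop of height that starts, by continuity, from at most [lambda]. *)
Lemma integral_strip_q_le s :
  (\int[mu]_t (strip_q t s)%:E <= lambda%:E)%E.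
Proof.
have ms : measurable_fun setT (fun t => (strip_q t s)%:E).
  apply/measurable_EFinP.
  exact: (measurableT_comp measurable_strip_q (pair2_measurable s)).
pose A := [set t | strip t s].
have [A0|A0] := pselect (A !=set0); last first.
  rewrite integral0_eq ?lee_fin ?(ltW lambda0)// => t _; rewrite /strip_q.
  by case: ifP => // st; exfalso; apply: A0; exists t.
have lbA : has_lbound A by exists alpha => t /= /and5P[/ltW].
have ubA : has_ubound A by exists beta => t /= /and5P[].
set a := inf A; set b := sup A.
have ab : a <= b.
  by have [t At] := A0; rewrite (le_trans (ge_inf lbA At))// ub_le_sup.
have qab t : a < t < b -> 0 <= q t s.
  move=> /andP[/(inf_lt A0)[t1 At1 t1t] /(sup_gt A0)[t2 At2 tt2]].
  have /and5P[a1 _ _ h1 _] := At1; have /and5P[_ b2 h2 _ _] := At2.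
  have [|t' tt' tE] := tau_sigma (t := t).
    by rewrite (lt_trans a1 t1t) (le_trans (ltW tt2) b2).
  apply: (q_ge0 tt'); rewrite (le_trans (sigma_nd (ltW tt2)) h2)/= -tE.
  exact: le_trans h1 (tau_nd (ltW t1t)).
have fa : f a s <= lambda.
  apply/ler_addgt0Pr => e e0; have [d d0 hd] := f_near a s e0.
  have [|t At tad] := inf_lt A0 (x := a + d); first by rewrite -/a ltrDl.
  have /and5P[_ _ _ _ ft] := At.
  have := hd t; rewrite ger0_norm ?subr_ge0 ?ge_inf//.
  rewrite lerBlDl (ltW tad) => /(_ isT); rewrite ler_norml => /andP[h _]; lra.
apply: (@le_trans _ _ (\int[mu]_(t in `]a, b[) (q t s)%:E)%E); last first.
  by rewrite f_integral_oo// lee_fin lerBlDr (le_trans fa)// lerDl.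
rewrite [leRHS]integral_mkcond; apply: ae_ge0_le_integral => //.
- by move=> t _; rewrite lee_fin strip_q_ge0.
- move=> t _; apply: erestrict_ge0 => x /=; rewrite in_itv/= lee_fin.
  exact: qab.
- apply/(measurable_restrictT _ _).1 => //.
  by apply/measurable_EFinP; apply: measurable_funTS; exact: measurable_q.
exists [set a; b]; split.
- exact: measurableU.
- by apply: countable_lebesgue_measure0; apply/finite_set_countable/finite_set2.
- move=> t /= /not_implyP[_] h; apply: contrapT => tab; apply: h.
  rewrite patchE /strip_q; case: ifPn => [st|_]; last first.
    by case: ifPn => // /set_mem/=; rewrite in_itv/= lee_fin; exact: qab.
  case: ifPn => //; rewrite notin_setE/= in_itv/= => /negP; case/negP.
  rewrite !lt_neqAle ge_inf// ub_le_sup// !andbT; apply/andP; split.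
    by apply/eqP => ta; apply: tab; left.
  by apply/eqP => ta; apply: tab; right.
Qed.

Lemma strip_q_supp t s : strip_q t s != 0 -> sigma alpha <= s <= tau beta.
Proof.
rewrite /strip_q; case: ifP => [/and5P[h1 h2 h3 h4 _] _|]; last by rewrite eqxx.
by rewrite (le_trans (sigma_nd (ltW h1)) h3) (le_trans h4 (tau_nd h2)).
Qed.

Lemma integral_strip_le : sigma alpha <= tau beta ->
  (\int[mu]_t \int[mu]_s (strip_q t s)%:E <=
   (lambda * (tau beta - sigma alpha))%:E)%E.
Proof.
move=> ab.
rewrite (@fubini_tonelli _ _ _ _ _ mu mu (fun z => (strip_q z.1 z.2)%:E)); last 2 first.
- by apply/measurable_EFinP; exact: measurable_strip_q.
- by move=> z; rewrite lee_fin strip_q_ge0.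
apply: (@le_trans _ _ (\int[mu]_(s in `[sigma alpha, tau beta]) lambda%:E)%E).
  rewrite [leRHS]integral_mkcond; apply: ge0_le_integralW => s _.
    by apply: integral_ge0 => t _; rewrite lee_fin strip_q_ge0.
  rewrite patchE; case: ifPn => [_|]; first exact: integral_strip_q_le.
  rewrite notin_setE/= in_itv/= => sab; rewrite integral0_eq// => t _ /=.
  by congr EFin; apply/eqP/negPn/negP => /strip_q_supp.
rewrite integral_cst//= lebesgue_measure_itv/= lte_fin.
move: ab; rewrite le_eqVlt => /predU1P[->|->].
  by rewrite ltxx mule0 subrr mulr0.
by rewrite -EFinB -EFinM.
Qed.

Hypothesis ab : alpha < beta.
Hypothesis ab_eps : beta <= alpha + eps0.
Hypothesis tau_end : forall t, alpha < t <= beta -> tau t = sigma beta.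

(** [t1] is the last direction of the interval with [sigma t <= s], and [s] is on its face; [t2] is
    the last direction up to [t1] at which [s] has height at least [lambda]. All directions strictly
    between are in the strip, and the height drops there from [lambda] or more to 0. *)
Lemma integral_strip_q_ge (s : R) : sigma alpha <= s <= sigma beta ->
  lambda <= f alpha s -> (lambda%:E <= \int[mu]_t (strip_q t s)%:E)%E.
Proof.
move=> /andP[sa sb] fl.
have sab : sigma alpha <= s <= sigma beta by rewrite sa.
have [t1 [/andP[at1 t1b] f1 below_t1 _]] := exists_face (ltW ab) sab.
pose B := [set t | alpha <= t <= t1 /\ lambda <= f t s].
have Ba : B alpha by split=> //; rewrite lexx.
have B0 : B !=set0 by exists alpha.
have ubB : has_ubound B by exists t1 => t /= [/andP[]].
set t2 := sup B.
have at2 : alpha <= t2 by exact: ub_le_sup.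
have t21 : t2 <= t1 by apply: ge_sup => // t /= [/andP[]].
have f2 : lambda <= f t2 s.
  apply/ler_addgt0Pr => e e0; have [d d0 hd] := f_near t2 s e0.
  have [|t [/andP[at_ tt] lt] td] := sup_gt B0 (x := t2 - d).
    by rewrite gtrDl oppr_lt0.
  have t2t : t <= t2 by apply: ub_le_sup => //; split=> //; rewrite at_.
  have := hd t; rewrite distrC ger0_norm ?subr_ge0//.
  by move=> /(_ ltac:(lra)); rewrite ler_norml => /andP[h1 h2]; lra.
apply: (@le_trans _ _ (\int[mu]_(t in `]t2, t1[) (q t s)%:E)%E).
  by rewrite f_integral_oo// f1 subr0 lee_fin.
have inq t : t2 < t < t1 -> strip t s.
  move=> /andP[t2t tt1]; have at_ : alpha < t by exact: le_lt_trans t2t.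
  have tb : t <= beta by exact: le_trans (ltW tt1) t1b.
  rewrite /strip at_ tb tau_end ?at_// sb/=.
  rewrite below_t1 ?(ltW at_)//= leNgt; apply/negP => lt.
  have : t <= t2.
    by apply: ub_le_sup => //; split; [rewrite ltW//= ltW|exact: ltW].
  by rewrite leNgt t2t.
rewrite integral_mkcond; apply: ge0_le_integralW => t _.
  apply: erestrict_ge0 => x /=; rewrite in_itv/= lee_fin => /inq st.
  by have := strip_q_ge0 x s; rewrite /strip_q st.
rewrite patchE; case: ifPn => [|_]; last by rewrite lee_fin strip_q_ge0.
by rewrite inE/= in_itv/= => /inq st; rewrite /strip_q st.
Qed.

(** [delta] discards the parameters next to [sigma alpha], whose height in direction [alpha] is
    below [lambda]. *)
Lemma strip_integral_ge (delta : R) :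
  0 <= delta -> sigma alpha + delta <= sigma beta ->
  (forall s, sigma alpha + delta <= s <= sigma beta -> lambda <= f alpha s) ->
  ((lambda * (sigma beta - sigma alpha - delta))%:E <=
   \int[mu]_t \int[mu]_s (strip_q t s)%:E)%E.
Proof.
move=> d0 dab fl.
rewrite (@fubini_tonelli _ _ _ _ _ mu mu (fun z => (strip_q z.1 z.2)%:E)); last 2 first.
- by apply/measurable_EFinP; exact: measurable_strip_q.
- by move=> z; rewrite lee_fin strip_q_ge0.
apply: (@le_trans _ _
    (\int[mu]_(s in `[(sigma alpha + delta)%R, sigma beta]) lambda%:E)%E).
  rewrite integral_cst//= lebesgue_measure_itv/= lte_fin.
  move: dab; rewrite le_eqVlt => /predU1P[<-|dab].
    by rewrite ltxx mule0 addrAC addrK subrr mulr0.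
  by rewrite dab -EFinB -EFinM opprD addrA.
rewrite integral_mkcond; apply: ge0_le_integralW => s _.
  by apply: erestrict_ge0 => x _; rewrite lee_fin ltW.
rewrite patchE; case: ifPn => [|_]; last first.
  by apply: integral_ge0 => t _; rewrite lee_fin strip_q_ge0.
rewrite inE/= in_itv/= => /[dup] sab /andP[sa sb]; apply: integral_strip_q_ge.
  by rewrite sb andbT (le_trans _ sa)// lerDl.
exact: fl.
Qed.

End region.

Hypothesis q_lip : forall t s s' : R, s <= s' -> q t s' - q t s <= s' - s.
Hypothesis f_inc : forall t t' s s' : R, t <= t' <= t + eps0 ->
  sigma t <= s -> s < s' -> s' <= sigma t' -> f t s < f t s'.
Hypothesis sigma_rc : forall t e : R, 0 < e ->
  exists2 d, 0 < d & sigma (t + d) <= sigma t + e.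

(** Going back from [s'], [q] stays above a triangle of slope 1, whose base lies in the strip
    because the height up to [s'] is at most [lambda]. *)
Lemma strip_sq_le (a b lambda eps t s' : R) :
  0 < lambda -> 0 <= eps <= eps0 -> a < t <= b ->
  sigma t <= s' <= sigma (t + eps) ->
  (forall s, sigma t <= s <= s' -> f t s <= lambda) ->
  ((q t s' ^+ 2 / 2)%:E <=
    \int[mu]_s (strip_q a b lambda (fun t => sigma (t + eps)%R) t s)%:E)%E.
Proof.
move=> lambda0 /andP[e0 ee0] /andP[at_ tb] /andP[s1 s2] fl.
have tte : t <= t + eps <= t + eps0 by rewrite lerDl e0 lerD2l.
apply: (@sq_le_integral _ _ _ (sigma t) s').
- apply/andP; split; first by apply: (q_ge0 tte); rewrite s1.
  by have := q_lip t s1; rewrite q_sigma subr0.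
- move=> s; apply: strip_q_ge0 => t1 _; exists (t1 + eps) => //.
  by rewrite lerDl e0 lerD2l.
- move=> s /andP[h1 h2]; rewrite /strip_q /strip at_ tb h1 (le_trans h2 s2).
  rewrite fl ?h1//=; have := q_lip t h2; lra.
Qed.

(** At direction [t] the strip lies over [sigma t <= s <= s'], and [q] stays there below the line of
    slope 1 - (b - a)^2 ending at [q t s']. The bound [k] is an extended real because semi-chord
    lengths are measures. *)
Lemma strip_le_sq (a b lambda t s' : R) (k : \bar R) :
  0 < lambda -> a < t <= b -> b <= a + eps0 -> (b - a) ^+ 2 < 1 ->
  sigma t <= s' <= sigma b ->
  (forall s, sigma t <= s <= sigma b -> f t s <= lambda -> s <= s') ->
  ((q t s')%:E <= k)%E ->
  ((2 * (1 - (b - a) ^+ 2))%:E *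
    \int[mu]_s (strip_q a b lambda (fun=> sigma b) t s)%:E <= k ^+ 2)%E.
Proof.
move=> lambda0 /andP[at_ tb] bae ba1 /andP[s1 s2] fl qk.
have tbe : t <= b <= t + eps0.
  by rewrite tb (le_trans bae)// lerD2r ltW.
have qs'0 : 0 <= q t s' by apply: (q_ge0 tbe); rewrite s1.
have k0 : (0 <= k)%E by apply: le_trans qk; rewrite lee_fin.
apply: (@le_trans _ _ ((q t s')%:E ^+ 2)%E); last by rewrite lee_sqr// lee_fin.
have c0 : 0 < 1 - (b - a) ^+ 2 by rewrite subr_gt0.
have := @integral_le_sq _ (strip_q a b lambda (fun=> sigma b) t) (q t s')
  (1 - (b - a) ^+ 2) (sigma t) s' c0 s1.
have sp s : strip_q a b lambda (fun=> sigma b) t s != 0 -> sigma t <= s <= s'.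
  rewrite /strip_q; case: ifP => [/and5P[h1 h2 h3 h4 h5] _|]; last by rewrite eqxx.
  by rewrite h3 fl// h3.
move=> /(_ _ sp) H; rewrite EFinM -muleA -EFin_expe.
have -> : (q t s' ^+ 2)%:E = (2%:E * (q t s' ^+ 2 / 2)%:E)%E.
  by rewrite -EFinM; congr EFin; field.
apply: lee_wpmul2l; first by rewrite lee_fin.
apply: H.
- move=> s; apply: strip_q_ge0 => t1 /andP[h1 h2]; exists b => //.
  by rewrite h2 (le_trans bae)// lerD2r ltW.
- move=> s /andP[h1 h2].
  have := q_inc tbe h1 h2 s2.
  have tba : (b - t) ^+ 2 <= (b - a) ^+ 2.
    have bt0 : 0 <= b - t by rewrite subr_ge0.
    have btba : b - t <= b - a by rewrite lerD2l lerN2 ltW.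
    by rewrite lerXn2r// nnegrE// (le_trans bt0).
  have hs : 0 <= s' - s by rewrite subr_ge0.
  have := ler_wpM2r hs tba => h3 h4.
  have le : q t s <= q t s' - (1 - (b - a) ^+ 2) * (s' - s) by nra.
  rewrite /strip_q; case: ifP => // _; apply: le_trans le.
  by apply: (q_ge0 tbe); rewrite h1 (le_trans h2).
Qed.

Let J a b lambda tau t : \bar R :=
  (\int[mu]_s (strip_q a b lambda tau t s)%:E)%E.

Lemma measurable_J a b lambda tau : {homo tau : x y / x <= y} ->
  (forall t, a < t <= b -> exists2 t', t <= t' <= t + eps0 & tau t = sigma t') ->
  measurable_fun setT (J a b lambda tau).
Proof.
move=> tau_nd ts.
apply: (@measurable_fun_fubini_tonelli_F _ _ _ _ _ mu
  (fun z => (strip_q a b lambda tau z.1 z.2)%:E)).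
  by apply/measurable_EFinP; exact: measurable_strip_q.
by move=> z; rewrite lee_fin; exact: strip_q_ge0.
Qed.

Lemma integral_J_le (I : set R) a b lambda tau :
  (forall t, a < t <= b -> exists2 t', t <= t' <= t + eps0 & tau t = sigma t') ->
  (\int[mu]_(t in I) J a b lambda tau t <= \int[mu]_t J a b lambda tau t)%E.
Proof.
move=> ts; have J0 t : (0 <= J a b lambda tau t)%E.
  by apply: integral_ge0 => s _; rewrite lee_fin; exact: strip_q_ge0.
rewrite integral_mkcond; apply: ge0_le_integralW => t _.
  by apply: erestrict_ge0.
by rewrite patchE; case: ifPn.
Qed.

(** * Passage to the limit *)

Section limit.
(** [Kl lambda t] stands for the semi-chord length and [E] for the exceptional directions. In
    [Kl_le] the constants may depend on [eps], but not on the direction. *)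
Variables (alpha beta : R) (Kl : R -> R -> \bar R) (E : set R).
Hypothesis ab : alpha < beta.
Hypotheses (mE : measurable E) (E0 : mu E = 0%E).
Hypothesis Kl_ge0 : forall lambda t, (0 <= Kl lambda t)%E.
Hypothesis Kl_le : forall eps, 0 < eps <= eps0 -> exists C l0,
  [/\ 0 <= C, 0 < l0 & forall lambda t, 0 < lambda < l0 -> ~ E t ->
   exists s', [/\ sigma t <= s' <= sigma (t + eps),
     forall s, sigma t <= s <= s' -> f t s <= lambda &
     (Kl lambda t <= (q t s' + C * lambda)%:E)%E]].
Hypothesis Kl_ge : exists2 l0, 0 < l0 & forall lambda t t', 0 < lambda < l0 ->
  ~ E t -> t <= t' <= t + eps0 ->
  exists s', [/\ sigma t <= s' <= sigma t',
     forall s, sigma t <= s <= sigma t' -> f t s <= lambda -> s <= s' &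
     ((q t s')%:E <= Kl lambda t)%E].

Let I : set R := `]alpha, beta].

(** The square of q + C lambda is at most (1 + delta) q^2 + (1 + 1 / delta) (C lambda)^2. For fixed
    [delta] the last term is O(lambda^2) and disappears after division by [lambda]. *)
Lemma integral_Kl_le (eps delta lambda C l0 : R) : 0 < eps <= eps0 ->
  0 <= C -> 0 < delta -> 0 < lambda < l0 ->
  (forall lambda t, 0 < lambda < l0 -> ~ E t ->
   exists s', [/\ sigma t <= s' <= sigma (t + eps),
     forall s, sigma t <= s <= s' -> f t s <= lambda &
     (Kl lambda t <= (q t s' + C * lambda)%:E)%E]) ->
  (\int[mu]_(t in I) Kl lambda t ^+ 2 <=
   (2 * (1 + delta) * (lambda * (sigma (beta + eps) - sigma alpha))
    + (1 + delta^-1) * (C * lambda) ^+ 2 * (beta - alpha))%:E)%E.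
Proof.
move=> /andP[e0 ee0] C0 d0 ll0 /(_ lambda _ ll0) HK; have /andP[l_gt0 _] := ll0.
pose tau t := sigma (t + eps).
have tau_nd : {homo tau : x y / x <= y} by move=> x y xy; rewrite sigma_nd// lerD2r.
have ts t : alpha < t <= beta -> exists2 t', t <= t' <= t + eps0 & tau t = sigma t'.
  by move=> _; exists (t + eps) => //; rewrite lerDl (ltW e0) lerD2l.
have J0 t : (0 <= J alpha beta lambda tau t)%E.
  by apply: integral_ge0 => s _; rewrite lee_fin; exact: strip_q_ge0.
have mJ := measurable_J lambda tau_nd ts.
set c := (1 + delta^-1) * (C * lambda) ^+ 2.
have c0 : 0 <= c by rewrite mulr_ge0// ?sqr_ge0// addr_ge0// invr_ge0 ltW.
have d20 : 0 <= 2 * (1 + delta) by rewrite mulr_ge0// addr_ge0// ltW.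
have mI : measurable I by exact: measurable_itv.
have m1 : measurable_fun I (fun t => ((2 * (1 + delta))%:E * J alpha beta lambda tau t)%E).
  by apply: measurable_funTS; apply: measurable_funeM.
apply: (@le_trans _ _ (\int[mu]_(t in I)
   ((2 * (1 + delta))%:E * J alpha beta lambda tau t + c%:E))%E).
  apply: (@ae_le_integralWl _ _ _ mu I E (fun t => Kl lambda t ^+ 2)%E) => //.
  - by move=> t; exact: sqre_ge0.
  - by move=> t; rewrite adde_ge0// mule_ge0.
  - move=> t; rewrite /I/= in_itv/= => tI nE.
    have [s' [s'1 s'2 s'3]] := HK t nE.
    have ee : 0 <= eps <= eps0 by rewrite ltW.
    have := strip_sq_le l_gt0 ee tI s'1 s'2; rewrite -/(J _ _ _ _ t) => H.
    have q0 : 0 <= q t s'.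
      apply: (@q_ge0 t (t + eps)); last by have /andP[-> ] := s'1.
      by rewrite lerDl (ltW e0) lerD2l.
    have qc0 : 0 <= q t s' + C * lambda by rewrite addr_ge0// mulr_ge0// ltW.
    apply: (@le_trans _ _ ((q t s' + C * lambda)%:E ^+ 2)%E).
      by rewrite lee_sqr// lee_fin.
    apply: (@le_trans _ _ ((2 * (1 + delta))%:E * (q t s' ^+ 2 / 2)%:E + c%:E)%E).
      rewrite -EFin_expe -EFinM -EFinD lee_fin /c -subr_ge0.
      have -> : 2 * (1 + delta) * (q t s' ^+ 2 / 2) + (1 + delta^-1) * (C * lambda) ^+ 2 -
         (q t s' + C * lambda) ^+ 2 = delta * (q t s' - C * lambda / delta) ^+ 2.
        by field; rewrite gt_eqF.
      by rewrite mulr_ge0 ?sqr_ge0// ltW.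
    by rewrite leeD2r// lee_wpmul2l.
  - by apply: emeasurable_funD.
rewrite ge0_integralD//; last first.
  by move=> t _; rewrite mule_ge0.
rewrite integral_cst//= lebesgue_measure_itv/= lte_fin ab -EFinB -EFinM EFinD.
rewrite leeD2r// ge0_integralZl_EFin//; last exact: measurable_funTS.
rewrite [leRHS]EFinM; apply: lee_wpmul2l => //.
apply: (le_trans (integral_J_le _ _ ts)).
apply: integral_strip_le => //.
by rewrite /tau sigma_nd// (le_trans (ltW ab))// lerDl ltW.
Qed.

(** The conclusion is a measurable minorant supported in one short interval, and not a bound on an
    integral of [Kl]: minorants of several intervals can be added under the integral, whereas [Kl]
    is not known to be measurable. *)
Lemma integral_Kl_ge (a b lambda delta l0 : R) : a < b ->
  b <= a + eps0 -> (b - a) ^+ 2 < 1 -> 0 < lambda < l0 -> 0 < delta ->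
  (sigma a + delta <= sigma b -> lambda <= f a (sigma a + delta)) ->
  (forall lambda t t', 0 < lambda < l0 ->
    ~ E t -> t <= t' <= t + eps0 ->
    exists s', [/\ sigma t <= s' <= sigma t',
     forall s, sigma t <= s <= sigma t' -> f t s <= lambda -> s <= s' &
     ((q t s')%:E <= Kl lambda t)%E]) ->
  exists g : R -> \bar R, [/\ measurable_fun setT g, forall t, (0 <= g t)%E,
    forall t, g t != 0%E -> a < t <= b,
    forall t, a < t <= b -> ~ E t -> (g t <= Kl lambda t ^+ 2)%E &
    ((2 * (1 - (b - a) ^+ 2) * (lambda * (sigma b - sigma a - delta)))%:E <=
      \int[mu]_t g t)%E].
Proof.
move=> ab' bae ba1 ll0 d0 fl HK.
have /andP[l_gt0 _] := ll0.
have ts t : a < t <= b -> exists2 t', t <= t' <= t + eps0 & sigma b = sigma t'.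
  move=> /andP[h1 h2]; exists b => //.
  by rewrite h2 (le_trans bae)// lerD2r ltW.
have J0 t : (0 <= J a b lambda (fun=> sigma b) t)%E.
  by apply: integral_ge0 => s _; rewrite lee_fin; exact: strip_q_ge0.
have c0 : 0 <= 2 * (1 - (b - a) ^+ 2) by rewrite mulr_ge0// subr_ge0 ltW.
exists (fun t => ((2 * (1 - (b - a) ^+ 2))%:E * J a b lambda (fun=> sigma b) t)%E).
have mJ : measurable_fun setT (J a b lambda (fun=> sigma b)) by exact: measurable_J.
split.
- exact: measurable_funeM.
- by move=> t; rewrite mule_ge0.
- move=> t; apply: contraNT => tab; rewrite /J integral0_eq ?mule0// => s _.
  rewrite /strip_q; case: ifP => // /and5P[h1 h2 _ _ _].
  by move: tab; rewrite h1 h2.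
- move=> t /andP[at_ tb] nE.
  have [|s' [h1 h2 h3]] := HK lambda t b ll0 nE.
    by rewrite tb (le_trans bae)// lerD2r ltW.
  by apply: (strip_le_sq (s' := s')) => //; rewrite at_.
rewrite ge0_integralZl_EFin// EFinM; apply: lee_wpmul2l => //.
(* If [sigma] grows by less than [delta], the left-hand side is nonpositive and the bound is
   trivial. *)
have [sab|sab] := leP (sigma a + delta) (sigma b); last first.
  apply: (@le_trans _ _ 0%E); last by apply: integral_ge0 => t _; exact: J0.
  by rewrite lee_fin pmulr_rle0//; lra.
apply: strip_integral_ge => //; first exact: ltW.
move=> s /andP[]; rewrite le_eqVlt => /predU1P[<- _|h1 h2]; first exact: fl.
apply: le_trans (fl sab) _; apply/ltW; apply: (f_inc (t' := b)) => //.
- by rewrite (ltW ab').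
- by rewrite lerDl ltW.
Qed.

Let P := sigma beta - sigma alpha.

Let P0 : 0 <= P. Proof. by rewrite subr_ge0 sigma_nd// ltW. Qed.

(** [eps] is chosen before all else, because [C] depends on it; right-continuity of [sigma] at
    [beta] makes the overshoot up to [sigma (beta + eps)] small. Then [delta] is fixed, and only
    then [lambda]. *)
Lemma near_integral_Kl_le e : 0 < e -> \forall lambda \near 0^'+,
  (\int[mu]_(t in I) Kl lambda t ^+ 2 <= (2 * lambda * (P + e))%:E)%E.
Proof.
move=> e0; have e40 : 0 < e / 4 by rewrite divr_gt0.
have [d d0 sd] := sigma_rc beta e40.
pose eps := Num.min d eps0.
have eps1 : 0 < eps <= eps0 by rewrite lt_min d0 eps0_gt0 ge_min lexx orbT.
have se : sigma (beta + eps) <= sigma beta + e / 4.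
  by apply: le_trans sd; rewrite sigma_nd// lerD2l ge_min lexx.
have [C [l0 [C0 l00 HK]]] := Kl_le eps1.
pose delta := Num.min 1 (e / 4 / (P + 1)).
have P1 : 0 < P + 1 by rewrite ltr_wpDl.
have delta0 : 0 < delta by rewrite lt_min ltr01 !divr_gt0.
have delta1 : delta <= 1 by rewrite ge_min lexx.
have deltaP : delta * P <= e / 4.
  apply: (@le_trans _ _ (delta * (P + 1))); first by rewrite ler_wpM2l ?lerDl// ltW.
  by rewrite -ler_pdivlMr// ge_min lexx orbT.
pose c := (1 + delta^-1) * C ^+ 2 * (beta - alpha).
have c0 : 0 <= c.
  have di : 0 <= delta^-1 by rewrite invr_ge0 ltW.
  apply: mulr_ge0; last by rewrite subr_ge0 ltW.
  by rewrite mulr_ge0 ?sqr_ge0// addr_ge0.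
have c10 : 0 < c + 1 by rewrite ltr_wpDl.
near=> lambda.
have lambda0 : 0 < lambda by near: lambda; exact: nbhs_right_gt.
have ll0 : 0 < lambda < l0.
  by rewrite lambda0/=; near: lambda; exact: nbhs_right_lt.
apply: le_trans (integral_Kl_le eps1 C0 delta0 ll0 HK) _.
have : lambda * (c + 1) <= e / 4.
  rewrite -ler_pdivlMr//; near: lambda; apply: nbhs_right_le.
  by rewrite divr_gt0.
rewrite lee_fin => lc.
have -> : (1 + delta^-1) * (C * lambda) ^+ 2 * (beta - alpha) = lambda * (lambda * c).
  by rewrite /c; ring.
have -> : 2 * (1 + delta) * (lambda * (sigma (beta + eps) - sigma alpha)) +
    lambda * (lambda * c) =
  lambda * (2 * (1 + delta) * (sigma (beta + eps) - sigma alpha) + lambda * c) by ring.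
have -> : 2 * lambda * (P + e) = lambda * (2 * (P + e)) by ring.
rewrite ler_wpM2l ?(ltW lambda0)//.
have sP : sigma (beta + eps) - sigma alpha <= P + e / 4 by rewrite /P; lra.
have d1 : 0 <= 1 + delta by rewrite addr_ge0// ltW.
have h1 := ler_wpM2l d1 sP.
have h2 : delta * (e / 4) <= 1 * (e / 4) by rewrite ler_wpM2r// ltW.
lra.
Unshelve. all: by end_near. Qed.

Lemma near_integral_Kl_ge e : 0 < e -> \forall lambda \near 0^'+,
  ((2 * lambda * (P - e))%:E <= \int[mu]_(t in I) Kl lambda t ^+ 2)%E.
Proof.
move=> e0; have [l0 l00 HK] := Kl_ge.
have P1 : 0 < P + 1 by rewrite ltr_wpDl.
(* The cell width [w] stays below [eps0] for the slope estimates, at most 1/2 so that w^2 < 1, and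
   so small that the loss w^2 P is at most e / 2. *)
pose eta := Num.min eps0 (Num.min 2^-1 (e / 2 / (P + 1))).
have eta0 : 0 < eta by rewrite !lt_min eps0_gt0 invr_gt0 ltr0n !divr_gt0.
pose N := (Num.truncn ((beta - alpha) / eta)).+1.
have N0 : 0 < N%:R :> R by rewrite ltr0n.
pose w := (beta - alpha) / N%:R.
have w0 : 0 < w by rewrite divr_gt0// subr_gt0.
have weta : w < eta.
  by rewrite /w ltr_pdivrMr// mulrC -ltr_pdivrMr//; exact: truncnS_gt.
have w_eps : w <= eps0 by rewrite ltW// (lt_le_trans weta)// ge_min lexx.
have w1 : w <= 2^-1.
  by rewrite ltW// (lt_le_trans weta)// !ge_min lexx !orbT.
have we : w * (P + 1) <= e / 2.
  by rewrite -ler_pdivlMr// ltW// (lt_le_trans weta)// !ge_min lexx !orbT.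
have w2 : w ^+ 2 < 1 by rewrite expr2; nra.
pose x (i : nat) := alpha + i%:R * w.
have xS i : x i.+1 = x i + w by rewrite /x -natr1; ring.
have xN : x N = beta by rewrite /x /w mulrCA divff ?gt_eqF// mulr1 addrC subrK.
have x_nd i j : (i <= j)%N -> x i <= x j.
  by move=> ij; rewrite lerD2l ler_wpM2r ?(ltW w0)// ler_nat.
have x0 : x 0%N = alpha by rewrite /x mul0r addr0.
(* Each of the [N] cells loses [delta], which amounts to e / 2 in all. *)
pose delta := e / 2 / N%:R.
have delta0 : 0 < delta by rewrite !divr_gt0.
(* One threshold for all cells: it is at most each of finitely many heights, which are positive
   because [f] strictly increases past the end of a face. *)
have [l1 l10 Hl1] : exists2 l1, 0 < l1 & forall i lambda, (i < N)%N ->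
    lambda < l1 -> sigma (x i) + delta <= sigma (x i.+1) ->
    lambda <= f (x i) (sigma (x i) + delta).
  elim: (N) => [|n [l1 l10 IH]]; first by exists 1.
  have [h|h] := leP (sigma (x n) + delta) (sigma (x n.+1)); last first.
    exists l1 => // i lambda; rewrite ltnS leq_eqVlt => /predU1P[->|]; last exact: IH.
    by move=> _ /le_lt_trans/(_ h); rewrite ltxx.
  have fx : 0 < f (x n) (sigma (x n) + delta).
    apply: le_lt_trans (f_ge0 (x n) (sigma (x n))) _.
    apply: (f_inc (t' := x n.+1)) => //; last by rewrite ltrDl.
    by rewrite x_nd// xS lerD2l.
  exists (Num.min l1 (f (x n) (sigma (x n) + delta))); first by rewrite lt_min l10.
  move=> i lambda; rewrite lt_min ltnS leq_eqVlt => /predU1P[->|iN] /andP[h1 h2].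
    by move=> _; exact: ltW.
  exact: IH.
near=> lambda.
have lambda0 : 0 < lambda by near: lambda; exact: nbhs_right_gt.
have ll0 : 0 < lambda < l0.
  by rewrite lambda0/=; near: lambda; exact: nbhs_right_lt.
have ll1 : lambda < l1 by near: lambda; exact: nbhs_right_lt.
have /choice[G HG] : forall i, exists g : R -> \bar R, (i < N)%N ->
   [/\ measurable_fun setT g, forall t, (0 <= g t)%E,
    forall t, g t != 0%E -> x i < t <= x i.+1,
    forall t, x i < t <= x i.+1 -> ~ E t -> (g t <= Kl lambda t ^+ 2)%E &
    ((2 * (1 - w ^+ 2) * (lambda * (sigma (x i.+1) - sigma (x i) - delta)))%:E <=
      \int[mu]_t g t)%E].
  move=> i; have [iN|iN] := ltnP i N; last by exists (cst 0%E).
  have xw : x i.+1 - x i = w by rewrite xS addrC addKr.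
  have [|||||||g Hg] := @integral_Kl_ge (x i) (x i.+1) lambda delta l0.
  - by rewrite xS ltrDl.
  - by rewrite xS lerD2l.
  - by rewrite xw.
  - by [].
  - by [].
  - exact: Hl1.
  - exact: HK.
  - by exists g => _; rewrite xw in Hg.
have mI : measurable I by exact: measurable_itv.
pose g t := (\sum_(i < N) G i t)%E.
have g0 t : (0 <= g t)%E.
  by apply: sume_ge0 => i _; have [_ h _ _ _] := HG i (ltn_ord i); exact: h.
apply: (@le_trans _ _ (\int[mu]_(t in I) g t)%E); last first.
  apply: (@ae_le_integralWr _ _ _ mu I E g (fun t => Kl lambda t ^+ 2)%E) => //.
  - move=> t; exact: sqre_ge0.
  - move=> t tI nE.
    (* The cells are disjoint, so at most one summand is nonzero at [t]. *)
    have [[i /eqP Git]|Gt] := pselect (exists i : 'I_N, G i t != 0%E); last first.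
      rewrite /g big1 ?sqre_ge0// => i _; apply/eqP/negPn/negP => h.
      by apply: Gt; exists i.
    have [_ _ h3 h4 _] := HG i (ltn_ord i).
    have /andP[x1 x2] := h3 t (introN eqP Git).
    rewrite /g (bigD1 i)//= big1 ?adde0; first by apply: h4; rewrite ?x1.
    move=> j ji; apply/eqP/negPn/negP => Gjt.
    have [_ _ h3' _ _] := HG j (ltn_ord j).
    have /andP[x1' x2'] := h3' t Gjt.
    move: ji; rewrite -val_eqE /= neq_ltn => /orP[ji|ij].
      by have := le_lt_trans (le_trans x2' (x_nd _ _ ji)) x1; rewrite ltxx.
    by have := le_lt_trans (le_trans x2 (x_nd _ _ ij)) x1'; rewrite ltxx.
  - apply: emeasurable_sum => i; apply: measurable_funTS.
    by have [] := HG i (ltn_ord i).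
apply: (@le_trans _ _ (\int[mu]_t g t)%E); last first.
  rewrite [leRHS]integral_mkcond; apply: ge0_le_integralW => t _ //.
  rewrite patchE; case: ifPn => //; rewrite notin_setE /I/= in_itv/= => tI.
  rewrite /g big1// => i _; apply/eqP/negPn/negP => Git; apply: tI.
  have [_ _ h3 _ _] := HG i (ltn_ord i); have /andP[h1 h2] := h3 t Git.
  rewrite -x0 -xN (le_lt_trans (x_nd 0%N i _) h1)//=.
  exact: le_trans h2 (x_nd _ _ (ltn_ord i)).
rewrite /g ge0_integral_sum//; last 2 first.
- by move=> i; have [] := HG i (ltn_ord i).
- by move=> i t _; have [_ h _ _ _] := HG i (ltn_ord i).
apply: (@le_trans _ _ (\sum_(i < N)
  (2 * (1 - w ^+ 2) * (lambda * (sigma (x i.+1) - sigma (x i) - delta)))%:E)%E); last first.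
  by apply: lee_sum => i _; have [] := HG i (ltn_ord i).
rewrite sumEFin lee_fin -!mulr_sumr sumrB.
rewrite -(big_mkord xpredT (fun i => sigma (x i.+1) - sigma (x i))).
rewrite telescope_sumr// x0 xN sumr_const card_ord -/P.
have -> : delta *+ N = e / 2 by rewrite /delta -[LHS]mulr_natr divfK// gt_eqF.
rewrite -[leLHS]mulrA -[leRHS]mulrA ler_wpM2l// mulrCA ler_wpM2l ?(ltW lambda0)//.
have w2w : w ^+ 2 <= w by rewrite expr2; nra.
have := ler_wpM2r P0 w2w; nra.
Unshelve. all: by end_near. Qed.

Theorem cvg_integral_Kl :
  (((2 * lambda)^-1)%:E * \int[mu]_(t in `]alpha, beta]) (Kl lambda t ^+ 2))%E
    @[lambda --> 0^'+] --> (sigma beta - sigma alpha)%:E.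
Proof.
have H e : 0 < e -> \forall lambda \near 0^'+, exists2 y,
   (((2 * lambda)^-1)%:E * \int[mu]_(t in I) (Kl lambda t ^+ 2))%E = y%:E &
   `|P - y| <= e.
  move=> e0; near=> lambda.
  have lambda0 : 0 < lambda by near: lambda; exact: nbhs_right_gt.
  have l2 : 0 < 2 * lambda by rewrite mulr_gt0.
  have : ((2 * lambda * (P - e))%:E <= \int[mu]_(t in I) Kl lambda t ^+ 2)%E.
    by near: lambda; exact: near_integral_Kl_ge.
  have : (\int[mu]_(t in I) Kl lambda t ^+ 2 <= (2 * lambda * (P + e))%:E)%E.
    by near: lambda; exact: near_integral_Kl_le.
  case: (\int[mu]_(t in I) _)%E => [r| |]//; rewrite !lee_fin => h1 h2.
  exists ((2 * lambda)^-1 * r) => //; set y := _^-1 * r.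
  have ry : r = 2 * lambda * y by rewrite /y mulrA divff ?mul1r// gt_eqF.
  rewrite ry !ler_pM2l// in h1 h2.
  by rewrite ler_norml; apply/andP; split; lra.
apply/fine_cvgP; split.
  by near=> lambda; have [|y -> _] := near (H 1 ltr01) lambda.
apply/cvgrPdist_le => e e0; near=> lambda.
by have [|y /= -> ] := near (H e e0) lambda.
Unshelve. all: by end_near. Qed.

End limit.
End strip.
(** * Plane geometry *)

Section plane_algebra.
Context {R : realType}.
Implicit Types (x y z : plane R) (t a b : R).

Definition cross x y : R := x.1 * y.2 - x.2 * y.1.

Lemma dotDl x y z : dot (x + y) z = dot x z + dot y z.
Proof. by rewrite /dot /=; ring. Qed.

Lemma dotBl x y z : dot (x - y) z = dot x z - dot y z.
Proof. by rewrite /dot /=; ring. Qed.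

Lemma dotZl a x y : dot (a *: x) y = a * dot x y.
Proof. by rewrite /dot /= /GRing.scale /=; ring. Qed.

Lemma dot_frame t x : dot x x = dot x (u t) ^+ 2 + dot x (u' t) ^+ 2.
Proof.
rewrite /dot /=; apply/eqP; rewrite -subr_eq0; apply/eqP.
have := cos2Dsin2 t; set c := cos t; set s := sin t => cs.
transitivity ((x.1 ^+ 2 + x.2 ^+ 2) * (1 - (c ^+ 2 + s ^+ 2)) : R).
  by ring.
by rewrite cs subrr mulr0.
Qed.

Lemma cross_frame t x y :
  cross x y = dot x (u t) * dot y (u' t) - dot x (u' t) * dot y (u t).
Proof.
rewrite /cross /dot /=; apply/eqP; rewrite -subr_eq0; apply/eqP.
have := cos2Dsin2 t; set c := cos t; set s := sin t => cs.
transitivity ((x.1 * y.2 - x.2 * y.1) * (1 - (c ^+ 2 + s ^+ 2)) : R).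
  by ring.
by rewrite cs subrr mulr0.
Qed.

Lemma dot_u_rot t t' x :
  dot x (u t') = cos (t' - t) * dot x (u t) + sin (t' - t) * dot x (u' t).
Proof.
rewrite -{1}(subrK t t'); set d := t' - t.
by rewrite /dot /= (cosD d) (sinD d); ring.
Qed.

(** Expresses the cross product by components along two oblique directions. It is used to compare
    the faces of two directions, whose minimality gives signs to such components. *)
Lemma cross_sin (a b : R) x y :
  sin (b - a) * cross x y = dot x (u a) * dot y (u b) - dot x (u b) * dot y (u a).
Proof.
rewrite (dot_u_rot a b x) (dot_u_rot a b y) (cross_frame a); ring.
Qed.

Lemma enorm_ge0 x : 0 <= enorm x. Proof. exact: sqrtr_ge0. Qed.

Lemma dot_ge0 x : 0 <= dot x x.
Proof. by rewrite /dot -!expr2 addr_ge0// sqr_ge0. Qed.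

Lemma enorm_sq x : enorm x ^+ 2 = dot x x.
Proof. by rewrite sqr_sqrtr// dot_ge0. Qed.

Lemma enorm_le x a : 0 <= a -> (enorm x <= a) = (dot x x <= a ^+ 2).
Proof.
by move=> a0; rewrite -enorm_sq -[in RHS]ler_sqrt ?sqr_ge0// !sqrtr_sqr !ger0_norm// enorm_ge0.
Qed.

Lemma norm_dot_u_le x t : `|dot x (u t)| <= enorm x.
Proof.
rewrite -[leLHS]sqrtr_sqr ler_wsqrtr// (dot_frame t x) lerDl sqr_ge0//.
Qed.

Lemma norm_dot_u'_le x t : `|dot x (u' t)| <= enorm x.
Proof.
rewrite -[leLHS]sqrtr_sqr ler_wsqrtr// (dot_frame t x) lerDr sqr_ge0//.
Qed.

Lemma dot_uu a b : dot (u a) (u b) = cos (b - a).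
Proof. by rewrite /dot /= cosB; ring. Qed.

Lemma dot_u_u t : dot (u t) (u t) = 1.
Proof. by rewrite dot_uu subrr cos0. Qed.

Lemma dot_u_u' t : dot (u t) (u' t) = 0.
Proof. by rewrite /dot /=; ring. Qed.

Lemma dot_u'_u t : dot (u' t) (u t) = 0.
Proof. by rewrite /dot /=; ring. Qed.

Lemma dot_u'_u' t : dot (u' t) (u' t) = 1.
Proof. by rewrite /dot /= mulrNN -!expr2 addrC cos2Dsin2. Qed.

Lemma cross_uu a b : cross (u a) (u b) = sin (b - a).
Proof. by rewrite /cross /= sinB; ring. Qed.

Lemma crossZl a x y : cross (a *: x) y = a * cross x y.
Proof. by rewrite /cross /= /GRing.scale /=; ring. Qed.

Lemma crossZr a x y : cross x (a *: y) = a * cross x y.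
Proof. by rewrite /cross /= /GRing.scale /=; ring. Qed.

Lemma plane_eq x y : x.1 = y.1 -> x.2 = y.2 -> x = y.
Proof. by case: x y => [x1 x2] [y1 y2] /= -> ->. Qed.

Lemma frame_inj t x y : dot x (u t) = dot y (u t) -> dot x (u' t) = dot y (u' t) ->
  x = y.
Proof.
move=> h1 h2; apply/eqP; rewrite -subr_eq0; apply/eqP.
have : dot (x - y) (x - y) = 0.
  by rewrite (dot_frame t) !(dotBl x) h1 h2 !subrr expr0n addr0.
rewrite /dot -!expr2 => /eqP; rewrite paddr_eq0 ?sqr_ge0// !sqrf_eq0.
by move=> /andP[/eqP e1 /eqP e2]; exact: plane_eq.
Qed.

Lemma sin_norm_le (x : R) : `|sin x| <= `|x|.
Proof.
wlog x0 : x / 0 <= x => [H|].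
  have [/H//|x0] := leP 0 x; have := H (- x).
  by rewrite sinN !normrN; apply; rewrite oppr_ge0 ltW.
have [|c _] := @MVT_segment R sin cos 0 x x0.
  by apply: continuous_subspaceT => y; exact: continuous_sin.
rewrite sin0 !subr0 => ->; rewrite normrM ler_piMl//; exact: cos_max.
Qed.

Lemma cos_ge_1B_sq (x : R) : 1 - x ^+ 2 <= cos x.
Proof.
have -> : x = (x / 2) *+ 2 by rewrite -mulr_natr divfK.
rewrite cos_mulr2n cos2sin2; set y := x / 2.
have := sin_norm_le y; rewrite -ler_sqr ?nnegrE// !real_normK ?num_real// => h.
by have := sqr_ge0 y; rewrite !mulr2n; nra.
Qed.

Lemma sin_dist (x : R) : `|sin x - x| <= x ^+ 2.
Proof.
wlog x0 : x / 0 <= x => [H|].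
  have [/H//|x0] := leP 0 x; have := H (- x).
  by rewrite sinN -opprB normrN opprK addrC sqrrN; apply; rewrite oppr_ge0 ltW.
have [|c] := @MVT_segment R (fun y : R => sin y - y) (fun y : R => cos y - 1) 0 x x0.
  apply: continuous_subspaceT => y; apply: cvgB; last exact: cvg_id.
  exact: continuous_sin.
rewrite in_itv/= => /andP[c0 cx]; rewrite sin0 !subr0 => ->.
rewrite normrM (ger0_norm x0) expr2 ler_wpM2r//.
rewrite ler0_norm ?subr_le0 ?cos_le1// opprB.
have -> : c = (c / 2) *+ 2 by rewrite -mulr_natr divfK.
rewrite cos_mulr2n cos2sin2; set y := c / 2.
have h1 := sin_norm_le y; have h2 := sin_max y.
have h3 : `|sin y| ^+ 2 <= y.
  have y0 : 0 <= y by rewrite divr_ge0.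
  rewrite (ger0_norm y0) in h1; have := normr_ge0 (sin y); nra.
rewrite real_normK ?num_real// in h3.
have : c = 2 * y by rewrite /y; field.
rewrite !mulr2n; nra.
Qed.

End plane_algebra.

(** * Interior and closure in the Euclidean norm *)

Section plane_topology.
Context {R : realType}.
Implicit Types (x y z : plane R) (A C : set (plane R)).

(** The topology of the product comes from the maximum norm, while the estimates are Euclidean; this
    lemma and the next one convert at the cost of a factor 2. *)
Lemma ball_enorm x y (e : R) : enorm (y - x) < e -> ball x e y.
Proof.
move=> xye; split; rewrite /ball/=.
  apply: le_lt_trans xye; rewrite distrC; have := norm_dot_u_le (y - x) 0.
  by rewrite /dot /= cos0 sin0 mulr1 mulr0 addr0.
apply: le_lt_trans xye; rewrite distrC; have := norm_dot_u'_le (y - x) 0.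
by rewrite /dot /= cos0 sin0 oppr0 mulr1 mulr0 add0r.
Qed.

Lemma enorm_ball x y (e : R) : ball x e y -> enorm (y - x) < 2 * e.
Proof.
move=> -[] /=; rewrite /ball/= => h1 h2.
have e0 : 0 < e by apply: le_lt_trans h1.
rewrite ltNge -[2 * e]gtr0_norm ?mulr_gt0// -sqrtr_sqr; apply/negP.
rewrite /enorm ler_sqrt ?dot_ge0// /dot /=.
rewrite distrC in h1; rewrite distrC in h2.
have : `|y.1 - x.1| ^+ 2 < e ^+ 2 by rewrite ltrXn2r.
have : `|y.2 - x.2| ^+ 2 < e ^+ 2 by rewrite ltrXn2r.
rewrite !real_normK ?num_real//; nra.
Qed.

Lemma interior_enorm C x : C° x <-> exists2 r, 0 < r & forall y, enorm (y - x) < r -> C y.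
Proof.
split.
  move/nbhs_ballP => [r /= r0 rC]; exists r => // y /ball_enorm; exact: rC.
move=> [r r0 rC]; apply/nbhs_ballP; exists (r / 2); first by rewrite /= divr_gt0.
by move=> y /= /enorm_ball; rewrite mulrCA divff// mulr1; exact: rC.
Qed.

Lemma closure_enorm C x : closure C x <->
  forall r, 0 < r -> exists2 y, C y & enorm (y - x) < r.
Proof.
split.
  move=> Cx r r0; have r20 : 0 < r / 2 by rewrite divr_gt0.
  have [y [Cy /enorm_ball yx]] := Cx _ (nbhsx_ballx x _ r20).
  by exists y => //; rewrite mulrCA divff// mulr1 in yx.
move=> H B /nbhs_ballP[r /= r0 rB]; have [y Cy yx] := H r r0.
by exists y; split=> //; apply: rB; exact: ball_enorm.
Qed.

Lemma convex_setP C x y (t : R) : convex_set C -> C x -> C y -> 0 <= t <= 1 ->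
  C ((1 - t) *: x + t *: y).
Proof.
move=> cC Cx Cy /andP[t0 t1].
pose p : {i01 R} := Itv01 t0 t1.
have := cC y x p; rewrite !inE => /(_ Cy Cx).
by rewrite addrC.
Qed.

Lemma enormZ (a : R) x : enorm (a *: x) = `|a| * enorm x.
Proof.
rewrite /enorm dotZl; have -> : dot x (a *: x) = a * dot x x.
  by rewrite /dot /= /GRing.scale /=; ring.
by rewrite mulrA -expr2 sqrtrM ?sqr_ge0// sqrtr_sqr.
Qed.

Lemma enormN x : enorm (- x) = enorm x.
Proof. by rewrite -scaleN1r enormZ normrN1 mul1r. Qed.

Lemma enormD x y : enorm (x + y) <= enorm x + enorm y.
Proof.
rewrite enorm_le ?addr_ge0 ?enorm_ge0//.
rewrite sqrrD !enorm_sq.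
have -> : dot (x + y) (x + y) = dot x x + dot y y + 2 * dot x y.
  by rewrite /dot /=; ring.
suff : dot x y <= enorm x * enorm y by rewrite mulr2n; lra.
apply: (le_trans (ler_norm _)).
rewrite -[leLHS]sqrtr_sqr -sqrtrM ?dot_ge0// ler_wsqrtr//.
rewrite -subr_ge0.
have -> : dot x x * dot y y - dot x y ^+ 2 = cross x y ^+ 2.
  by rewrite /dot /cross; ring.
exact: sqr_ge0.
Qed.

(** As [y] is only in the closure, it is replaced by a point [y'] of [C] so close that every [z]
    near the given point is a combination, with the same weights, of [y'] and some [c'] in the ball
    around [c]. *)
Lemma interior_segment C c y (t : R) : convex_set C -> C° c -> closure C y ->
  0 <= t < 1 -> C° ((1 - t) *: c + t *: y).
Proof.
move=> cC /interior_enorm[r r0 rC] /closure_enorm Cy /andP[t0 t1].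
have s0 : 0 < 1 - t by rewrite subr_gt0.
have e0 : 0 < (1 - t) * r / 2 by rewrite divr_gt0// mulr_gt0.
have [y' Cy' yy'] := Cy _ e0.
apply/interior_enorm; exists ((1 - t) * r / 2) => // z hz.
pose c' := (1 - t)^-1 *: (z - t *: y').
have -> : z = (1 - t) *: c' + t *: y'.
  by rewrite /c' scalerA divff ?gt_eqF// scale1r subrK.
apply: convex_setP => //; last by rewrite t0 ltW.
apply: rC.
have -> : c' - c = (1 - t)^-1 *: ((z - ((1 - t) *: c + t *: y)) - t *: (y' - y)).
  apply: plane_eq; rewrite /c' /= /GRing.scale /=; field; rewrite gt_eqF//.
rewrite enormZ gtr0_norm ?invr_gt0// -ltr_pdivlMl ?invr_gt0// invrK.
apply: (le_lt_trans (enormD _ _)); rewrite enormN enormZ (ger0_norm t0).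
have : t * enorm (y' - y) <= enorm (y' - y).
  by rewrite ler_piMl ?enorm_ge0// ltW.
lra.
Qed.

End plane_topology.
(** * Periodic functions and the circle *)

Section periods.
Context {R : realType}.

Lemma period_int (T : Type) (F : R -> T) (p : R) : (forall x, F (x + p) = F x) ->
  forall (k : int) x, F (x + p * k%:~R) = F x.
Proof.
move=> Fp; have Hn n x : F (x + p * n%:R) = F x.
  elim: n x => [|n IH] x; first by rewrite mulr0 addr0.
  by rewrite -natr1 mulrDr mulr1 addrA Fp.
case=> n x; first exact: Hn.
rewrite -[in RHS](subrK (p * n.+1%:R) x) Hn; congr F.
by rewrite NegzE mulrNz mulrN.
Qed.

Lemma quasiperiod_int (F : R -> R) (p a : R) : (forall x, F (x + p) = F x + a) ->
  forall (k : int) x, F (x + p * k%:~R) = F x + a * k%:~R.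
Proof.
move=> Fp; have Hn n x : F (x + p * n%:R) = F x + a * n%:R.
  elim: n x => [|n IH] x; first by rewrite !mulr0 !addr0.
  by rewrite -natr1 !mulrDr !mulr1 addrA Fp IH addrA.
case=> n x; first exact: Hn.
have := Hn n.+1 (x - p * n.+1%:R); rewrite subrK => ->.
by rewrite NegzE !mulrNz !mulrN addrK.
Qed.

Lemma period_reduce (p a x : R) : 0 < p ->
  exists k : int, a <= x + p * k%:~R < a + p.
Proof.
move=> p0; exists (- Num.floor ((x - a) / p)); rewrite mulrNz mulrN.
have /andP[h1 h2] := floor_itv ((x - a) / p).
rewrite ler_pdivlMr// mulrC in h1; rewrite intrD1 ltr_pdivrMr// mulrDl mul1r mulrC in h2.
by apply/andP; split; lra.
Qed.

Lemma u_period (k : int) (x : R) : u (x + 2 * pi * k%:~R) = u x :> plane R.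
Proof.
apply: (@period_int _ (@u R)) => y.
by rewrite /u mulr_natl cosD2pi sinD2pi.
Qed.

Lemma cos_period (k : int) (x : R) : cos (x + 2 * pi * k%:~R) = cos x :> R.
Proof. by have [] := u_period k x. Qed.

Lemma cos_lt0 (x : R) : pi / 2 < x < 3 * (pi / 2) -> cos x < 0.
Proof.
move=> /andP[h1 h2]; rewrite -[x](subrK pi) cosDpi oppr_lt0.
by apply: cos_gt0_pihalf; apply/andP; split; lra.
Qed.

Lemma cos_ge0 (x : R) : 3 * (pi / 2) <= x <= 5 * (pi / 2) -> 0 <= cos x.
Proof.
move=> /andP[h1 h2]; have := cos_period (-1) x; rewrite mulrN1z => <-.
by apply: cos_ge0_pihalf; apply/andP; split; lra.
Qed.

Lemma cos_lt0_window (x : R) : pi / 2 <= x < 5 * (pi / 2) -> cos x < 0 ->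
  pi / 2 < x < 3 * (pi / 2).
Proof.
move=> /andP[h1 h2] cx; apply/andP; split.
  by rewrite lt_neqAle h1 andbT; apply/eqP => e; move: cx; rewrite -e cos_pihalf ltxx.
rewrite ltNge; apply/negP => h3; move: cx; rewrite ltNge => /negP; apply.
by apply: cos_ge0; rewrite h3 ltW.
Qed.

(* Qualified: HB.structures shadows eta. *)
Lemma eta_eq (p x1 x2 y : R) (k : int) : 0 < p -> 0 <= y < p ->
  x1 + y = x2 + p * k%:~R -> Defs.eta p x1 x2 = y.
Proof. by move=> p0 yp e; apply/esym/(@etaP R p x1 x2 y p0); split=> //; exists k. Qed.

Lemma circle_dist_le (p x l : R) (k k' : int) : 0 < p ->
  `|x + p * k%:~R - (l + p * k'%:~R)| < p ->
  circle_dist p x l <= `|x + p * k%:~R - (l + p * k'%:~R)|.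
Proof.
move=> p0; set d := _ - _ => dp; rewrite /circle_dist ge_min.
have [d0|d0] := leP 0 d.
  rewrite (ger0_norm d0) in dp *; apply/orP; right.
  rewrite (@eta_eq p l x d (k - k'))// ?d0// intrB /d; ring.
rewrite (ltr0_norm d0) in dp *; apply/orP; left.
rewrite (@eta_eq p x l (- d) (k' - k))// ?oppr_ge0 ?(ltW d0)// intrB /d; ring.
Qed.

Lemma circle_distE (p x y : R) : 0 < p ->
  exists k : int, `|y - x - p * k%:~R| = circle_dist p x y.
Proof.
move=> p0; have [/(_ erefl)[/andP[e1 _] _] _] := @etaP R p x y (Defs.eta p x y) p0.
have [/(_ erefl)[/andP[e2 _] _] _] := @etaP R p y x (Defs.eta p y x) p0.
rewrite /circle_dist; have [_|_] := leP (Defs.eta p x y) (Defs.eta p y x).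
  by exists (Num.floor ((y - x) / p)); rewrite ger0_norm.
exists (- Num.floor ((x - y) / p)).
rewrite -normrN -[RHS](ger0_norm e2) /Defs.eta mulrNz; congr (`| _ |); ring.
Qed.

(** For small [lambda], [l - l'] is within [2 * e] of a multiple of [p]. The choice of [e] excludes
    the multiple 0 by [d] and all others by [p - d]. *)
Lemma circle_lim_unique (p l l' : R) (F : R -> R) : 0 < p -> 0 <= l < p -> 0 <= l' < p ->
  cvg_circle_at0 p F l -> cvg_circle_at0 p F l' -> l = l'.
Proof.
move=> p0 /andP[l0 lp] /andP[l'0 l'p] Fl Fl'; apply/eqP; rewrite -subr_eq0 -normr_le0 leNgt.
apply/negP => d0; set d := `|l - l'| in d0.
have dp : d < p by rewrite /d ltr_norml; apply/andP; split; lra.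
pose e := Num.min d (p - d) / 2.
have e0 : 0 < e by rewrite divr_gt0// lt_min d0 subr_gt0.
have e1 : 2 * e <= d by rewrite mulrC divfK// ge_min lexx.
have e2 : 2 * e <= p - d by rewrite mulrC divfK// ge_min lexx orbT.
move/cvgrPdist_lt/(_ _ e0): Fl => Fl; move/cvgrPdist_lt/(_ _ e0): Fl' => Fl'.
near (0 : R)^'+ => lambda.
have : `|0 - circle_dist p (F lambda) l| < e by near: lambda.
have : `|0 - circle_dist p (F lambda) l'| < e by near: lambda.
rewrite !sub0r !normrN.
have [k <-] := circle_distE (F lambda) l p0; have [k' <-] := circle_distE (F lambda) l' p0.
rewrite !normr_id => h1 h2.
have : `|l - l' - p * (k - k')%:~R| < 2 * e.
  have -> : l - l' - p * (k - k')%:~R =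
    (l - F lambda - p * k%:~R) - (l' - F lambda - p * k'%:~R) by rewrite intrB; ring.
  by apply: (le_lt_trans (ler_normB _ _)); lra.
have [->|kk] := eqVneq (k - k') 0; first by rewrite mulr0 subr0 -/d; lra.
have : p <= `|p * (k - k')%:~R|.
  rewrite normrM gtr0_norm// ler_peMr ?(ltW p0)// -intr_norm -[1]/(1%:~R) ler_int.
  by rewrite -gtz0_ge1 normr_gt0.
have := lerB_dist (p * (k - k')%:~R) (l - l'); rewrite [in X in X -> _]distrC -/d; lra.
Unshelve. all: by end_near. Qed.

Lemma circle_lim_eq (p l : R) (F : R -> R) : 0 < p -> 0 <= l < p ->
  cvg_circle_at0 p F l -> circle_lim_at0 p F = l.
Proof.
move=> p0 lp Fl; rewrite /circle_lim_at0.
set A := [set x | _].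
have [gp gF] : A (get A) by apply: getI (_ : A l).
exact: circle_lim_unique gF Fl.
Qed.

End periods.

(** * The boundary curve *)

Section curve.
Context {R : realType}.
Variables (C : set (plane R)) (L : R) (Gamma : R -> plane R).
Hypothesis cC : convex_set C.
Hypothesis GammaP : arclength_param C L Gamma.

Let L0 : 0 < L. Proof. exact: param_period_gt0 GammaP. Qed.

Lemma Gamma_period (k : int) s : Gamma (s + L * k%:~R) = Gamma s.
Proof. exact/period_int/(param_periodic GammaP). Qed.

Lemma Gamma_boundary s : boundary C (Gamma s).
Proof.
have [k /andP[h1 h2]] := period_reduce 0 s L0; rewrite add0r in h2.
rewrite -(Gamma_period k) -(param_image GammaP); exists (s + L * k%:~R) => //=.
by rewrite in_itv/= h1.
Qed.

Lemma Gamma_closure s : closure C (Gamma s).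
Proof. by have [] := Gamma_boundary s. Qed.

Lemma Gamma_not_interior s : ~ C° (Gamma s).
Proof. by have [] := Gamma_boundary s. Qed.

Lemma Gamma_inj s s' : Gamma s = Gamma s' -> exists k : int, s' = s + L * k%:~R.
Proof.
have [k /andP[h1 h2]] := period_reduce 0 s L0.
have [k' /andP[h1' h2']] := period_reduce 0 s' L0.
rewrite add0r in h2; rewrite add0r in h2'.
rewrite -(Gamma_period k s) -(Gamma_period k' s') => e.
have := param_inj GammaP _ _ e; rewrite !in_itv/= h1 h1' => /(_ h2 h2') {}e.
by exists (k - k'); rewrite intrB; lra.
Qed.

Lemma Gamma_lip s s' : s <= s' -> enorm (Gamma s' - Gamma s) <= s' - s.
Proof.
rewrite le_eqVlt => /predU1P[->|ss'].
  by rewrite !subrr /enorm /dot /= mulr0 addr0 sqrtr0.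
rewrite -lee_fin -(param_arclength GammaP (ltW ss')); apply: ereal_sup_ubound.
exists [:: s']; first by split; rewrite /= ?ss'.
by rewrite /polygon_length /= big_nat1.
Qed.

(** Every inscribed polygon is dominated by a telescoping sum of increments of [F], and the arc
    length is the supremum of the polygons. This turns bounds on chords into bounds on arcs. *)
Lemma Gamma_length_le a b (F : R -> R) : a <= b ->
  (forall s s', a <= s -> s < s' -> s' <= b ->
    enorm (Gamma s' - Gamma s) <= F s' - F s) ->
  b - a <= F b - F a.
Proof.
move=> ab HF; rewrite -lee_fin -(param_arclength GammaP ab).
apply: ge_ereal_sup => _ [s [ps /eqP lsb] <-]; rewrite lee_fin.
rewrite /polygon_length.
have key : forall x s', a <= x -> path <%R x s' -> last x s' = b ->
    \sum_(0 <= n < size s') enorm ((Gamma \o nth b (x :: s')) n.+1 -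
      (Gamma \o nth b (x :: s')) n) <= F b - F x.
  move=> {ps lsb s} x s; elim: s x => [|y s IH] x ax /=.
    by move=> _ <-; rewrite big_nil subrr.
  move=> /andP[xy ys] lb; rewrite big_nat_recl//=.
  have yb : y <= b.
    rewrite -lb; move: (mem_last y s); rewrite in_cons => /predU1P[->//|ls].
    have := order_path_min lt_trans ys => /allP/(_ _ ls); exact: ltW.
  have -> : F b - F x = (F y - F x) + (F b - F y) by ring.
  apply: lerD; first exact: HF.
  by apply: IH => //; rewrite (le_trans ax)// ltW.
exact: key.
Qed.

End curve.
Lemma u_between {R : realType} (x y z : R) : 0 < sin (z - x) ->
  u y = (sin (z - y) / sin (z - x)) *: u x + (sin (y - x) / sin (z - x)) *: u z
    :> plane R.
Proof.
move=> s0; have sn : sin (z - x) != 0 by rewrite gt_eqF.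
apply: plane_eq; rewrite /= /GRing.scale /=.
  have -> : sin (z - y) / sin (z - x) * cos x + sin (y - x) / sin (z - x) * cos z =
    (sin (z - y) * cos x + sin (y - x) * cos z) / sin (z - x) by field.
  apply: (canRL (mulfK sn)); rewrite !sinB; ring.
have -> : sin (z - y) / sin (z - x) * sin x + sin (y - x) / sin (z - x) * sin z =
  (sin (z - y) * sin x + sin (y - x) * sin z) / sin (z - x) by field.
apply: (canRL (mulfK sn)); rewrite !sinB; ring.
Qed.

Lemma polar_exists {R : realType} (x : plane R) : exists psi, x = enorm x *: u psi.
Proof.
have [x0|x0] := eqVneq (enorm x) 0.
  exists 0; rewrite x0 scale0r; apply: (@frame_inj _ 0).
    have := norm_dot_u_le x 0; rewrite x0 normr_le0 => /eqP ->.
    by rewrite /dot /= !mul0r addr0.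
  have := norm_dot_u'_le x 0; rewrite x0 normr_le0 => /eqP ->.
  by rewrite /dot /= !mul0r addr0.
have xp : 0 < enorm x by rewrite lt_neqAle eq_sym x0 enorm_ge0.
pose a : R := x.1 / enorm x; pose b : R := x.2 / enorm x.
have ab : a ^+ 2 + b ^+ 2 = 1.
  have := enorm_sq x; rewrite /dot /a /b => e.
  apply: (@mulfI _ (enorm x ^+ 2)); first by rewrite sqrf_eq0.
  by rewrite mulr1 [RHS]e; field.
have a1 : -1 <= a <= 1.
  by rewrite -ler_norml -[leRHS]normr1 -ler_sqr ?nnegrE// !real_normK ?num_real//
    expr1n -ab lerDl sqr_ge0.
have b2 : b ^+ 2 = 1 - a ^+ 2 by rewrite -ab addrC addKr.
have xE : x = enorm x *: (a, b) :> plane R.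
  by apply: plane_eq; rewrite /a /b /= /GRing.scale /= mulrCA divff ?mulr1.
have [b0|b0] := leP 0 b.
  exists (acos a); rewrite {1}xE; congr (_ *: _).
  by rewrite /u acosK ?in_itv// sin_acos// -b2 sqrtr_sqr ger0_norm.
exists (- acos a); rewrite {1}xE; congr (_ *: _).
by rewrite /u cosN sinN acosK ?in_itv// sin_acos// -b2 sqrtr_sqr ltr0_norm// opprK.
Qed.

(** * The boundary in polar coordinates about [c] *)

Section polar.
Context {R : realType}.
Variables (C : set (plane R)) (L : R) (Gamma : R -> plane R).
Variables (c : plane R) (r D : R) (phi : R -> R).
Hypothesis cC : convex_set C.
Hypothesis GammaP : arclength_param C L Gamma.
Hypothesis r0 : 0 < r.
Hypothesis rC : forall y : plane R, enorm (y - c) < r -> C y.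
Hypothesis DC : forall y, C y -> enorm (y - c) <= D.
Hypothesis phi_cont : continuous phi.
Hypothesis phi_polar : forall s, Gamma s - c = enorm (Gamma s - c) *: u (phi s).
Hypothesis phi_period : forall s, phi (s + L) = phi s + 2 * pi.

Let L0 : 0 < L. Proof. exact: param_period_gt0 GammaP. Qed.
Let pi0 : 0 < pi :> R. Proof. exact: pi_gt0. Qed.

Let Cc : C° c. Proof. by apply/interior_enorm; exists r. Qed.

Let rho s := enorm (Gamma s - c).

Let p s := Gamma s - c.

Let GammaE s : Gamma s = c + p s. Proof. by rewrite /p addrC subrK. Qed.

Let D0 : 0 <= D.
Proof.
apply: le_trans (DC (_ : C c)); first exact: enorm_ge0.
by apply: rC; rewrite subrr /enorm /dot /= mulr0 addr0 sqrtr0.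
Qed.

Lemma closure_enorm_le y : closure C y -> enorm (y - c) <= D.
Proof.
move=> /closure_enorm Cy; apply/ler_addgt0Pr => e e0.
have [z Cz zy] := Cy e e0.
have -> : y - c = (z - c) - (z - y) by rewrite opprB [RHS]addrC addrA subrK.
apply: (le_trans (enormD _ _)); rewrite enormN; have := DC Cz; lra.
Qed.

Lemma rho_gt0 s : 0 < rho s.
Proof.
rewrite lt_neqAle enorm_ge0 andbT; apply/eqP => rho0.
apply: (Gamma_not_interior GammaP (s := s)).
by rewrite -[Gamma s](subrK c) phi_polar -/(rho s) -rho0 scale0r add0r.
Qed.

Let rho_ge0 s : 0 <= rho s. Proof. exact: enorm_ge0. Qed.

Lemma rho_le s : rho s <= D.
Proof. by apply: closure_enorm_le; exact: (Gamma_closure GammaP). Qed.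

Lemma p_polar s : p s = rho s *: u (phi s). Proof. exact: phi_polar. Qed.

Lemma phi_periodZ (k : int) s : phi (s + L * k%:~R) = phi s + 2 * pi * k%:~R.
Proof. exact: quasiperiod_int. Qed.

Lemma ray_interior (s a : R) : 0 <= a < 1 -> C° (c + a *: p s).
Proof.
move=> a01; have := interior_segment cC Cc (Gamma_closure GammaP (s := s)) a01.
suff -> : (1 - a) *: c + a *: Gamma s = c + a *: p s by [].
by rewrite scalerBl scale1r addrAC -addrA -scalerBr.
Qed.

(** Of two boundary points on one ray from [c] the nearer would be interior, so equal angles give
    equal points. The parameters then differ by k periods and the angles by k full turns, whence k =
    0. *)
Lemma phi_inj : injective phi.
Proof.
move=> s s' e; have rr : Gamma s = Gamma s'.
  have H a b : phi a = phi b -> rho b <= rho a.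
    move=> ab; rewrite leNgt; apply/negP => rab.
    apply: (Gamma_not_interior GammaP (s := a)).
    have := @ray_interior b (rho a / rho b).
    rewrite ltr_pdivrMr ?rho_gt0// mul1r rab divr_ge0 ?enorm_ge0// => /(_ isT).
    by rewrite p_polar scalerA divfK ?gt_eqF ?rho_gt0// -ab -p_polar -GammaE.
  rewrite !GammaE !p_polar e; congr (_ + _ *: _).
  by apply/eqP; rewrite eq_le !H.
have [k sk] := Gamma_inj GammaP rr.
have : phi s' = phi s + 2 * pi * k%:~R by rewrite sk phi_periodZ.
rewrite e -[LHS]addr0 => /addrI/esym/eqP.
rewrite mulf_eq0 gt_eqF ?mulr_gt0//= intr_eq0 => /eqP k0.
by rewrite sk k0 mulr0 addr0.
Qed.

Let phi_within (a b : R) : {within `[a, b], continuous phi}.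
Proof. by apply: continuous_subspaceT => x; exact: phi_cont. Qed.

(** Otherwise the value [phi s] would be taken again at or after [s'], since [phi] grows by a full
    turn over each period, against injectivity. *)
Lemma phi_lt s s' : s < s' -> phi s < phi s'.
Proof.
move=> ss'; rewrite ltNge; apply/negP => le.
pose n := Num.truncn ((s' - s) / L); have sn : s' < s + L * n.+1%:~R.
  by rewrite -ltrBlDl mulrC -ltr_pdivrMr// truncnS_gt.
have [||x] := @IVT _ phi s' (s + L * n.+1%:~R) (phi s) (ltW sn).
- exact: phi_within.
- rewrite phi_periodZ ge_min le/= le_max lerDl orbC.
  by rewrite !mulr_ge0 ?ler0z// ltW.
rewrite in_itv/= => /andP[s'x _] /phi_inj xs.
by move: ss'; rewrite -xs ltNge s'x.
Qed.

Lemma phi_mono : {mono phi : x y / x <= y}.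
Proof. by apply: le_mono => x y; exact: phi_lt. Qed.

Lemma phi_mono_lt : {mono phi : x y / x < y}.
Proof. exact: leW_mono phi_mono. Qed.

Lemma phi_surj y : exists s, phi s = y.
Proof.
have pi20 : 0 < 2 * pi :> R by rewrite mulr_gt0.
pose n := Num.truncn (`|y - phi 0| / (2 * pi)).
have hn : `|y - phi 0| < 2 * pi * n.+1%:~R.
  by rewrite mulrC -ltr_pdivrMr//; exact: truncnS_gt.
have lb : phi (0 + L * (- n.+1%:Z)%:~R) = phi 0 - 2 * pi * n.+1%:~R.
  by rewrite phi_periodZ mulrNz mulrN.
have ub : phi (0 + L * n.+1%:~R) = phi 0 + 2 * pi * n.+1%:~R by rewrite phi_periodZ.
move: hn; rewrite ltr_norml => /andP[h1 h2].
have ab : 0 + L * (- n.+1%:Z)%:~R <= 0 + L * n.+1%:~R.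
  by rewrite -phi_mono lb ub; lra.
have [||x _ <-] := @IVT _ phi _ _ y ab.
- exact: phi_within.
- by rewrite lb ub ge_min le_max; apply/andP; split; apply/orP; [left|right]; lra.
by exists x.
Qed.

(* a + b >= 1 says that Gamma s2 lies on the far side from c of the segment
   joining Gamma s1 and Gamma s3; otherwise it would be an interior point. *)
Lemma cone s1 s2 s3 : s1 <= s2 -> s2 <= s3 -> phi s3 < phi s1 + pi ->
  exists a b, [/\ 0 <= a, 0 <= b, 1 <= a + b, p s2 = a *: p s1 + b *: p s3 &
    s2 < s3 -> 0 < a].
Proof.
move=> s12 s23 s31.
have [e13|ne13] := eqVneq s1 s3.
  have e12 : s2 = s1 by apply/eqP; rewrite eq_le s12 {1}e13 s23.
  exists 1, 0; rewrite scale1r scale0r !addr0; split => //.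
  by rewrite e12.
have lt13 : s1 < s3 by rewrite lt_neqAle ne13 (le_trans s12).
have sin31 : 0 < sin (phi s3 - phi s1).
  by apply: sin_gt0_pi; rewrite subr_gt0 phi_lt// ltrBlDl.
have h1 : 0 <= phi s2 - phi s1 <= pi.
  rewrite subr_ge0 phi_mono s12 lerBlDl ltW//.
  by apply: le_lt_trans s31; rewrite phi_mono.
have h3 : 0 <= phi s3 - phi s2 <= pi.
  rewrite subr_ge0 phi_mono s23 lerBlDl ltW//.
  by apply: (lt_le_trans s31); rewrite lerD2r phi_mono.
have sin21 := sin_ge0_pi h1; have sin32 := sin_ge0_pi h3.
pose a := rho s2 * sin (phi s3 - phi s2) / (rho s1 * sin (phi s3 - phi s1)).
pose b := rho s2 * sin (phi s2 - phi s1) / (rho s3 * sin (phi s3 - phi s1)).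
have a0 : 0 <= a.
  by apply: divr_ge0; apply: mulr_ge0; rewrite ?rho_ge0 ?(ltW sin31).
have b0 : 0 <= b.
  by apply: divr_ge0; apply: mulr_ge0; rewrite ?rho_ge0 ?(ltW sin31).
have r1 := rho_gt0 s1; have r2 := rho_gt0 s2; have r3 := rho_gt0 s3.
have pE : p s2 = a *: p s1 + b *: p s3.
  rewrite !p_polar !scalerA.
  have -> : a * rho s1 = rho s2 * sin (phi s3 - phi s2) / sin (phi s3 - phi s1).
    by rewrite /a; field; rewrite !gt_eqF.
  have -> : b * rho s3 = rho s2 * sin (phi s2 - phi s1) / sin (phi s3 - phi s1).
    by rewrite /b; field; rewrite !gt_eqF.
  rewrite {1}(u_between (phi s2) sin31) scalerDr !scalerA.
  by congr (_ *: _ + _ *: _); field; rewrite gt_eqF.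
exists a, b; split=> //.
- rewrite leNgt; apply/negP => ab1.
  have b1 : b < 1 by lra.
  have a1b : 0 <= a / (1 - b) < 1.
    by rewrite divr_ge0 ?subr_ge0 ?(ltW b1)//= ltr_pdivrMr ?subr_gt0// mul1r; lra.
  apply: (Gamma_not_interior GammaP (s := s2)).
  have b01 : 0 <= b < 1 by rewrite b0.
  have := interior_segment cC (ray_interior s1 a1b) (Gamma_closure GammaP (s := s3)) b01.
  suff -> : (1 - b) *: (c + (a / (1 - b)) *: p s1) + b *: Gamma s3 = Gamma s2 by [].
  rewrite [Gamma s2]GammaE pE [Gamma s3]GammaE; apply: plane_eq.
    by rewrite /= /GRing.scale /=; field; rewrite gt_eqF// subr_gt0.
  by rewrite /= /GRing.scale /=; field; rewrite gt_eqF// subr_gt0.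
- move=> s23'; rewrite /a divr_gt0// mulr_gt0// sin_gt0_pi// subr_gt0 phi_lt//=.
  rewrite ltrBlDl; apply: (lt_le_trans s31); rewrite lerD2r phi_mono//.
Qed.

(** * Height above the support line *)

Let h t := support_inf C t.

Definition height t s := dot (Gamma s) (u t) - support_inf C t.

Local Notation f := height.

Let H t := dot c (u t) - h t.

Lemma support_inf_le t y : closure C y -> support_inf C t <= dot y (u t).
Proof.
move=> Cy; apply/ler_addgt0Pr => e e0.
have [z Cz zy] := (iffLR (closure_enorm C y)) Cy e e0.
have lb : has_lbound [set dot a (u t) | a in C].
  exists (dot c (u t) - D) => _ [a Ca <-].
  have := norm_dot_u_le (a - c) t; rewrite dotBl ler_norml => /andP[h1 _].
  have := DC Ca; lra.
have : support_inf C t <= dot z (u t) by apply: ge_inf => //; exists z.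
have := norm_dot_u_le (z - y) t; rewrite dotBl ler_norml => /andP[_ h2]; lra.
Qed.

Lemma height_ge0 t s : 0 <= f t s.
Proof. by rewrite subr_ge0; apply: support_inf_le; exact: (Gamma_closure GammaP). Qed.

Lemma center_height_ge t : r <= dot c (u t) - support_inf C t.
Proof.
apply/ler_addgt0Pr => e e0.
have [re|re] := leP r e.
  apply: (le_trans re); rewrite lerDr subr_ge0; apply: support_inf_le.
  by apply: subset_closure; apply: interior_subset; exact: Cc.
have : C (c - (r - e) *: u t).
  apply: rC; rewrite addrAC subrr add0r enormN enormZ.
  have -> : enorm (u t) = 1 by rewrite /enorm dot_u_u sqrtr1.
  by rewrite mulr1 gtr0_norm ?subr_gt0//; lra.
move=> /(@subset_closure _ C)/(support_inf_le t).
rewrite dotBl dotZl dot_u_u mulr1; lra.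
Qed.

Lemma dot_p s t : dot (p s) (u t) = rho s * cos (phi s - t).
Proof. by rewrite p_polar dotZl dot_uu -cosN opprB. Qed.

Let fE t s : f t s = dot (p s) (u t) + H t.
Proof. by rewrite /f /H /p dotBl; ring. Qed.

Lemma height_cos t s : f t s = rho s * cos (phi s - t) + H t.
Proof. by rewrite fE dot_p. Qed.

Lemma Gamma_dist s s' : enorm (Gamma s' - Gamma s) <= `|s' - s|.
Proof.
have [ss'|/ltW ss'] := leP s s'.
  by rewrite ger0_norm ?subr_ge0//; exact: (Gamma_lip GammaP).
by rewrite -enormN opprB distrC ger0_norm ?subr_ge0//; exact: (Gamma_lip GammaP).
Qed.

Lemma height_lip t s s' : `|f t s' - f t s| <= `|s' - s|.
Proof.
apply: le_trans (Gamma_dist s s'); apply: le_trans (norm_dot_u_le _ t).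
by rewrite dotBl /f opprB addrA subrK.
Qed.

Lemma height_cont t : continuous (f t).
Proof.
move=> s; apply/cvgrPdist_le => e e0; near=> s'.
apply: le_trans (height_lip _ _ _) _; near: s'.
by apply: cvgr_dist_le.
Unshelve. all: by end_near. Qed.

(** The support value is an infimum over [C], whereas compactness gives a minimum over the boundary.
    For a point of [C] not below [c], the boundary point in direction [t + pi] is lower; for a point
    below [c], the boundary point on its ray is at least as low. *)
Lemma height_attained t : exists s, f t s = 0.
Proof.
have cf : {within `[0, L], continuous f t}.
  by apply: continuous_subspaceT => x; exact: height_cont.
have [s0 s0L Hs0] := EVT_min (ltW L0) cf.
have Hs s : f t s0 <= f t s.
  have [k /andP[h1 h2]] := period_reduce 0 s L0.
  have <- : f t (s + L * k%:~R) = f t s by rewrite /f (Gamma_period GammaP).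
  by rewrite add0r in h2; apply: Hs0; rewrite in_itv/= h1 ltW.
exists s0; apply/eqP; rewrite eq_le height_ge0 andbT.
suff : h t + f t s0 <= h t by rewrite gerDl.
apply: lb_le_inf; first by exists (dot c (u t)), c => //; exact: interior_subset Cc.
move=> _ [x Cx <-].
have xcE : dot x (u t) = dot c (u t) + dot (x - c) (u t) by rewrite dotBl addrC subrK.
have [psi xpsi] := polar_exists (x - c); set m := enorm (x - c) in xpsi.
have m0 : 0 <= m by exact: enorm_ge0.
have [cos0|cos0] := leP 0 (cos (t - psi)).
  have [s1 s1E] := phi_surj (t + pi).
  have := Hs s1; rewrite (height_cos t s1) s1E addrAC subrr add0r cospi /H => h1.
  rewrite xcE xpsi dotZl dot_uu.
  have : 0 <= m * cos (t - psi) by rewrite mulr_ge0.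
  have := rho_gt0 s1; rewrite /h in h1 *; lra.
have [s1 s1E] := phi_surj psi.
have mr : m <= rho s1.
  rewrite leNgt; apply/negP => rm; apply: (Gamma_not_interior GammaP (s := s1)).
  have m_gt0 : 0 < m by apply: lt_trans rm; exact: rho_gt0.
  have am : 0 <= rho s1 / m < 1.
    by rewrite divr_ge0//= ltr_pdivrMr// mul1r.
  have := interior_segment cC Cc (subset_closure Cx) am.
  suff -> : (1 - rho s1 / m) *: c + (rho s1 / m) *: x = Gamma s1 by [].
  rewrite GammaE p_polar s1E.
  have -> : x = c + m *: u psi by rewrite -xpsi addrC subrK.
  by apply: plane_eq; rewrite /= /GRing.scale /=; field; rewrite gt_eqF.
have := Hs s1; rewrite (height_cos t s1) s1E xcE xpsi dotZl dot_uu /H.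
have -> : cos (psi - t) = cos (t - psi) by rewrite -cosN opprB.
rewrite /h; nra.
Qed.

(* The polar angle around c of a point of the face of direction t lies in this
   range: c is at positive height. *)
Definition below t s := t + pi / 2 < phi s < t + 3 * (pi / 2).

Lemma dot_p_lt0 t s : below t s -> dot (p s) (u t) < 0.
Proof.
move=> /andP[h1 h2]; rewrite dot_p pmulr_rlt0 ?rho_gt0// cos_lt0//.
by apply/andP; split; lra.
Qed.

Lemma dot_p_le0 t s : t + pi / 2 <= phi s <= t + 3 * (pi / 2) -> dot (p s) (u t) <= 0.
Proof.
move=> /andP[h1 h2]; rewrite dot_p pmulr_rle0 ?rho_gt0//.
rewrite -[phi s - t](subrK pi) cosDpi oppr_le0 cos_ge0_pihalf//.
by apply/andP; split; lra.
Qed.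

Lemma face_below t s : f t s = 0 -> t + pi / 2 <= phi s < t + 5 * (pi / 2) -> below t s.
Proof.
move=> ft /andP[h1 h2].
have cs : cos (phi s - t) < 0.
  move: ft; rewrite height_cos => /eqP; rewrite addr_eq0 => /eqP e.
  rewrite -(pmulr_rlt0 _ (rho_gt0 s)) e oppr_lt0.
  exact: lt_le_trans (center_height_ge t).
have /cos_lt0_window/(_ cs)/andP[h3 h4] : pi / 2 <= phi s - t < 5 * (pi / 2).
  by apply/andP; split; lra.
by apply/andP; split; lra.
Qed.

Lemma height_period (k : int) t s : f t (s + L * k%:~R) = f t s.
Proof. by rewrite /f (Gamma_period GammaP). Qed.

Lemma face_in_window t s : f t s = 0 -> exists k : int, below t (s + L * k%:~R).
Proof.
move=> ft; have p20 : 0 < 2 * pi :> R by rewrite mulr_gt0.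
have [k /andP[h1 h2]] := period_reduce (t + pi / 2) (phi s) p20.
exists k; apply: face_below; first by rewrite height_period.
by rewrite phi_periodZ h1/=; lra.
Qed.

(** The zeros of [f t] recur with period [L]; the bound on the polar angle selects the turn, so that
    [sigma] is a function on the line and not on the circle. *)
Definition sigma t := sup [set s | phi s <= t + 3 * (pi / 2) /\ f t s = 0].

Lemma sigmaP t : [/\ f t (sigma t) = 0, below t (sigma t) &
  forall s, phi s <= t + 3 * (pi / 2) -> f t s = 0 -> s <= sigma t].
Proof.
set S := [set s | phi s <= t + 3 * (pi / 2) /\ f t s = 0].
have [s1 hs1] := height_attained t; have [k wk] := face_in_window hs1.
have [b bE] := phi_surj (t + 3 * (pi / 2)).
have ubb s : S s -> s <= b by move=> [hs _]; rewrite -phi_mono bE.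
have ubS : has_ubound S by exists b => s; exact: ubb.
have S0 : S (s1 + L * k%:~R).
  by split; [have /andP[_ /ltW] := wk|rewrite height_period].
have nS : S !=set0 by exists (s1 + L * k%:~R).
have sub s : S s -> s <= sigma t by move=> Ss; exact: ub_le_sup.
have f0 : f t (sigma t) = 0.
  apply/eqP; rewrite eq_le height_ge0 andbT; apply/ler_addgt0Pr => e e0.
  have [|s Ss se] := sup_gt nS (x := sigma t - e); first by rewrite gtrDl oppr_lt0.
  have [_ fs] := Ss; have := height_lip t s (sigma t); rewrite fs subr0 add0r.
  rewrite [in X in _ <= X]ger0_norm ?subr_ge0 ?sub// ger0_norm ?height_ge0//; lra.
split=> //; last by move=> s h1 h2; exact: sub.
apply: face_below => //; apply/andP; split.
  have /andP[/ltW h1 _] := wk; apply: (le_trans h1); rewrite phi_mono; exact: sub.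
apply: (@le_lt_trans _ _ (t + 3 * (pi / 2))); last by rewrite ltrD2l ltr_pM2r ?divr_gt0// ltr_nat.
by rewrite -bE phi_mono; apply: ge_sup.
Qed.

Lemma height_sigma t : f t (sigma t) = 0. Proof. by have [] := sigmaP t. Qed.

Lemma sigma_below t : below t (sigma t). Proof. by have [] := sigmaP t. Qed.

Lemma le_sigma t s : phi s <= t + 3 * (pi / 2) -> f t s = 0 -> s <= sigma t.
Proof. by have [_ _] := sigmaP t; apply. Qed.

(** If [s' < s], then [p s'] and [p s] have a positive cross product. Minimality of both faces fixes
    the signs of the components of [p s' - p s] in the directions [t] and [t'], and these signs make
    the same cross product nonpositive. The sine of [t' - t] must be positive, hence the range of
    [t']. *)
Lemma face_mono t t' s s' : below t s -> f t s = 0 -> below t' s' -> f t' s' = 0 ->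
  t < t' < t + pi -> s <= s'.
Proof.
move=> wts fts wts' fts' /andP[tt' t't]; rewrite leNgt; apply/negP => s's.
have /andP[w1 w2] := wts; have /andP[w1' w2'] := wts'.
have ps's := phi_lt s's.
have c1 : 0 < cross (p s') (p s).
  rewrite !p_polar crossZl crossZr cross_uu !mulr_gt0 ?rho_gt0// sin_gt0_pi//.
  by apply/andP; split; lra.
have d1 : dot (p s) (u t) < 0 by exact: dot_p_lt0.
have d2 : dot (p s) (u t') < 0 by apply: dot_p_lt0; apply/andP; split; lra.
have v1 : 0 <= dot (p s' - p s) (u t).
  by rewrite dotBl; have := height_ge0 t s'; rewrite fE; rewrite fE in fts; lra.
have v2 : dot (p s' - p s) (u t') <= 0.
  by rewrite dotBl; have := height_ge0 t' s; rewrite fE; rewrite fE in fts'; lra.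
have s0 : 0 < sin (t' - t) by rewrite sin_gt0_pi// subr_gt0 tt' ltrBlDl.
have := cross_sin t t' (p s' - p s) (p s).
have -> : cross (p s' - p s) (p s) = cross (p s') (p s) by rewrite /cross /=; ring.
have := mulr_gt0 s0 c1; nra.
Qed.

(** [face_mono] reaches only directions less than [pi] apart, hence the steps of [pi / 2]. *)
Lemma sigma_nd : {homo sigma : t t' / t <= t'}.
Proof.
have p2 : 0 < pi / 2 :> R by rewrite divr_gt0.
have step n : forall t t', t <= t' <= t + n%:R * (pi / 2) -> sigma t <= sigma t'.
  elim: n => [|n IH] t t' /andP[t1 t2].
    have -> : t' = t by apply/eqP; rewrite eq_le t1 andbT; rewrite mul0r addr0 in t2.
    exact: lexx.
  rewrite -natr1 mulrDl mul1r addrA in t2.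
  have [tn|tn] := leP t' (t + n%:R * (pi / 2)); first by apply: IH; rewrite t1.
  have nn : t <= t + n%:R * (pi / 2) by rewrite lerDl mulr_ge0// ltW.
  apply: (@le_trans _ _ (sigma (t + n%:R * (pi / 2)))); first by apply: IH; rewrite nn lexx.
  by apply: face_mono (sigma_below _) (height_sigma _) (sigma_below _) (height_sigma _) _;
    apply/andP; split; lra.
move=> t t' tt'; pose n := Num.truncn ((t' - t) / (pi / 2)).
apply: (step n.+1); rewrite tt' -lerBlDl -ler_pdivrMr//; exact/ltW/truncnS_gt.
Qed.

Lemma sigma_period t : sigma (t + 2 * pi) = sigma t + L.
Proof.
have f2 s t0 : f (t0 + 2 * pi) s = f t0 s.
  have up := @u_period R 1 t0; rewrite mulr1 in up.
  by rewrite /f /support_inf up.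
have fL s t0 : f t0 (s + L) = f t0 s.
  by have := height_period 1 t0 s; rewrite mulr1.
apply/eqP; rewrite eq_le; apply/andP; split.
  rewrite -lerBlDr; apply: le_sigma.
    have /andP[_ /ltW] := sigma_below (t + 2 * pi).
    rewrite -[in X in X -> _](subrK L (sigma (t + 2 * pi))) phi_period; lra.
  have <- : f t (sigma (t + 2 * pi) - L + L) = f t (sigma (t + 2 * pi) - L) by [].
  by rewrite subrK -f2 height_sigma.
apply: le_sigma; last by rewrite f2 fL height_sigma.
by rewrite phi_period; have /andP[_ /ltW] := sigma_below t; lra.
Qed.

(** Let y1, y2, y3 be the levels of [sigma t], [s], [s'] relative to [c]. By [cone], y2 = a y1 + b
    y3 with a > 0 and a + b >= 1; since y1 < y3 <= 0, this is less than y3. The first inequality is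
    strict because [sigma t] ends the face. *)
Lemma height_inc t s s' : sigma t <= s -> s < s' -> phi s' <= t + 3 * (pi / 2) ->
  f t s < f t s'.
Proof.
move=> ss ss' ps'; have /andP[w1 w2] := sigma_below t.
have [|a [b [a0 b0 ab pE a_gt0]]] := cone ss (ltW ss'); first by lra.
have := height_sigma t; rewrite !fE ltrD2r => y0.
have /dot_p_le0 y3 : t + pi / 2 <= phi s' <= t + 3 * (pi / 2).
  rewrite ps' andbT (le_trans (ltW w1))// phi_mono (le_trans ss)//; exact: ltW.
have y13 : dot (p (sigma t)) (u t) < dot (p s') (u t).
  have : f t s' != 0.
    apply/eqP => e; have := le_sigma ps' e; rewrite leNgt.
    by rewrite (le_lt_trans ss).
  move=> fn0; have : 0 < f t s' by rewrite lt_neqAle eq_sym fn0 height_ge0.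
  by rewrite fE; lra.
have -> : dot (p s) (u t) = a * dot (p (sigma t)) (u t) + b * dot (p s') (u t).
  by rewrite pE dotDl !dotZl.
have := a_gt0 ss'; nra.
Qed.

(** The mirror image of [height_inc], but not strict: the face may extend to the left of [s0]. *)
Lemma height_dec t s0 s s' : f t s0 = 0 -> below t s0 -> t + pi / 2 <= phi s ->
  s <= s' -> s' <= s0 -> f t s' <= f t s.
Proof.
move=> f0 /andP[w1 w2] ps ss' s's0.
have [|a [b [a0 b0 ab pE _]]] := cone ss' s's0; first by lra.
have := height_ge0 t s; rewrite fE in f0; rewrite !fE lerD2r => y0.
have /dot_p_le0 y1 : t + pi / 2 <= phi s <= t + 3 * (pi / 2).
  rewrite ps/= (le_trans _ (ltW w2))// phi_mono; exact: le_trans s's0.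
have -> : dot (p s') (u t) = a * dot (p s) (u t) + b * dot (p s0) (u t).
  by rewrite pE dotDl !dotZl.
nra.
Qed.

(* Small enough for a face of direction t, which is at distance at least r below
   c and at most D away from it, to remain below c for all directions within
   eps0 of t. *)
Definition eps0 : R := Num.min 2^-1 (r / (2 * (D + 1))).

Lemma eps0_gt0 : 0 < eps0.
Proof. by rewrite lt_min invr_gt0 ltr0n divr_gt0// mulr_gt0// ltr_wpDl. Qed.

Lemma eps0_le : eps0 <= 2^-1. Proof. by rewrite ge_min lexx. Qed.

Let eps0_D : eps0 * D <= r / 2.
Proof.
have D1 : 0 < D + 1 by rewrite ltr_wpDl.
have : eps0 <= r / (2 * (D + 1)) by rewrite ge_min lexx orbT.
rewrite ler_pdivlMr ?mulr_gt0//; have := ltW eps0_gt0; nra.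
Qed.

Let eps0_pi : eps0 < pi / 2.
Proof. by have := eps0_le; have := @pi_ge2 R; lra. Qed.

Let cos_eps0 d : `|d| <= eps0 -> 3 / 4 <= cos d.
Proof.
move=> de; apply: le_trans (cos_ge_1B_sq d).
have : `|d| ^+ 2 <= 2^-1 ^+ 2.
  by rewrite lerXn2r ?nnegrE// (le_trans de)// eps0_le.
by rewrite real_normK ?num_real//; lra.
Qed.

(** The level of the face relative to [c] is at most - r in direction [t]. After a rotation by at
    most [eps0] it is at most - 3 r / 4 + eps0 D, which is at most - r / 4. *)
Lemma below_near t t' s : f t s = 0 -> below t s -> `|t' - t| <= eps0 -> below t' s.
Proof.
move=> fts /andP[w1 w2] tt'.
have d1 : dot (p s) (u t') < 0.
  rewrite (dot_u_rot t t'); have := cos_eps0 tt'; set d := t' - t in tt' *.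
  have := center_height_ge t; rewrite fE in fts.
  have : sin d * dot (p s) (u' t) <= eps0 * D.
    apply: (le_trans (ler_norm _)); rewrite normrM; apply: ler_pM => //.
      exact: le_trans (sin_norm_le d) tt'.
    by apply: le_trans (norm_dot_u'_le _ t) _; exact: rho_le.
  have := eps0_D; rewrite /H /h in fts; have := r0; nra.
have cs : cos (phi s - t') < 0 by move: d1; rewrite dot_p pmulr_rlt0 ?rho_gt0.
move: tt'; rewrite ler_norml => /andP[d2 d3]; have := eps0_pi => ep.
apply/andP; split; rewrite ltNge; apply/negP => hh; move: cs; rewrite ltNge => /negP; apply.
  by apply: cos_ge0_pihalf; apply/andP; split; lra.
by apply: cos_ge0; apply/andP; split; lra.
Qed.

Lemma sigma_below_near t t' : `|t' - t| <= eps0 -> below t' (sigma t).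
Proof. by move=> tt'; apply: below_near tt'; [exact: height_sigma|exact: sigma_below]. Qed.

Let dist_eps0 t t' : t <= t' <= t + eps0 -> `|t' - t| <= eps0 /\ `|t - t'| <= eps0.
Proof.
move=> /andP[h1 h2]; rewrite distrC ler0_norm ?subr_le0// opprB lerBlDl; split=> //.
Qed.

Lemma height_inc_arc t t' s s' : t <= t' <= t + eps0 ->
  sigma t <= s -> s < s' -> s' <= sigma t' -> f t s < f t s'.
Proof.
move=> /dist_eps0[d1 d2] h1 h2 h3; apply: height_inc => //.
have /andP[_ /ltW] := sigma_below_near d2; apply: le_trans; by rewrite phi_mono.
Qed.

Lemma height_dec_arc t t' s s' : t <= t' <= t + eps0 ->
  sigma t <= s -> s <= s' -> s' <= sigma t' -> f t' s' <= f t' s.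
Proof.
move=> /dist_eps0[d1 d2] h1 h2 h3.
apply: (height_dec (height_sigma t') (sigma_below t')) => //.
have /andP[/ltW w _] := sigma_below_near d1; apply: (le_trans w); by rewrite phi_mono.
Qed.

(** * The offset from the face *)

Definition offset t s := dot (Gamma (sigma t) - Gamma s) (u' t).

Local Notation q := offset.

Let qB t s s' : q t s' - q t s = - dot (Gamma s' - Gamma s) (u' t).
Proof. by rewrite /q !dotBl; ring. Qed.

Let fB t s s' : f t s' - f t s = dot (Gamma s' - Gamma s) (u t).
Proof. by rewrite /f dotBl; ring. Qed.

Lemma Gamma_diam s s' : enorm (Gamma s' - Gamma s) <= 2 * D.
Proof.
have -> : Gamma s' - Gamma s = p s' - p s by rewrite /p opprB addrA subrK.
apply: (le_trans (enormD _ _)); rewrite enormN -/(rho s) -/(rho s').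
by have := rho_le s; have := rho_le s'; lra.
Qed.

Lemma offset_sigma t : q t (sigma t) = 0.
Proof. by rewrite /q subrr /dot /= !mul0r addr0. Qed.

Lemma offset_bound t s : `|q t s| <= 2 * D.
Proof. exact: le_trans (norm_dot_u'_le _ _) (Gamma_diam _ _). Qed.

Lemma offset_lip t s s' : s <= s' -> q t s' - q t s <= s' - s.
Proof.
move=> ss'; rewrite qB; apply: (le_trans (ler_norm _)); rewrite normrN.
exact: le_trans (norm_dot_u'_le _ _) (Gamma_lip GammaP ss').
Qed.

(** The arc between the two faces descends in direction [t']. Written in the frame of [t], this
    bounds the increment of the height by tan (t' - t) times that of the offset. *)
Let arc_slope t t' s s' : t <= t' <= t + eps0 ->
  sigma t <= s -> s <= s' -> s' <= sigma t' ->
  cos (t' - t) * (f t s' - f t s) <= sin (t' - t) * (q t s' - q t s).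
Proof.
move=> tt' h1 h2 h3; have := height_dec_arc tt' h1 h2 h3.
rewrite -subr_le0 !fB qB (dot_u_rot t t'); lra.
Qed.

(** By [arc_slope], a chord of this arc makes an angle of at most [t' - t] with the support line of
    direction [t], so its projection keeps at least the cosine of its length. *)
Lemma arc_le_offset t t' s s' : t <= t' <= t + eps0 ->
  sigma t <= s -> s <= s' -> s' <= sigma t' ->
  cos (t' - t) * enorm (Gamma s' - Gamma s) <= q t s' - q t s.
Proof.
move=> tt' h1 h2 h3; have [e|ne] := eqVneq t t'.
  have -> : s' = s by apply/eqP; rewrite eq_le h2 (le_trans h3)// -e.
  by rewrite !subrr /enorm /dot /= mulr0 addr0 sqrtr0 mulr0.
have lt : t < t' by rewrite lt_neqAle ne; have /andP[] := tt'.
have [d1 _] := dist_eps0 tt'.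
have cd := cos_eps0 d1; have ep := eps0_pi.
have sd : 0 < sin (t' - t).
  rewrite sin_gt0_pi// subr_gt0 lt/=; rewrite ger0_norm ?subr_ge0 ?(ltW lt)// in d1; lra.
have sl := arc_slope tt' h1 h2 h3.
have fi : 0 <= f t s' - f t s.
  move: h2; rewrite le_eqVlt subr_ge0 => /predU1P[->//|h2].
  exact/ltW/(height_inc_arc tt').
have q0 : 0 <= q t s' - q t s.
  by rewrite -(pmulr_rge0 _ sd); apply: le_trans sl; rewrite mulr_ge0//; lra.
rewrite -[cos _]gtr0_norm; last by lra.
rewrite -enormZ enorm_le// (dot_frame t) !dotZl -fB.
have -> : dot (Gamma s' - Gamma s) (u' t) = - (q t s' - q t s) by rewrite qB opprK.
have cs := cos2Dsin2 (t' - t).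
have : (cos (t' - t) * (f t s' - f t s)) ^+ 2 <= (sin (t' - t) * (q t s' - q t s)) ^+ 2.
  by rewrite lerXn2r ?nnegrE ?mulr_ge0// ?(ltW sd)//; lra.
have -> : (cos (t' - t) * - (q t s' - q t s)) ^+ 2 = (cos (t' - t)) ^+ 2 * (q t s' - q t s) ^+ 2.
  by ring.
rewrite [X in _ <= X -> _]exprMn (_ : sin (t' - t) ^+ 2 = 1 - cos (t' - t) ^+ 2); last lra.
lra.
Qed.

(** The bound on chords passes to arc length with the offset divided by the cosine as the dominating
    function. *)
Lemma offset_inc t t' s s' : t <= t' <= t + eps0 ->
  sigma t <= s -> s <= s' -> s' <= sigma t' ->
  (1 - (t' - t) ^+ 2) * (s' - s) <= q t s' - q t s.
Proof.
move=> tt' h1 h2 h3; have [d1 _] := dist_eps0 tt'.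
have cd := cos_eps0 d1; have c0 : 0 < cos (t' - t) by lra.
have : s' - s <= q t s' / cos (t' - t) - q t s / cos (t' - t).
  apply: (Gamma_length_le GammaP (F := fun s => q t s / cos (t' - t)) h2).
  move=> x y sx xy ys'.
  rewrite -mulrBl ler_pdivlMr// mulrC; apply: (arc_le_offset tt') => //.
  - exact: le_trans sx.
  - exact: ltW.
  - exact: le_trans h3.
rewrite -mulrBl ler_pdivlMr// mulrC; apply: le_trans.
by rewrite ler_wpM2r ?subr_ge0// cos_ge_1B_sq.
Qed.

Lemma height_small t t' s : t <= t' <= t + eps0 ->
  sigma t <= s <= sigma t' -> f t s <= 4 * D * (t' - t).
Proof.
move=> tt' /andP[h1 h2]; have [d1 _] := dist_eps0 tt'; have cd := cos_eps0 d1.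
have := arc_slope tt' (lexx _) h1 h2; rewrite height_sigma offset_sigma !subr0 => h3.
have t0 : 0 <= t' - t by rewrite subr_ge0; have /andP[] := tt'.
have : sin (t' - t) * q t s <= (t' - t) * (2 * D).
  apply: (le_trans (ler_norm _)); rewrite normrM; apply: ler_pM => //.
    by rewrite -[leRHS](ger0_norm t0); exact: sin_norm_le.
  exact: offset_bound.
have := height_ge0 t s; nra.
Qed.

(** The point at [sigma t] realizes the support value at [t] and bounds the one at [t'] from above,
    which leaves the rotation of a fixed vector of length at most 2 D. Replacing the sine by [d] and
    the cosine by 1 costs 2 D d^2 each. *)
Lemma height_subgrad t t' s :
  - q t s * (t' - t) - 4 * D * (t' - t) ^+ 2 <= f t' s - f t s.
Proof.
set d := t' - t.
have h1 : support_inf C t' <= dot (Gamma (sigma t)) (u t').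
  by apply: support_inf_le; exact: (Gamma_closure GammaP).
have h2 : support_inf C t = dot (Gamma (sigma t)) (u t).
  by have /eqP := height_sigma t; rewrite subr_eq0 => /eqP.
have : dot (Gamma s - Gamma (sigma t)) (u t') - dot (Gamma s - Gamma (sigma t)) (u t)
  <= f t' s - f t s by rewrite /f !dotBl; lra.
apply: le_trans; rewrite (dot_u_rot t t') -/d.
have -> : dot (Gamma s - Gamma (sigma t)) (u' t) = - q t s by rewrite /q !dotBl; ring.
have h3 : `|dot (Gamma s - Gamma (sigma t)) (u t)| <= 2 * D.
  exact: le_trans (norm_dot_u_le _ _) (Gamma_diam _ _).
have h4 := offset_bound t s; have h5 := sin_dist d; have h6 := cos_ge_1B_sq d.
have h7 := cos_le1 d.
have h8 : q t s * (sin d - d) <= 2 * D * d ^+ 2.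
  by apply: (le_trans (ler_norm _)); rewrite normrM; apply: ler_pM.
have h9 : (1 - cos d) * dot (Gamma s - Gamma (sigma t)) (u t) <= d ^+ 2 * (2 * D).
  apply: (le_trans (ler_norm _)); rewrite normrM; apply: ler_pM => //.
  by rewrite ger0_norm; lra.
lra.
Qed.

(** If [sigma] jumped by more than [e] just after [t], then by [height_small] the point at
    [sigma t + e] would have height O(d) for all small d. It would lie on the face of [t], beyond
    its last parameter. *)
Lemma sigma_rc t e : 0 < e -> exists2 d, 0 < d & sigma (t + d) <= sigma t + e.
Proof.
move=> e0; apply: contrapT => hn.
have lte d : 0 < d -> sigma t + e < sigma (t + d).
  by move=> d0; rewrite ltNge; apply/negP => h1; apply: hn; exists d.
have h1 d : 0 < d <= eps0 -> f t (sigma t + e) <= 4 * D * d.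
  move=> /andP[d0 de]; have := @height_small t (t + d) (sigma t + e).
  rewrite addrAC subrr add0r; apply; first by rewrite lerDl (ltW d0) lerD2l.
  by rewrite lerDl (ltW e0) (ltW (lte d d0)).
have f0 : f t (sigma t + e) = 0.
  apply/eqP; rewrite eq_le height_ge0 andbT; apply/ler_addgt0Pr => x x0; rewrite add0r.
  have D1 : 0 < 4 * D + 1 by rewrite ltr_wpDl// mulr_ge0.
  pose d := Num.min eps0 (x / (4 * D + 1)).
  have d0 : 0 < d by rewrite lt_min eps0_gt0 divr_gt0.
  have de : 0 < d <= eps0 by rewrite d0 ge_min lexx.
  have : d * (4 * D + 1) <= x by rewrite -ler_pdivlMr// ge_min lexx orbT.
  have := h1 d de; lra.
have : sigma t + e <= sigma t.
  apply: le_sigma => //.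
  have de : 0 < eps0 <= eps0 by rewrite eps0_gt0 lexx.
  have := lte _ eps0_gt0; rewrite -phi_mono_lt => /ltW/le_trans; apply.
  have /sigma_below_near/andP[_ /ltW] : `|t - (t + eps0)| <= eps0.
    by rewrite opprD addrA subrr add0r normrN ger0_norm// ltW// eps0_gt0.
  by [].
by rewrite gerDl leNgt e0.
Qed.

Lemma height_at_pi t s : phi s = t + 3 * (pi / 2) \/ phi s = t + pi / 2 -> f t s = H t.
Proof.
rewrite height_cos => -[] ->; rewrite addrAC subrr add0r.
  have -> : 3 * (pi / 2) = pi / 2 + pi :> R by field.
  by rewrite cosDpi cos_pihalf oppr0 mulr0 add0r.
by rewrite cos_pihalf mulr0 add0r.
Qed.

Lemma right_end_exists t lambda : 0 < lambda < r ->
  exists s, [/\ sigma t < s, phi s < t + 3 * (pi / 2) & f t s = lambda].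
Proof.
move=> /andP[l0 lr]; have [b bE] := phi_surj (t + 3 * (pi / 2)).
have fb : f t b = H t by apply: height_at_pi; left.
have Hl : lambda < H t by apply: (lt_le_trans lr); exact: center_height_ge.
have sb : sigma t <= b.
  by rewrite -phi_mono bE; have /andP[_ /ltW] := sigma_below t.
have [||s] := @IVT _ (f t) (sigma t) b lambda sb.
- by apply: continuous_subspaceT => x; exact: height_cont.
- by rewrite height_sigma fb ge_min (ltW l0)/= le_max (ltW Hl) orbT.
rewrite in_itv/= => /andP[h1 h2] fs; exists s; split=> //.
- rewrite lt_neqAle h1 andbT; apply/eqP => e.
  by move: fs l0; rewrite -e height_sigma => <-; rewrite ltxx.
- rewrite -bE phi_mono_lt lt_neqAle h2 andbT; apply/eqP => e.
  by move: fs Hl; rewrite e fb => ->; rewrite ltxx.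
Qed.

Lemma left_end_exists t lambda : 0 < lambda < r ->
  exists s, [/\ s < sigma t, t + pi / 2 < phi s & f t s = lambda].
Proof.
move=> /andP[l0 lr]; have [a aE] := phi_surj (t + pi / 2).
have fa : f t a = H t by apply: height_at_pi; right.
have Hl : lambda < H t by apply: (lt_le_trans lr); exact: center_height_ge.
have sa : a <= sigma t.
  by rewrite -phi_mono aE; have /andP[/ltW] := sigma_below t.
have [||s] := @IVT _ (f t) a (sigma t) lambda sa.
- by apply: continuous_subspaceT => x; exact: height_cont.
- by rewrite height_sigma fa ge_min (ltW l0) orbT le_max (ltW Hl).
rewrite in_itv/= => /andP[h1 h2] fs; exists s; split=> //.
- rewrite lt_neqAle h2 andbT; apply/eqP => e.
  by move: fs l0; rewrite e height_sigma => <-; rewrite ltxx.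
- rewrite -aE phi_mono_lt lt_neqAle h1 andbT; apply/eqP => e.
  by move: fs Hl; rewrite -e fa => ->; rewrite ltxx.
Qed.

(** * Chords *)

Section chord_analysis.
Variables (t lambda sm sp : R).
Hypothesis lambda_r : 0 < lambda < r.
Hypothesis sm_lt : sm < sigma t.
Hypothesis sm_gt : t + pi / 2 < phi sm.
Hypothesis f_sm : f t sm = lambda.
Hypothesis sp_gt : sigma t < sp.
Hypothesis sp_lt : phi sp < t + 3 * (pi / 2).
Hypothesis f_sp : f t sp = lambda.

Let X (x : plane R) := dot x (u' t).
Let Y (x : plane R) := dot x (u t).
Let lvl := support_inf C t + lambda.

Let Hl : lambda < H t.
Proof. by have /andP[_ h1] := lambda_r; apply: lt_le_trans h1 (center_height_ge t). Qed.

Let YB : Y (Gamma sp) = lvl.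
Proof. by have := f_sp; rewrite /Y /lvl /f => <-; rewrite addrC subrK. Qed.

Let YA : Y (Gamma sm) = lvl.
Proof. by have := f_sm; rewrite /Y /lvl /f => <-; rewrite addrC subrK. Qed.

(** The point at height [lambda] on the segment from [c] to the end of the face. It is interior to
    [C] and separates the two ends of the chord. *)
Let c0 : plane R := c + (1 - lambda / H t) *: p (sigma t).

Let H0 : 0 < H t. Proof. by have /andP[l0 _] := lambda_r; exact: lt_trans Hl. Qed.

Let tau01 : 0 < 1 - lambda / H t < 1.
Proof.
have /andP[l0 _] := lambda_r.
by rewrite subr_gt0 ltr_pdivrMr// mul1r Hl/= gtrBl divr_gt0.
Qed.

Let Cc0 : C° c0.
Proof. by apply: ray_interior; have /andP[/ltW -> ->] := tau01. Qed.

Let Yc0 : Y c0 = lvl.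
Proof.
have := height_sigma t; rewrite fE => e.
rewrite /Y /c0 dotDl dotZl (_ : dot (p (sigma t)) (u t) = - H t); last by lra.
by have := H0; rewrite /lvl /H /h => h0; field; rewrite gt_eqF.
Qed.

(** For points on one level below [c] the cross product is a negative multiple of the difference of
    the coordinates, so the coordinate decreases as the polar angle grows. *)
Let X_order (x y : plane R) : Y x = lvl -> Y y = lvl ->
  0 < cross (x - c) (y - c) -> X y < X x.
Proof.
move=> Yx Yy; rewrite (cross_frame t) !dotBl -/(X x) -/(X y) -/(Y x) -/(Y y) Yx Yy.
have : lvl - dot c (u t) < 0 by have := Hl; rewrite /lvl /H /h; lra.
nra.
Qed.

Let XBc : X (Gamma sp) < X c0.
Proof.
apply: X_order => //; rewrite /c0 addrAC subrr add0r -/(p sp).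
rewrite crossZl !p_polar crossZl crossZr cross_uu !mulr_gt0 ?rho_gt0//.
  by have /andP[] := tau01.
rewrite sin_gt0_pi// subr_gt0 phi_lt//=; have /andP[] := sigma_below t; have := sp_lt; lra.
Qed.

Let XcA : X c0 < X (Gamma sm).
Proof.
apply: X_order => //; rewrite /c0 addrAC subrr add0r -/(p sm).
rewrite crossZr !p_polar crossZl crossZr cross_uu !mulr_gt0 ?rho_gt0//.
  by have /andP[] := tau01.
rewrite sin_gt0_pi// subr_gt0 phi_lt//=; have /andP[] := sigma_below t; have := sm_gt; lra.
Qed.

Let level_combination (x y z : plane R) : Y x = lvl -> Y y = lvl -> Y z = lvl ->
  (X x - X y) * (X x - X z) < 0 \/ x = y -> closure C z -> C° y -> C° x.
Proof.
move=> Yx Yy Yz [xyz|->//] Cz Cy.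
have zy : X z - X y != 0.
  by rewrite subr_eq0; apply/eqP => e; move: xyz; rewrite e -expr2 ltNge sqr_ge0.
pose k := (X x - X y) / (X z - X y).
have k01 : 0 <= k < 1.
  rewrite /k; have [zy0|zy0] := ltP 0 (X z - X y).
    by rewrite ler_pdivlMr// ltr_pdivrMr// mul0r mul1r; apply/andP; split; nra.
  have zy1 : X z - X y < 0 by rewrite lt_neqAle zy.
  by rewrite ler_ndivlMr// ltr_ndivrMr// mul0r mul1r; apply/andP; split; nra.
have := interior_segment cC Cy Cz k01.
suff -> : (1 - k) *: y + k *: z = x by [].
apply: (@frame_inj _ t); rewrite dotDl !dotZl.
  by rewrite -/(Y x) -/(Y y) -/(Y z) Yx Yy Yz; ring.
by rewrite -/(X x) -/(X y) -/(X z) /k; field.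
Qed.

Lemma chord_closed_bound x : closure C x -> Y x = lvl ->
  X (Gamma sp) <= X x <= X (Gamma sm).
Proof.
move=> Cx Yx; apply/andP; split; rewrite leNgt; apply/negP => lt.
  apply: (Gamma_not_interior GammaP (s := sp)).
  apply: (level_combination YB Yc0 Yx) => //; left; have := XBc; nra.
apply: (Gamma_not_interior GammaP (s := sm)).
apply: (level_combination YA Yc0 Yx) => //; left; have := XcA; nra.
Qed.

Lemma chord_open_interior x : Y x = lvl -> X (Gamma sp) < X x < X (Gamma sm) -> C° x.
Proof.
move=> Yx /andP[h1 h2]; have [e|] := eqVneq (X x) (X c0).
  have -> : x = c0 by apply: (@frame_inj _ t); [exact: etrans Yx (esym Yc0)|exact: e].
  exact: Cc0.
rewrite neq_lt => /orP[xc|xc].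
  apply: (level_combination Yx Yc0 YB) => //; last exact: (Gamma_closure GammaP).
  by left; nra.
apply: (level_combination Yx Yc0 YA) => //; last exact: (Gamma_closure GammaP).
by left; nra.
Qed.

Let seg := [set x | Y x = lvl /\ X (Gamma sp) <= X x <= X (Gamma sm)].

(** The end points may be missing from [C], but a small move towards [c0] leads from any point of
    the closed segment into the interior. *)
Lemma closure_chord : closure (chord C t lambda) = seg.
Proof.
have enormX x y : `|X x - X y| <= enorm (x - y) by rewrite /X -dotBl; exact: norm_dot_u'_le.
have enormY x y : `|Y x - Y y| <= enorm (x - y) by rewrite /Y -dotBl; exact: norm_dot_u_le.
have chB x : chord C t lambda x -> seg x.
  by move=> [Cx Yx]; split=> //; apply: chord_closed_bound => //; exact: subset_closure.
apply/seteqP; split=> x.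
  move=> /closure_enorm Hx; split.
    apply/eqP; rewrite -subr_eq0 -normr_le0; apply/ler_addgt0Pr => e e0; rewrite add0r.
    have [y [_ Yy] yx] := Hx e e0; have := enormY y x.
    by rewrite /Y Yy -/lvl -/(Y x) distrC; lra.
  apply/andP; split; apply/ler_addgt0Pr => e e0; have [y Cy yx] := Hx e e0.
    have [_ /andP[h1 h2]] := chB y Cy; have := enormX y x; rewrite ler_norml => /andP[_]; lra.
  have [_ /andP[h1 h2]] := chB y Cy; have := enormX y x; rewrite ler_norml => /andP[+ _]; lra.
move=> [Yx /andP[h1 h2]]; apply/closure_enorm => e e0.
pose k := Num.min 2^-1 (e / (2 * (enorm (c0 - x) + 1))).
have n1 : 0 < enorm (c0 - x) + 1 by rewrite ltr_wpDl// enorm_ge0.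
have k0 : 0 < k by rewrite lt_min invr_gt0 ltr0n divr_gt0// mulr_gt0.
have k1 : k <= 2^-1 by rewrite ge_min lexx.
have ke : k * (2 * (enorm (c0 - x) + 1)) <= e.
  by rewrite -ler_pdivlMr ?mulr_gt0// ge_min lexx orbT.
exists (x + k *: (c0 - x)).
  have Yx' : Y (x + k *: (c0 - x)) = lvl.
    by rewrite /Y dotDl dotZl dotBl -/(Y x) -/(Y c0) Yx Yc0; ring.
  split; last exact: Yx'.
  apply: interior_subset; apply: chord_open_interior => //.
  rewrite /X dotDl dotZl dotBl -/(X x) -/(X c0) -/(X (Gamma sp)) -/(X (Gamma sm)).
  have := XBc; have := XcA => a1 a2; apply/andP; split; nra.
rewrite addrAC subrr add0r enormZ gtr0_norm//.
have := enorm_ge0 (c0 - x); nra.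
Qed.

Lemma extreme_chord : extreme_points (closure (chord C t lambda)) =
  [set Gamma sm; Gamma sp].
Proof.
rewrite closure_chord; have XBA : X (Gamma sp) < X (Gamma sm) by exact: lt_trans XBc XcA.
have segA : seg (Gamma sm) by split=> //; rewrite lexx ltW.
have segB : seg (Gamma sp) by split=> //; rewrite lexx ltW.
have segE x y : seg x -> seg y -> X x = X y -> x = y.
  by move=> [Yx _] [Yy _] e; apply: (@frame_inj _ t) => //; exact: etrans Yx (esym Yy).
apply/seteqP; split=> x.
  move=> [[Yx /andP[h1 h2]] ext].
  have [e|neA] := eqVneq (X x) (X (Gamma sm)).
    by left; apply: segE => //; split=> //; rewrite h1.
  have [e|neB] := eqVneq (X x) (X (Gamma sp)).
    by right; apply: segE => //; split=> //; rewrite h1.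
  exfalso; pose k := (X x - X (Gamma sp)) / (X (Gamma sm) - X (Gamma sp)).
  have d0 : 0 < X (Gamma sm) - X (Gamma sp) by rewrite subr_gt0.
  have k01 : 0 < k < 1.
    rewrite /k ltr_pdivlMr// ltr_pdivrMr// mul0r mul1r subr_gt0 ltrD2r.
    by rewrite !lt_neqAle h1 h2 neA eq_sym neB.
  have AB := ext (Gamma sm) (Gamma sp) k segA segB k01.
  move: XBA; rewrite AB ?ltxx//; apply: (@frame_inj _ t).
    by rewrite dotDl !dotZl -/(Y x) -/(Y (Gamma sm)) -/(Y (Gamma sp)) Yx YA YB; ring.
  rewrite dotDl !dotZl -/(X x) -/(X (Gamma sm)) -/(X (Gamma sp)) /k; field.
  by rewrite gt_eqF.
have comb a b k : X (k *: a + (1 - k) *: b) = k * X a + (1 - k) * X b.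
  by rewrite /X dotDl !dotZl.
case=> ->; split=> // a b k Sa Sb /andP[k0 k1] /(congr1 X); rewrite comb => e.
  have [_ /andP[_ ha]] := Sa; have [_ /andP[_ hb]] := Sb.
  by apply: segE => //; nra.
have [_ /andP[ha _]] := Sa; have [_ /andP[hb _]] := Sb.
by apply: segE => //; nra.
Qed.

Lemma line_length_chord :
  line_length t (chord C t lambda) = (X (Gamma sm) - X (Gamma sp))%:E.
Proof.
have XBA : X (Gamma sp) < X (Gamma sm) by exact: lt_trans XBc XcA.
apply: measure_itv_between; first exact: ltW.
  move=> v /=; rewrite in_itv/= => hv.
  pose x : plane R := lvl *: u t + v *: u' t.
  have Yx : Y x = lvl by rewrite /Y /x dotDl !dotZl dot_u_u dot_u'_u mulr1 mulr0 addr0.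
  have Xx : X x = v by rewrite /X /x dotDl !dotZl dot_u_u' dot_u'_u' mulr1 mulr0 add0r.
  exists x => //; split=> //; apply: interior_subset; apply: chord_open_interior => //.
  by rewrite Xx.
move=> _ [x [Cx Yx] <-] /=; rewrite in_itv/=; apply: chord_closed_bound => //.
exact: subset_closure.
Qed.

Let chord_diff : Gamma sm - Gamma sp = (X (Gamma sm) - X (Gamma sp)) *: u' t.
Proof.
apply: (@frame_inj _ t); rewrite dotBl dotZl.
  by rewrite dot_u'_u mulr0 -/(Y (Gamma sm)) -/(Y (Gamma sp)) YA YB subrr.
by rewrite dot_u'_u' mulr1.
Qed.

(** [get] may return any pair satisfying [chord_ends]. The extreme points fix the two boundary
    points up to order, the sign of their difference along [u' t] fixes the order, and injectivity
    fixes the parameters modulo [L]. *)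
Lemma s_pm_ends : exists km kp : int,
  [/\ 0 <= s_minus C L Gamma t lambda < L, 0 <= s_plus C L Gamma t lambda < L,
    s_minus C L Gamma t lambda = sm + L * km%:~R &
    s_plus C L Gamma t lambda = sp + L * kp%:~R].
Proof.
have XBA : X (Gamma sp) < X (Gamma sm) by exact: lt_trans XBc XcA.
have [km hkm] := period_reduce 0 sm L0; have [kp hkp] := period_reduce 0 sp L0.
rewrite add0r in hkm; rewrite add0r in hkp.
have : chord_ends C L Gamma t lambda (get (chord_ends C L Gamma t lambda)).
  apply: getI (_ : chord_ends C L Gamma t lambda (sm + L * km%:~R, sp + L * kp%:~R)).
  split=> //=; rewrite !(Gamma_period GammaP); first exact: extreme_chord.
  by rewrite line_length_chord chord_diff.
rewrite /s_minus /s_plus; set s := get _ => -[s1 s2].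
rewrite extreme_chord line_length_chord /= => ext dif.
have g1 : [set Gamma sm; Gamma sp] (Gamma s.1) by rewrite ext; left.
have g2 : [set Gamma sm; Gamma sp] (Gamma s.2) by rewrite ext; right.
have dX : X (Gamma s.1) - X (Gamma s.2) = X (Gamma sm) - X (Gamma sp).
  by rewrite /X -dotBl dif dotZl dot_u'_u' mulr1.
have e1 : Gamma sm = Gamma s.1.
  case: g1 => // e; exfalso; case: g2 => e2; rewrite e e2 in dX; lra.
have e2 : Gamma sp = Gamma s.2.
  case: g2 => // e2; exfalso; rewrite -e1 e2 in dX; lra.
have [k1 E1] := Gamma_inj GammaP e1; have [k2 E2] := Gamma_inj GammaP e2.
by exists k1, k2; split.
Qed.

End chord_analysis.

(* The directions whose face is a nontrivial segment; s_o is the middle of the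
   segment there, and equal to sigma modulo L elsewhere. *)
Definition flat_angles : set R := [set t | exists s, [/\ s < sigma t, f t s = 0 & below t s]].

(** The height strictly increases after [sigma t], so [d] can be its value at [sigma t + e],
    provided this parameter is still in the range of monotonicity. *)
Lemma right_end_near t e : 0 < e -> exists2 d, 0 < d & forall lambda s, lambda < d ->
  phi s < t + 3 * (pi / 2) -> f t s = lambda -> s < sigma t + e.
Proof.
move=> e0; have [h1|h1] := leP (phi (sigma t + e)) (t + 3 * (pi / 2)).
  exists (f t (sigma t + e)).
    rewrite -(height_sigma t); apply: height_inc => //; by rewrite ltrDl.
  move=> lambda s ld ps fs; rewrite ltNge; apply/negP; rewrite le_eqVlt => /predU1P[se|se].
    by move: ld; rewrite -fs -se ltxx.
  have : f t (sigma t + e) < f t s.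
    by apply: height_inc => //; [rewrite lerDl ltW|exact: ltW].
  by rewrite fs; move: ld; lra.
exists 1 => // lambda s _ ps _; rewrite -phi_mono_lt; exact: lt_trans h1.
Qed.

(** Before [sigma t] the height is only known to be nonincreasing. Its value at [sigma t - e] is
    positive because the face is a single point. *)
Lemma left_end_near t e : ~ flat_angles t -> 0 < e -> exists2 d, 0 < d &
  forall lambda s, lambda < d -> t + pi / 2 < phi s -> s < sigma t -> f t s = lambda ->
    sigma t - e < s.
Proof.
move=> nt e0; have [h1|h1] := ltP (phi (sigma t - e)) (t + pi / 2).
  exists 1 => // lambda s _ ps _ _; rewrite -phi_mono_lt; exact: lt_trans ps.
have se : sigma t - e < sigma t by rewrite gtrBl.
exists (f t (sigma t - e)).
  rewrite lt_neqAle height_ge0 andbT; apply/eqP => f0; apply: nt.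
  exists (sigma t - e); split=> //; apply: face_below => //; rewrite h1/=.
  have := phi_lt se; have /andP[_ h2] := sigma_below t; have := pi0; lra.
move=> lambda s ld ps _ fs; rewrite ltNge; apply/negP => h2.
have : f t (sigma t - e) <= f t s.
  by apply: (height_dec (height_sigma t) (sigma_below t)) => //; exact: ltW.
by rewrite fs; move: ld; lra.
Qed.

Lemma cvg_circle_ends t k : ~ flat_angles t ->
  cvg_circle_at0 L (s_minus C L Gamma t) (sigma t + L * k%:~R) /\
  cvg_circle_at0 L (s_plus C L Gamma t) (sigma t + L * k%:~R).
Proof.
(* The cap [L / 2] keeps the distance of the lifts below a full period, as [circle_dist_le]
   requires. *)
move=> nt; split; apply/cvgrPdist_le => e e0;
  (have me : 0 < Num.min e (L / 2) by rewrite lt_min e0 divr_gt0);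
  have me1 : Num.min e (L / 2) <= e by [rewrite ge_min lexx];
  have me2 : Num.min e (L / 2) < L by [rewrite gt_min ltr_pdivrMr// ltr_pMr// ltr1n orbT].
- have [d d0 hd] := left_end_near nt me.
  near=> lambda.
  have lr : 0 < lambda < r.
    by apply/andP; split; near: lambda; [exact: nbhs_right_gt|exact: nbhs_right_lt].
  have ld : lambda < d by near: lambda; exact: nbhs_right_lt.
  have [sp [sp1 sp2 sp3]] := right_end_exists t lr.
  have [sm [sm1 sm2 sm3]] := left_end_exists t lr.
  have [km [_ [_ _ -> _]]] := s_pm_ends lr sm1 sm2 sm3 sp1 sp2 sp3.
  have h1 := hd _ _ ld sm2 sm1 sm3.
  have h2 : `|sm - sigma t| <= Num.min e (L / 2) by rewrite ltr0_norm ?subr_lt0//; lra.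
  rewrite sub0r normrN ger0_norm; last first.
    by have [k' <-] := circle_distE (sm + L * km%:~R) (sigma t + L * k%:~R) L0.
  have := @circle_dist_le _ L (sm + L * km%:~R) (sigma t + L * k%:~R) (- km) (- k) L0.
  rewrite !mulrNz !mulrN !addrK => /(_ (le_lt_trans h2 me2))/le_trans; apply.
  exact: le_trans h2 me1.
- have [d d0 hd] := right_end_near t me.
  near=> lambda.
  have lr : 0 < lambda < r.
    by apply/andP; split; near: lambda; [exact: nbhs_right_gt|exact: nbhs_right_lt].
  have ld : lambda < d by near: lambda; exact: nbhs_right_lt.
  have [sp [sp1 sp2 sp3]] := right_end_exists t lr.
  have [sm [sm1 sm2 sm3]] := left_end_exists t lr.
  have [_ [kp [_ _ _ ->]]] := s_pm_ends lr sm1 sm2 sm3 sp1 sp2 sp3.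
  have h1 := hd _ _ ld sp2 sp3.
  have h2 : `|sp - sigma t| <= Num.min e (L / 2) by rewrite gtr0_norm ?subr_gt0//; lra.
  rewrite sub0r normrN ger0_norm; last first.
    by have [k' <-] := circle_distE (sp + L * kp%:~R) (sigma t + L * k%:~R) L0.
  have := @circle_dist_le _ L (sp + L * kp%:~R) (sigma t + L * k%:~R) (- kp) (- k) L0.
  rewrite !mulrNz !mulrN !addrK => /(_ (le_lt_trans h2 me2))/le_trans; apply.
  exact: le_trans h2 me1.
Unshelve. all: by end_near. Qed.

(** Both ends converge to the same point of the circle, so the halfway correction in [s_o]
    vanishes. *)
Lemma s_oE t : ~ flat_angles t -> exists k : int, s_o C L Gamma t = sigma t + L * k%:~R.
Proof.
move=> nt; have [k hk] := period_reduce 0 (sigma t) L0; rewrite add0r in hk.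
have [cm cp] := cvg_circle_ends k nt; exists k.
rewrite /s_o /s_o_minus /s_o_plus (circle_lim_eq L0 hk cm) (circle_lim_eq L0 hk cp).
by rewrite /Defs.eta subrr mul0r floor0 mulr0 subr0 mulr0 addr0.
Qed.

(** Projecting in direction [u t] leaves the coordinate along [u' t] unchanged, so the arc and its
    projection have the same image. *)
Lemma semichord_image t lambda sp : ~ flat_angles t -> 0 < lambda < r ->
  sigma t < sp -> phi sp < t + 3 * (pi / 2) -> f t sp = lambda ->
  [set dot x (u' t) | x in right_semichord C L Gamma t lambda] =
  (fun s => dot (Gamma s) (u' t)) @` `[sigma t, sp].
Proof.
move=> nt lr sp1 sp2 sp3; have [k so] := s_oE nt.
have [sm [sm1 sm2 sm3]] := left_end_exists t lr.
have [_ [kp [_ _ _ spE]]] := s_pm_ends lr sm1 sm2 sm3 sp1 sp2 sp3.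
(* The polar angles of both parameters lie in a window shorter than a full turn, so [eta] is the
   plain difference. *)
have spL : sp < sigma t + L.
  rewrite -phi_mono_lt phi_period; apply: (lt_trans sp2).
  by have /andP[] := sigma_below t; have := pi0; lra.
have etaE : Defs.eta L (s_o C L Gamma t) (s_plus C L Gamma t lambda) = sp - sigma t.
  apply: (@eta_eq _ _ _ _ _ (k - kp) L0).
    by rewrite subr_ge0 (ltW sp1) ltrBlDl.
  by rewrite so spE intrB; ring.
apply/seteqP; split=> v.
  move=> [y [_ [_ [s sarc <-] [a ->]]] <-].
  rewrite dotDl dotZl dot_u_u' mulr0 addr0.
  exists (s + L * (- k)%:~R); last by rewrite (Gamma_period GammaP).
  move: sarc; rewrite /circle_arc /= etaE so in_itv/= mulrNz mulrN => /andP[h1 h2].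
  by apply/andP; split; lra.
move=> [s]; rewrite /= in_itv/= => /andP[h1 h2] <-.
exists (Gamma (s + L * k%:~R) +
  (support_inf C t + lambda - dot (Gamma (s + L * k%:~R)) (u t)) *: u t); last first.
  by rewrite dotDl dotZl dot_u_u' mulr0 addr0 (Gamma_period GammaP).
split; first by rewrite dotDl dotZl dot_u_u mulr1 addrC subrK.
exists (Gamma (s + L * k%:~R)); last by eexists.
exists (s + L * k%:~R) => //; rewrite /circle_arc /= etaE so.
by apply/andP; split; lra.
Qed.

(** * Bounds on the length of the semi-chord *)

Section semichord_bounds.
Variables (t lambda sp : R).
Hypothesis nt : ~ flat_angles t.
Hypothesis lambda_r : 0 < lambda < r.
Hypothesis sp_gt : sigma t < sp.
Hypothesis sp_lt : phi sp < t + 3 * (pi / 2).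
Hypothesis f_sp : f t sp = lambda.

Let Xg s := dot (Gamma s) (u' t).

Let Xg_cont : continuous Xg.
Proof.
move=> s; apply/cvgrPdist_le => e e0; near=> s'.
apply: (@le_trans _ _ `|s - s'|); last by near: s'; apply: cvgr_dist_le.
apply: le_trans (Gamma_dist s' s); apply: le_trans (norm_dot_u'_le _ t).
by rewrite dotBl.
Unshelve. all: by end_near. Qed.

Let Xg_within (A : set R) : {within A, continuous Xg}.
Proof. by apply: continuous_subspaceT => x; exact: Xg_cont. Qed.

Let lengthE : right_semichord_length C L Gamma t lambda =
  lebesgue_measure (Xg @` `[sigma t, sp]).
Proof.
rewrite /right_semichord_length /line_length.
by rewrite (semichord_image nt lambda_r sp_gt sp_lt f_sp).
Qed.

Let measurable_image : measurable (Xg @` `[sigma t, sp]).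
Proof.
apply: closed_measurable; apply: compact_closed; first exact: Rhausdorff.
by apply: continuous_compact; [exact: Xg_within|exact: segment_compact].
Qed.

(** By continuity the image of the arc contains the whole interval between the coordinates of
    [Gamma s] and of the end of the face. *)
Lemma offset_le_semichord s : sigma t <= s <= sp -> 0 <= q t s ->
  ((q t s)%:E <= right_semichord_length C L Gamma t lambda)%E.
Proof.
move=> /andP[s1 s2] q0; rewrite lengthE.
have qX : q t s = Xg (sigma t) - Xg s by rewrite /q dotBl.
have -> : ((q t s)%:E = lebesgue_measure `[Xg s, Xg (sigma t)]%classic)%E.
  rewrite lebesgue_measure_itv/= lte_fin -EFinB qX.
  by case: ltP => //; rewrite -subr_le0 -qX => q1; congr EFin; apply/eqP; rewrite eq_le q0 q1.
rewrite le_measure ?inE// => v /=; rewrite in_itv/= => /andP[v1 v2].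
have [||x] := @IVT _ Xg (sigma t) s v s1.
- exact: Xg_within.
- by rewrite ge_min le_max v1 v2 orbT.
rewrite in_itv/= => /andP[x1 x2] <-; exists x => //=.
by rewrite in_itv/= x1 (le_trans x2).
Qed.

Lemma semichord_le_bounds (a b : R) : a <= b ->
  (forall s, sigma t <= s <= sp -> a <= q t s <= b) ->
  (right_semichord_length C L Gamma t lambda <= (b - a)%:E)%E.
Proof.
move=> ab hq; rewrite lengthE.
have -> : (b - a)%:E = lebesgue_measure `[Xg (sigma t) - b, Xg (sigma t) - a]%classic.
  rewrite lebesgue_measure_itv/= lte_fin -EFinB ltrD2l ltrN2.
  move: ab; rewrite le_eqVlt => /predU1P[->|->]; first by rewrite ltxx subrr.
  by congr EFin; ring.
rewrite le_measure ?inE// => _ [s hs <-]; move: hs; rewrite /= in_itv/= => /hq/andP[].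
rewrite in_itv/=; rewrite /q dotBl -/(Xg _) -/(Xg _) => h1 h2.
by apply/andP; split; lra.
Qed.

(* The tangent at a corner may lean to the left by more than a right angle; the
   arc still stays to the right of the segment from the corner to c. *)
Lemma offset_ge s : sigma t <= s <= sp -> - (D / r * lambda) <= q t s.
Proof.
move=> /andP[s1 s2]; have /andP[l0 _] := lambda_r.
have fs : f t s <= lambda.
  move: s2; rewrite le_eqVlt => /predU1P[->|s2]; first by rewrite f_sp.
  by rewrite -f_sp ltW// height_inc// ltW.
have c1 : 0 <= cross (p (sigma t)) (p s).
  rewrite !p_polar crossZl crossZr cross_uu !mulr_ge0// sin_ge0_pi//.
  rewrite subr_ge0 phi_mono s1/=.
  have : phi s <= phi sp by rewrite phi_mono.
  by have /andP[] := sigma_below t; have := sp_lt; lra.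
have hs := height_sigma t; rewrite fE in hs.
have qE : q t s = dot (p (sigma t)) (u' t) - dot (p s) (u' t).
  by rewrite /q /p !dotBl; ring.
have d1 : `|dot (p (sigma t)) (u' t)| <= D.
  by apply: le_trans (norm_dot_u'_le _ t) _; exact: rho_le.
have fs' := fE t s; have fs0 := height_ge0 t s.
have c2 : cross (p (sigma t)) (p s) = H t * q t s - dot (p (sigma t)) (u' t) * f t s.
  rewrite (cross_frame t) qE fs'; have -> : dot (p (sigma t)) (u t) = - H t by lra.
  ring.
rewrite c2 in c1.
have d2 : - (D * lambda) <= dot (p (sigma t)) (u' t) * f t s.
  have : `|dot (p (sigma t)) (u' t) * f t s| <= D * lambda.
    by rewrite normrM ler_pM// ger0_norm.
  by rewrite ler_norml => /andP[].
have [q0|q0] := leP 0 (q t s).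
  by apply: (le_trans _ q0); rewrite oppr_le0 mulr_ge0// ?divr_ge0// ltW.
have Hr := center_height_ge t; rewrite -/(h t) -/(H t) in Hr.
have rq : - (D * lambda) <= r * q t s by nra.
have e : r * (D / r * lambda) = D * lambda by field; rewrite gt_eqF.
by rewrite -subr_ge0 -(pmulr_rge0 _ r0); lra.
Qed.

End semichord_bounds.

(** The witness is the right end of the chord, cut off at the face of [t']; past the right end the
    height exceeds [lambda]. *)
Lemma semichord_ge t t' lambda : ~ flat_angles t -> 0 < lambda < r ->
  t <= t' <= t + eps0 ->
  exists s', [/\ sigma t <= s' <= sigma t',
     forall s, sigma t <= s <= sigma t' -> f t s <= lambda -> s <= s' &
     ((q t s')%:E <= right_semichord_length C L Gamma t lambda)%E].
Proof.
move=> nt lr tt'; have [sp [sp1 sp2 sp3]] := right_end_exists t lr.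
have /andP[t0 _] := tt'; have ss := sigma_nd t0.
have s1 : sigma t <= Num.min sp (sigma t') by rewrite le_min (ltW sp1).
exists (Num.min sp (sigma t')); split.
- by rewrite s1 ge_min lexx orbT.
- move=> s /andP[h1 h2] fs; rewrite le_min h2 andbT leNgt; apply/negP => sps.
  have : f t sp < f t s.
    by apply: (height_inc_arc tt') => //; exact: ltW.
  by rewrite sp3 ltNge fs.
- apply: (offset_le_semichord nt lr sp1 sp2 sp3); first by rewrite s1 ge_min lexx.
  have s2 : Num.min sp (sigma t') <= sigma t' by rewrite ge_min lexx orbT.
  have := offset_inc tt' (lexx _) s1 s2; rewrite offset_sigma subr0; apply: le_trans.
  have [d1 _] := dist_eps0 tt'; have := cos_eps0 d1; have := eps0_le => e1 _.
  have d0 : 0 <= t' - t by rewrite subr_ge0.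
  rewrite ger0_norm// in d1; rewrite mulr_ge0 ?subr_ge0//; nra.
Qed.

(** The constant has two sources: 1 / sin eps bounds the growth of the offset beyond the cut-off,
    and D / r, from [offset_ge], the part of the arc that leans back to the left of the face. *)
Lemma semichord_le eps : 0 < eps <= eps0 -> exists C0 l0,
  [/\ 0 <= C0, 0 < l0 & forall lambda t, 0 < lambda < l0 -> ~ flat_angles t ->
   exists s', [/\ sigma t <= s' <= sigma (t + eps),
     forall s, sigma t <= s <= s' -> f t s <= lambda &
     (right_semichord_length C L Gamma t lambda <= (q t s' + C0 * lambda)%:E)%E]].
Proof.
move=> /andP[e0 ee0].
have se : 0 < sin eps.
  by rewrite sin_gt0_pi// e0; have := eps0_pi; have := pi0; lra.
have se1 : 0 <= (sin eps)^-1 by rewrite invr_ge0 ltW.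
have Dr : 0 <= D / r by rewrite divr_ge0// ltW.
exists ((sin eps)^-1 + D / r), r; split=> //; first exact: addr_ge0.
move=> lambda t lr nt; have [sp [sp1 sp2 sp3]] := right_end_exists t lr.
have /andP[l0 _] := lr.
have tt' : t <= t + eps <= t + eps0 by rewrite lerDl (ltW e0) lerD2l.
have ss : sigma t <= sigma (t + eps) by apply: sigma_nd; rewrite lerDl ltW.
set s' := Num.min sp (sigma (t + eps)).
have s1 : sigma t <= s' by rewrite le_min (ltW sp1).
have s2 : s' <= sigma (t + eps) by rewrite ge_min lexx orbT.
have s3 : s' <= sp by rewrite ge_min lexx.
have fl s : sigma t <= s <= sp -> f t s <= lambda.
  move=> /andP[h1]; rewrite le_eqVlt => /predU1P[->|h2]; first by rewrite sp3.
  by rewrite -sp3 ltW// height_inc// ltW.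
exists s'; split.
- by rewrite s1.
- by move=> s /andP[h1 h2]; apply: fl; rewrite h1 (le_trans h2).
have -> : q t s' + ((sin eps)^-1 + D / r) * lambda =
  (q t s' + (sin eps)^-1 * lambda) - (- (D / r * lambda)) by ring.
have lo := offset_ge lr sp2 sp3.
have sl : 0 <= (sin eps)^-1 * lambda by rewrite mulr_ge0// ltW.
have up s : sigma t <= s <= sp -> q t s <= q t s' + (sin eps)^-1 * lambda.
  move=> /andP[h1 h2]; have [h3|h3] := leP s s'.
    apply: (@le_trans _ _ (q t s')); last by rewrite lerDl.
    rewrite -subr_ge0; apply: le_trans (offset_inc tt' h1 h3 s2).
    rewrite mulr_ge0 ?subr_ge0//; have := eps0_le; rewrite addrAC subrr add0r; nra.
  have s'E : s' = sigma (t + eps).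
    move: h3; rewrite /s' gt_min => /orP[h3|h3]; first by move: h2; rewrite leNgt h3.
    by rewrite min_r// (le_trans (ltW h3)).
  (* [Gamma s] is above the support line of direction [t + eps], which touches the boundary at [s'].
     In the frame of [t] this bounds the growth of [q] by cot eps times that of [f]. *)
  have := height_ge0 (t + eps) s; rewrite -[0](height_sigma (t + eps)) -s'E -subr_ge0.
  rewrite fB (dot_u_rot t) addrAC subrr add0r -fB.
  have -> : dot (Gamma s - Gamma s') (u' t) = - (q t s - q t s') by rewrite qB opprK.
  have f1 := fl s; rewrite h1 h2 in f1; have {}f1 := f1 isT.
  have f2 := height_ge0 t s'; have ce := cos_le1 eps.
  have ce0 : 0 <= cos eps.
    have : `|eps| <= eps0 by rewrite ger0_norm// ltW.
    by move=> /cos_eps0; lra.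
  move=> h4; rewrite -lerBlDl mulrC ler_pdivlMr//; nra.
apply: (semichord_le_bounds nt lr sp1 sp2 sp3).
- apply: (@le_trans _ _ 0); first by rewrite oppr_le0 mulr_ge0// ltW.
  have := up (sigma t); rewrite lexx (ltW sp1) => /(_ isT).
  by rewrite offset_sigma.
- by move=> s hs; rewrite lo// up.
Qed.

(** * Countability of the flat directions *)

Lemma face_mono_all t t' s s' : below t s -> f t s = 0 -> below t' s' -> f t' s' = 0 ->
  t < t' -> s <= s'.
Proof.
move=> h1 h2 h3 h4 tt'; have pi_0 := pi0.
have [lt|ge] := ltP t' (t + pi).
  by apply: (face_mono h1 h2 h3 h4); rewrite tt'.
apply: (@le_trans _ _ (sigma t)).
  by apply: le_sigma => //; have /andP[_ /ltW] := h1.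
apply: (@le_trans _ _ (sigma (t' - pi / 2))); first by apply: sigma_nd; lra.
apply: (face_mono (sigma_below _) (height_sigma _) h3 h4).
by apply/andP; split; lra.
Qed.

(** Distinct faces overlap in at most an end point, so a rational parameter strictly inside each
    flat face determines its direction. *)
Lemma flat_angles_countable : countable flat_angles.
Proof.
have /choice[w hw] : forall t, exists x : rat, flat_angles t ->
    exists s, [/\ s < ratr x, ratr x < sigma t, f t s = 0 & below t s].
  move=> t; have [[s [s1 s2 s3]]|nt] := pselect (flat_angles t); last by exists 0.
  have [x] := rat_in_itvoo s1; rewrite in_itv/= => /andP[x1 x2].
  by exists x => _; exists s.
apply/countable_injP; exists (pickle \o w) => t t' /[!inE] ht ht' /(pcan_inj pickleK) ww.
have [s [s1 s2 s3 s4]] := hw t ht; have [s' [s1' s2' s3' s4']] := hw t' ht'.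
apply/eqP/negPn/negP; rewrite neq_lt => /orP[lt|lt].
  have := face_mono_all (sigma_below t) (height_sigma t) s4' s3' lt.
  by rewrite ww in s2; lra.
have := face_mono_all (sigma_below t') (height_sigma t') s4 s3 lt.
by rewrite -ww in s2'; lra.
Qed.

(** * Measurability of the height and the offset *)

Let cont_coord1 : continuous (fun s => (Gamma s).1 : R).
Proof.
move=> s; apply/cvgrPdist_le => e e0; near=> s'.
apply: (@le_trans _ _ `|s - s'|); last by near: s'; apply: cvgr_dist_le.
apply: le_trans (Gamma_dist s' s); apply: le_trans (norm_dot_u_le _ 0).
by rewrite /dot /= cos0 sin0 !mulr1 !mulr0 addr0.
Unshelve. all: by end_near. Qed.

Let cont_coord2 : continuous (fun s => (Gamma s).2 : R).
Proof.
move=> s; apply/cvgrPdist_le => e e0; near=> s'.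
apply: (@le_trans _ _ `|s - s'|); last by near: s'; apply: cvgr_dist_le.
apply: le_trans (Gamma_dist s' s); apply: le_trans (norm_dot_u'_le _ 0).
by rewrite /dot /= cos0 sin0 oppr0 !mulr1 !mulr0 add0r.
Unshelve. all: by end_near. Qed.

Let m1 : measurable_fun setT (fun s => (Gamma s).1 : R).
Proof. exact: continuous_measurable_fun. Qed.

Let m2 : measurable_fun setT (fun s => (Gamma s).2 : R).
Proof. exact: continuous_measurable_fun. Qed.

Let ms : measurable_fun setT sigma.
Proof. by apply: nondecreasing_measurable => //; exact: sigma_nd. Qed.

Let mc1 : measurable_fun setT (fun z : R * R => (Gamma z.2).1 : R).
Proof. exact: (measurableT_comp m1 measurable_snd). Qed.

Let mc2 : measurable_fun setT (fun z : R * R => (Gamma z.2).2 : R).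
Proof. exact: (measurableT_comp m2 measurable_snd). Qed.

Let msc1 : measurable_fun setT (fun z : R * R => (Gamma (sigma z.1)).1 : R).
Proof. exact: (measurableT_comp (measurableT_comp m1 ms) measurable_fst). Qed.

Let msc2 : measurable_fun setT (fun z : R * R => (Gamma (sigma z.1)).2 : R).
Proof. exact: (measurableT_comp (measurableT_comp m2 ms) measurable_fst). Qed.

Let mcos : measurable_fun setT (fun z : R * R => cos z.1).
Proof.
apply: (measurableT_comp (f := @cos R)); last exact: measurable_fst.
by apply: continuous_measurable_fun; exact: continuous_cos.
Qed.

Let msin : measurable_fun setT (fun z : R * R => sin z.1).
Proof.
apply: (measurableT_comp (f := @sin R)); last exact: measurable_fst.
by apply: continuous_measurable_fun; exact: continuous_sin.
Qed.

(** The support value, an infimum over uncountably many points, is rewritten as the level of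
    [Gamma (sigma t)], which is measurable because [sigma] is monotone. *)
Lemma measurable_height : measurable_fun setT (fun z : R * R => f z.1 z.2).
Proof.
rewrite (_ : (fun z => _) = (fun z : R * R =>
  ((Gamma z.2).1 - (Gamma (sigma z.1)).1) * cos z.1 +
  ((Gamma z.2).2 - (Gamma (sigma z.1)).2) * sin z.1)); last first.
  apply/funext => z; rewrite -[LHS]subr0 -(height_sigma z.1) /f /dot /=.
  by ring.
by apply: measurable_funD; apply: measurable_funM => //; apply: measurable_funB.
Qed.

Lemma measurable_offset : measurable_fun setT (fun z : R * R => q z.1 z.2).
Proof.
rewrite (_ : (fun z => _) = (fun z : R * R =>
  ((Gamma (sigma z.1)).2 - (Gamma z.2).2) * cos z.1 -
  ((Gamma (sigma z.1)).1 - (Gamma z.2).1) * sin z.1)); last first.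
  by apply/funext => z; rewrite /q /dot /=; ring.
by apply: measurable_funB; apply: measurable_funM => //; apply: measurable_funB.
Qed.

(** * The perimeter portion *)

Section portion.
Variables alpha beta : R.
Hypothesis ab : alpha < beta.
Hypothesis ba : beta <= alpha + 2 * pi.

Let hit s := exists2 t, alpha < t <= beta & f t s = 0.

Let hit_period (k : int) s : hit s -> hit (s + L * k%:~R).
Proof. by move=> [t tab ft]; exists t => //; rewrite height_period. Qed.

(** [exists_face] yields a direction [t1], possibly [alpha] itself. That case is excluded by
    right-continuity: [sigma] stays at most [s] a little beyond [alpha], against the maximality of
    [t1]. *)
Let hit_in s : sigma alpha < s < sigma beta -> hit s.
Proof.
move=> /andP[sa sb].
have M0 : 0 <= 4 * D by rewrite mulr_ge0.
have sab : sigma alpha <= s <= sigma beta by rewrite !ltW.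
have [t1 [/andP[at1 t1b] f1 _ h4]] := exists_face M0 M0 height_ge0 height_subgrad
  offset_bound sigma_nd eps0_gt0 height_small (ltW ab) sab.
exists t1 => //; rewrite t1b andbT lt_neqAle at1 andbT; apply/eqP => e.
have [|d d0 sd] := @sigma_rc alpha (s - sigma alpha); first by rewrite subr_gt0.
pose t := Num.min beta (alpha + d).
have at_ : alpha < t by rewrite lt_min ab ltrDl.
have : t <= t1.
  apply: h4; first by rewrite (ltW at_) ge_min lexx.
  apply: (@le_trans _ _ (sigma (alpha + d))); first by rewrite sigma_nd// ge_min lexx orbT.
  by apply: (le_trans sd); rewrite addrC subrK.
by rewrite -e leNgt at_.
Qed.

(** The lift of [s] on the face of [t] lies between [sigma alpha] and [sigma beta]. As [s] is in the
    first period after [sigma alpha], the lift cannot precede it. *)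
Let hit_out s : sigma alpha <= s < sigma alpha + L -> hit s -> s <= sigma beta.
Proof.
move=> /andP[sa sL] [t /andP[at_ tb] ft].
have [k bk] := face_in_window ft.
have fk : f t (s + L * k%:~R) = 0 by rewrite height_period.
have h1 : s + L * k%:~R <= sigma beta.
  apply: (@le_trans _ _ (sigma t)); last exact: sigma_nd.
  by apply: le_sigma => //; have /andP[_ /ltW] := bk.
have h2 : sigma alpha <= s + L * k%:~R.
  exact: face_mono_all (sigma_below alpha) (height_sigma alpha) bk fk at_.
apply: le_trans h1; rewrite lerDl mulr_ge0 ?(ltW L0)// ler0z leNgt; apply/negP => k0.
have : L * k%:~R <= - L.
  rewrite -mulrN1 ler_pM2l// -[-1]/((-1)%:~R) ler_int.
  by case: k k0 {bk fk h2} => [n|[|n]].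
lra.
Qed.

(** [sigma] marks the end of a face, so the face of [beta] is counted and that of [alpha] is not, as
    the half-open interval requires. The bound on [beta] keeps the increment of [sigma] within one
    period. *)
Lemma perimeter_portionE :
  perimeter_portion C L Gamma `]alpha, beta] = (sigma beta - sigma alpha)%:E.
Proof.
have sab : sigma alpha <= sigma beta by exact/sigma_nd/ltW.
have sba : sigma beta <= sigma alpha + L by rewrite -sigma_period sigma_nd.
have [k /andP[ka kL]] := period_reduce 0 (sigma alpha) L0; rewrite add0r in kL.
set a := sigma alpha + L * k%:~R in ka kL.
pose b := sigma beta + L * k%:~R; pose m := Num.min b L.
have baE : sigma beta - sigma alpha = b - a by rewrite /a /b; ring.
have ab' : a <= b by rewrite /a /b; lra.
have baL : b <= a + L by rewrite /a /b; lra.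
have am : a <= m by rewrite le_min ab' ltW.
have hL s : hit s -> hit (s + L) by move=> /(hit_period 1); rewrite mulr1.
have hNL s : hit (s + L) -> hit s by move=> /(hit_period (-1)); rewrite mulrN1 addrK.
have in_ab s : a < s < b -> hit s.
  move=> /andP[h1 h2]; rewrite -[s](subrK (L * k%:~R)); apply: hit_period; apply: hit_in.
  by apply/andP; split; [move: h1; rewrite /a; lra|move: h2; rewrite /b; lra].
have out_ab s : a <= s < a + L -> hit s -> s <= b.
  move=> /andP[h1 h2] /(hit_period (- k)) hs; have := hit_out _ hs.
  rewrite mulrNz mulrN => hh; rewrite /b -lerBlDr; apply: hh.
  by apply/andP; split; [move: h1; rewrite /a; lra|move: h2; rewrite /a; lra].
(* The arc from [a] to [b] may run past [L]; the excess reappears from 0 to [b - L]. Which of the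
   end points are hit is left open, as they have measure 0. *)
pose A : set R := `]a, m[ `|` `]0, b - L[.
pose F : set R := [set a; m] `|` [set 0; b - L].
have mA : measurable A by apply: measurableU.
have fF : finite_set F by rewrite finite_setU; split; exact: finite_set2.
rewrite /perimeter_portion; set S := [set s | _].
have SE s : S s <-> 0 <= s < L /\ hit s.
  split=> -[sL].
    case=> t [nt]; rewrite /= in_itv/= => tab; split=> //; exists t => //.
    by rewrite /f nt subrr.
  case=> t tab ft; split=> //; exists t; split; last by rewrite /= in_itv.
  by rewrite /nu /=; move/eqP: ft; rewrite subr_eq0 => /eqP.
have AS : A `<=` S.
  move=> s [|] /=; rewrite in_itv/= => /andP[h1 h2]; apply/SE.
    move: h2; rewrite lt_min => /andP[h2 h3]; split; last by apply: in_ab; rewrite h1.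
    by rewrite h3 andbT ltW// (le_lt_trans ka).
  split; first by rewrite (ltW h1)/=; lra.
  by apply/hNL/in_ab/andP; split; lra.
have SAF : S `<=` A `|` F.
  move=> s /SE[/andP[s0 sL] hs]; have [as_|sa] := leP a s.
    have sb : s <= b by apply: out_ab => //; rewrite as_/=; lra.
    have sm : s <= m by rewrite le_min sb ltW.
    move: as_ sm; rewrite !le_eqVlt => /predU1P[e|h1]; first by right; left; left.
    move=> /predU1P[e|h2]; first by right; left; right.
    by left; left; rewrite /= in_itv/= h1.
  have sb : s + L <= b by apply: out_ab; [apply/andP; split; lra|exact: hL].
  have {}sb : s <= b - L by rewrite lerBrDr.
  move: s0 sb; rewrite !le_eqVlt => /predU1P[e|h1]; first by right; right; left.
  move=> /predU1P[e|h2]; first by right; right; right.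
  by left; right; rewrite /= in_itv/= h1.
have [_ ->] := measure_between mA fF AS SAF.
have -> : lebesgue_measure A =
    (lebesgue_measure `]a, m[%classic + lebesgue_measure `]0%R, (b - L)%R[%classic)%E.
  apply: measureU => //; apply/seteqP; split=> x //= -[].
  rewrite !in_itv/= => /andP[h1 _] /andP[_ h2].
  by exfalso; lra.
rewrite !lebesgue_measure_itv/= !lte_fin baE /m.
have [bL|Lb] := leP b L.
  rewrite [0 < b - L]ltNge subr_le0 bL /= adde0.
  by move: ab'; rewrite le_eqVlt => /predU1P[->|->]; rewrite ?ltxx ?subrr// EFinB.
by rewrite kL subr_gt0 Lb -!EFinB -EFinD; congr EFin; ring.
Qed.

Lemma cvg_semichord :
  (((2 * lambda)^-1)%:E *
     \int[lebesgue_measure]_(theta in `]alpha, beta])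
       (right_semichord_length C L Gamma theta lambda ^+ 2))%E
    @[lambda --> 0^'+]
  --> perimeter_portion C L Gamma `]alpha, beta].
Proof.
rewrite perimeter_portionE.
have D40 : 0 <= 4 * D by rewrite mulr_ge0.
have e1 : eps0 <= 1 by have := eps0_le; lra.
have mflat : measurable flat_angles.
  by apply: countable_measurable => //; exact: flat_angles_countable.
have flat0 : lebesgue_measure flat_angles = 0%E.
  by apply: countable_lebesgue_measure0; exact: flat_angles_countable.
apply: (cvg_integral_Kl (Kl := fun lambda t => right_semichord_length C L Gamma t lambda)
  D40 D40 height_ge0 height_subgrad offset_bound measurable_height measurable_offset
  sigma_nd eps0_gt0 e1 offset_sigma offset_inc height_small offset_lip height_inc_arc
  sigma_rc ab mflat flat0).
- by move=> lambda t; exact: measure_ge0.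
- exact: semichord_le.
- by exists r => // lambda t t' lr nt; exact: semichord_ge.
Qed.

End portion.

End polar.
Theorem proposition3p7 (R : realType) (C : set (plane R)) (L : R)
    (Gamma : R -> plane R) (alpha beta : R) :
  convex_body C ->
  arclength_param C L Gamma ->
  alpha < beta <= alpha + 2 * pi ->
  (((2 * lambda)^-1)%:E *
     \int[lebesgue_measure]_(theta in `]alpha, beta])
       (right_semichord_length C L Gamma theta lambda ^+ 2))%E
    @[lambda --> 0^'+]
  --> perimeter_portion C L Gamma `]alpha, beta].
Proof.
move=> [[M [_ CM]] cC [c Cc]] GammaP /andP[ab ba].
have [r r0 rC] := (iffLR (interior_enorm C c)) Cc.
have [phi [phi_cont phi_polar phi_period]] := param_ccw GammaP Cc.
(* [bounded_set] bounds the maximum norm; the factor 2 covers the passage to the Euclidean norm. *)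
have CD y : C y -> enorm (y - c) <= 2 * (M + 1) + enorm c.
  move=> Cy; have : `|y| <= M + 1 by apply: (CM (M + 1)) => //; rewrite ltrDl.
  rewrite /Num.norm/= ge_max => /andP[y1 y2].
  apply: (le_trans (enormD _ _)); rewrite enormN lerD2r.
  have M0 : 0 <= M + 1 by apply: le_trans y1; exact: normr_ge0.
  rewrite enorm_le ?mulr_ge0// /dot.
  have : `|y.1| ^+ 2 <= (M + 1) ^+ 2 by rewrite lerXn2r ?nnegrE.
  have : `|y.2| ^+ 2 <= (M + 1) ^+ 2 by rewrite lerXn2r ?nnegrE.
  rewrite !real_normK ?num_real//; nra.
exact: (cvg_semichord cC GammaP r0 rC CD phi_cont phi_polar phi_period ab ba).
Qed.
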